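(* Let $f=f^{(0)}+\dots+f^{(m)}:\mathbb{C}^n\to\mathbb{C}^n$ be a polynomial vector field ($f^{(i)}$ homogeneous of degree $i$, $f^{(m)}\ne0$) satisfying properties E and S, and let $\phi_1,\dots,\phi_{n-1}$ be irreducible, pairwise relatively prime semi-invariants of $f$ of degrees $r_1,\dots,r_{n-1}$. Then $\prod_{i=1}^{n-1}r_i\le\frac{m^n-1}{m-1}$.
   Context: Here $\frac{m^n-1}{m-1}$ means $\sum_{i=0}^{n-1}m^i$. A semi-invariant of $f$ is a nonconstant polynomial $\psi$ with $X_f(\psi)=\lambda\psi$ for some polynomial $\lambda$, $X_f=\sum f_i\partial/\partial x_i$. Poincaré transform: for $v\ne0$ choose regular $T$ with $Tv=e_1$, put $F=T\circ f\circ T^{-1}$, $G_i(x_1,\dots,x_{n+1})=\sum_{j=0}^mF_i^{(j)}(x_1,\dots,x_n)x_{n+1}^{m-j}$, and let $f_v^*(x_2,\dots,x_{n+1})$ have components $-G_1x_k+G_k$ ($2\le k\le n$) and $-G_1x_{n+1}$, evaluated at $(1,x_2,\dots,x_{n+1})$. Property E: for every $v\ne0$ with $f^{(m)}(v)\in\mathbb{C}v$ (equivalently, $0$ is stationary for $f_v^*$), the eigenvalues $\lambda_1,\dots,\lambda_n$ of $Df_v^*(0)$ are linearly independent over $\mathbb{Q}$, or satisfy $\dim_{\mathbb{Q}}(\sum\mathbb{Q}\lambda_i)=n-1$ together with $\sum m_i\lambda_i=0$ for some positive integers $m_i$. Property S: every proper homogeneous (i.e. stable under scalar multiplication) algebraic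 subvariety $Y\subsetneq\mathbb{C}^n$ with $\dim Y\ge1$ that is invariant for $\dot x=f^{(m)}(x)$ contains a line $\mathbb{C}v$, $v\ne0$, with $f^{(m)}(v)\in\mathbb{C}v$. *)

(* Defs.v *)
From HB Require Import structures.
From mathcomp Require Import all_boot all_order all_algebra.
From mathcomp Require Import mpoly.
From mathcomp Require Import complex.
From mathcomp Require Import reals.
From Stdlib Require List.

Set Implicit Arguments.
Unset Strict Implicit.
Unset Printing Implicit Defensive.

Import Order.TTheory GRing.Theory Num.Theory.
Local Open Scope ring_scope.

Section PolyVF.
Variables (C : fieldType) (n : nat).

Definition point := 'I_n -> C.

Definition hpart (d : nat) (p : {mpoly C[n]}) : {mpoly C[n]} := pihomog mdeg d p.

Definition tdeg (p : {mpoly C[n]}) : nat := (msize p).-1.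

Definition nonconstant (p : {mpoly C[n]}) : Prop := (1 < msize p)%N.

Definition Xder (f : 'I_n -> {mpoly C[n]}) (p : {mpoly C[n]}) : {mpoly C[n]} :=
  \sum_(i < n) f i * mderiv i p.

Definition semi_invariant (f : 'I_n -> {mpoly C[n]}) (psi : {mpoly C[n]}) : Prop :=
  nonconstant psi /\ exists lam : {mpoly C[n]}, Xder f psi = lam * psi.

Definition mdivides (d p : {mpoly C[n]}) : Prop := exists q, p = d * q.

Definition mirreducible (p : {mpoly C[n]}) : Prop :=
  nonconstant p /\
  forall a b : {mpoly C[n]}, p = a * b -> ~ nonconstant a \/ ~ nonconstant b.

Definition rel_prime (p q : {mpoly C[n]}) : Prop :=
  forall d, mdivides d p -> mdivides d q -> ~ nonconstant d.

Definition topf (f : 'I_n -> {mpoly C[n]}) (m : nat) : 'I_n -> {mpoly C[n]} :=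
  fun i => hpart m (f i).

Definition has_degree (f : 'I_n -> {mpoly C[n]}) (m : nat) : Prop :=
  (forall i, (msize (f i) <= m.+1)%N) /\ (exists i, topf f m i != 0).

Definition nonzero_pt (v : point) : Prop := exists i, v i != 0.

Definition in_line (g : 'I_n -> {mpoly C[n]}) (v : point) : Prop :=
  exists c : C, forall i, (g i).@[v] = c * v i.

Definition Xn (k : nat) : {mpoly C[n]} :=
  if (insub k : option 'I_n) is Some i then 'X_i else 0.

Definition conjF (f : 'I_n -> {mpoly C[n]}) (T : 'M[C]_n) (i : 'I_n) : {mpoly C[n]} :=
  \sum_(j < n) T i j *:
     (f j \mPo [tuple (\sum_(l < n) (invmx T) k l *: 'X_l) | k < n]).

(* substitution x_1 := 1, x_k := y_{k-1} (1-based), i.e. 0-based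
   x_0 := 1, x_k := y_{k-1}; the new variables y_0..y_{n-1} stand for
   x_2, ..., x_{n+1} *)
Definition dehom_sub : n.-tuple {mpoly C[n]} :=
  [tuple (if (k : nat) == 0%N then 1 else Xn k.-1) | k < n].

(* G_k (0-based k) evaluated at x_1 = 1, as a polynomial in y_0..y_{n-1};
   the homogenizing variable x_{n+1} is y_{n-1} *)
Definition Gdeh (f : 'I_n -> {mpoly C[n]}) (m : nat) (T : 'M[C]_n) (k : nat)
  : {mpoly C[n]} :=
  let Fk := if (insub k : option 'I_n) is Some i then conjF f T i else 0 in
  \sum_(j < m.+1) ((hpart j Fk) \mPo dehom_sub) * Xn n.-1 ^+ (m - j).

(* Poincare transform f_v^* (the dependence on v is through T, T v = e_1) *)
Definition poincare (f : 'I_n -> {mpoly C[n]}) (m : nat) (T : 'M[C]_n)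
  (k : 'I_n) : {mpoly C[n]} :=
  if (k.+1 < n)%N then - Gdeh f m T 0 * Xn k + Gdeh f m T k.+1
  else - Gdeh f m T 0 * Xn n.-1.

Definition jacobian (P : 'I_n -> {mpoly C[n]}) (x : point) : 'M[C]_n :=
  \matrix_(i, j) (mderiv j (P i)).@[x].

Definition Qindep (lam : 'I_n -> C) (S : {set 'I_n}) : Prop :=
  forall c : 'I_n -> rat, (forall i, i \notin S -> c i = 0) ->
    \sum_(i < n) ratr (c i) * lam i = 0 -> forall i, c i = 0.

Definition Qdim (lam : 'I_n -> C) (d : nat) : Prop :=
  (exists S : {set 'I_n}, #|S| = d /\ Qindep lam S) /\
  (forall S : {set 'I_n}, Qindep lam S -> (#|S| <= d)%N).

Definition propE (f : 'I_n -> {mpoly C[n]}) (m : nat) : Prop :=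
  forall v : point, nonzero_pt v -> in_line (topf f m) v ->
  forall T : 'M[C]_n, T \in unitmx ->
    (forall i, \sum_(j < n) T i j * v j = ((i : nat) == 0%N)%:R) ->
  forall lam : 'I_n -> C,
    char_poly (jacobian (poincare f m T) (fun _ => 0)) =
      \prod_(i < n) ('X - (lam i)%:P) ->
    Qdim lam n \/
    (Qdim lam n.-1 /\
     exists mu : 'I_n -> nat, (forall i, (0 < mu i)%N) /\
       \sum_(i < n) (mu i)%:R * lam i = 0).

Definition algebraic_set (Y : point -> Prop) : Prop :=
  exists (k : nat) (P : 'I_k -> {mpoly C[n]}),
    forall x, Y x <-> (forall j, (P j).@[x] = 0).

Definition homogeneous_set (Y : point -> Prop) : Prop :=
  forall (c : C) (x : point), Y x -> Y (fun i => c * x i).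

Definition proper_set (Y : point -> Prop) : Prop := exists x, ~ Y x.

(* for an algebraic set, dim Y >= 1 iff Y is infinite *)
Definition infinite_set (Y : point -> Prop) : Prop :=
  ~ exists s : seq point, forall x, Y x -> List.In x s.

(* Y is invariant for x' = g(x): its vanishing ideal is stable under X_g *)
Definition invariant_set (g : 'I_n -> {mpoly C[n]}) (Y : point -> Prop) : Prop :=
  forall p : {mpoly C[n]}, (forall x, Y x -> p.@[x] = 0) ->
    forall x, Y x -> (Xder g p).@[x] = 0.

Definition propS (f : 'I_n -> {mpoly C[n]}) (m : nat) : Prop :=
  forall Y : point -> Prop,
    algebraic_set Y -> homogeneous_set Y -> proper_set Y -> infinite_set Y ->
    invariant_set (topf f m) Y ->
    exists v : point, nonzero_pt v /\ (forall c : C, Y (fun i => c * v i)) /\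
      in_line (topf f m) v.

End PolyVF.

(* Main.v *)
Require Import Defs.
From HB Require Import structures.
From mathcomp Require Import all_boot all_order all_algebra.
From mathcomp Require Import mpoly.
From mathcomp Require Import complex.
From mathcomp Require Import reals.
From mathcomp Require Import perm separable cyclotomic.
From mathcomp Require Import zify ring.
Import Order.TTheory GRing.Theory Num.Theory.
Local Open Scope ring_scope.

Set Implicit Arguments.
Unset Strict Implicit.
Unset Printing Implicit Defensive.

(* Let g be the top form of f, let p_i be the top form of phi_i, of degree r_i, and
   let Y be the set of common zeros of the p_i.  At a stationary line of g contained
   in Y, the Poincare transforms of the phi_i are semi-invariants of f_v^*; in
   coordinates diagonalising D f_v^*(0) property E leaves only a monomial as lowest
   form of each of them, and irreducibility and coprimality, used through the
   elimination of one variable, force these monomials to be distinct coordinates.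
   Hence the p_i intersect transversally along the line.  The points of Y where they
   do not form an invariant cone without stationary line, which property S reduces to
   the origin; so Y is a union of N stationary lines of transversal intersection.

   Comparing the dimension of the forms of degree D with that of the products p^a q,
   for q in a fixed supply of forms, yields prod r_i <= N as D grows.  For the
   upper bound, the N lines are rescaled to N(m-1)+1 nondegenerate zeros of g - x.  If
   F_1, ..., F_n have degree at most m and e_j are polynomials separating N' of their
   nondegenerate zeros, the products F^a e_j are linearly independent (compare lowest
   forms at the zeros); counting dimensions again, N' <= m^n. *)

(** * Homogeneous parts, order at the origin, derivations *)

(** Intersection multiplicities and convergent normal forms are avoided: numbers of points are read
    off leading coefficients of dimension counts, and local statements hold modulo an arbitrarily
    high order at a stationary point. Property E enters only as a sign condition: the coefficients
    of a rational relation between the eigenvalues are all zero, all positive or all negative. In at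
    least two variables this makes the eigenvalues distinct and nonzero, and of two monomials of
    equal weight it makes the one of smaller degree divide the other. The hyperplane at infinity
    occupies one diagonal coordinate, so the lowest monomials of the n-1 semi-invariants share the
    n-1 others without overlap, and the pigeonhole principle does the rest. Property S speaks of a
    full vanishing ideal, whereas computation shows stability of an ideal with explicit generators;
    the Nullstellensatz closes this gap, and a counting argument over the uncountable field proves
    it. The upper bound is also what makes the set of lines finite, so it precedes the use of the
    lower bound. *)

Section MpolyBasics.
Variables (K : fieldType) (n : nat).
Implicit Types (p q : {mpoly K[n]}) (m : 'X_{1..n}).

Lemma mpoly_gen_ind (P : {mpoly K[n]} -> Prop) :
  (forall c, P c%:MP) -> (forall i, P 'X_i) ->
  (forall p q, P p -> P q -> P (p + q)) ->
  (forall p q, P p -> P q -> P (p * q)) -> forall p, P p.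
Proof.
move=> PC PX PD PM p; rewrite (mpolyE p); apply: (big_ind P).
- by rewrite -mpolyC0.
- by move=> x y; apply: PD.
move=> m _; rewrite -mul_mpolyC; apply: (PM) => //.
rewrite mpolyXE_id; apply: (big_ind P).
- by rewrite -mpolyC1.
- by move=> x y; apply: PM.
- move=> i _; elim: (m i) => [|k IH]; first by rewrite expr0 -mpolyC1.
  by rewrite exprS; apply: PM.
Qed.

Lemma mcoeff_hpart d p m : (hpart d p)@_m = if mdeg m == d then p@_m else 0.
Proof.
rewrite /hpart pihomogE raddf_sum /=.
under eq_bigr do rewrite mcoeffZ mcoeffX.
case: ifP => [/eqP md|md].
  have [mp|mp] := boolP (m \in msupp p); last first.
    rewrite (memN_msupp_eq0 mp) big_seq_cond big1 // => m' /andP[m'p _].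
    by case: eqP => [e|]; rewrite ?mulr0 //; rewrite -e m'p in mp.
  rewrite big_mkcond (bigD1_seq m) ?msupp_uniq //= md !eqxx mulr1 big1 ?addr0 //.
  by move=> m' /negbTE ->; rewrite mulr0; case: ifP.
rewrite big1 // => m' /eqP m'd; case: eqP => [e|]; rewrite ?mulr0 //.
by rewrite -e m'd eqxx in md.
Qed.

Lemma hpart_homog d p : hpart d p \is d.-homog.
Proof. exact: pihomogP. Qed.

Lemma hpart_id d p : p \is d.-homog -> hpart d p = p.
Proof. exact: pihomog_dE. Qed.

Lemma homog_coeff0 d p m : p \is d.-homog -> mdeg m != d -> p@_m = 0.
Proof. exact: dhomog_nemf_coeff. Qed.

Lemma hpart_other d e p : p \is e.-homog -> d != e -> hpart d p = 0.
Proof.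
move=> hp de; apply/mpolyP => m; rewrite mcoeff_hpart mcoeff0.
case: eqP => // md; apply: (homog_coeff0 hp); by rewrite md.
Qed.

Lemma hpartZ d c p : hpart d (c *: p) = c *: hpart d p.
Proof. exact: linearZ. Qed.

Lemma hpartD d p q : hpart d (p + q) = hpart d p + hpart d q.
Proof. exact: raddfD. Qed.

Lemma hpart_sum d (I : Type) (r : seq I) (P : pred I) (F : I -> {mpoly K[n]}) :
  hpart d (\sum_(i <- r | P i) F i) = \sum_(i <- r | P i) hpart d (F i).
Proof. exact: raddf_sum. Qed.

Lemma hpart_mderiv d i p : hpart d (mderiv i p) = mderiv i (hpart d.+1 p).
Proof.
apply/mpolyP => m; rewrite mcoeff_hpart !mcoeff_deriv mcoeff_hpart.
by rewrite mdegD mdeg1 addn1 eqSS; case: ifP; rewrite ?mul0rn.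
Qed.

Lemma mderiv_homog d i p : p \is d.+1.-homog -> mderiv i p \is d.-homog.
Proof. by move=> /hpart_id <-; rewrite -hpart_mderiv hpart_homog. Qed.

Lemma euler d p : p \is d.-homog -> \sum_i 'X_i * mderiv i p = d%:R *: p.
Proof.
move=> /dhomogP hp; rewrite [in RHS](mpolyE p) scaler_sumr.
have -> : \sum_i 'X_i * mderiv i p =
   \sum_i \sum_(m <- msupp p) p@_m *: ('X_i * mderiv i 'X_[m]).
  apply: eq_bigr => i _; rewrite [in LHS](mpolyE p) linear_sum /= mulr_sumr.
  by apply: eq_bigr => m _; rewrite linearZ /= scalerAr.
rewrite exchange_big /= [LHS]big_seq [RHS]big_seq; apply: eq_bigr => m mp.
rewrite -scaler_sumr scalerA mulrC -scalerA; congr (_ *: _).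
have <- : mdeg m = d by exact: hp.
rewrite mdegE natr_sum scaler_suml; apply: eq_bigr => i _.
rewrite mderivX -scalerAr -mpolyXD; case: (posnP (m i)) => [->|mi].
  by rewrite !scale0r.
by rewrite addmC submK // lep1mP -lt0n.
Qed.

Lemma homog_eval d p (c : K) (v : 'I_n -> K) : p \is d.-homog ->
  p.@[fun i => c * v i] = c ^+ d * p.@[v].
Proof.
move=> /dhomogP hp; rewrite !mevalE mulr_sumr big_seq [RHS]big_seq.
apply: eq_bigr => m mp; rewrite mulrCA; congr (_ * _).
under eq_bigr do rewrite exprMn.
have <- : mdeg m = d by exact: hp.
by rewrite big_split /= prodrXr -mdegE.
Qed.

(** A lower bound for the vanishing order at the origin, satisfied by [0] for every [d]. Congruence
    modulo [ordge N] takes the place of formal power series. *)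
Definition ordge d p := forall m, (mdeg m < d)%N -> p@_m = 0.

Lemma ordge_0 d : ordge d 0. Proof. by move=> m _; rewrite mcoeff0. Qed.
Lemma ordgeD d p q : ordge d p -> ordge d q -> ordge d (p + q).
Proof. by move=> a b m md; rewrite mcoeffD a // b // addr0. Qed.
Lemma ordgeN d p : ordge d p -> ordge d (- p).
Proof. by move=> a m md; rewrite mcoeffN a // oppr0. Qed.
Lemma ordgeB d p q : ordge d p -> ordge d q -> ordge d (p - q).
Proof. by move=> a b; apply/ordgeD/ordgeN. Qed.
Lemma ordgeZ d c p : ordge d p -> ordge d (c *: p).
Proof. by move=> a m md; rewrite mcoeffZ a // mulr0. Qed.
Lemma ordgeW d e p : (e <= d)%N -> ordge d p -> ordge e p.
Proof. by move=> ed a m md; apply: a; apply: leq_trans ed. Qed.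

Lemma ordge_sum d (I : Type) (r : seq I) (P : pred I) (F : I -> {mpoly K[n]}) :
  (forall i, P i -> ordge d (F i)) -> ordge d (\sum_(i <- r | P i) F i).
Proof. by move=> H; elim/big_ind: _ => //; [exact: ordge_0|exact: ordgeD]. Qed.

Lemma ordgeM d e p q : ordge d p -> ordge e q -> ordge (d + e) (p * q).
Proof.
move=> a b m md; rewrite mcoeffM big1 // => k /eqP mk.
have : (mdeg k.1 < d)%N || (mdeg k.2 < e)%N.
  have aux a' b' c' : (c' < d + e)%N -> c' = (a' + b')%N -> (a' < d)%N || (b' < e)%N by lia.
  by apply: aux md _; rewrite -mdegD -mk.
by case/orP => H; rewrite ?(a _ H) ?(b _ H) ?mul0r ?mulr0.
Qed.

Lemma ordgeMr d p q : ordge d q -> ordge d (p * q).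
Proof. by move=> b; rewrite -[d]add0n; apply: ordgeM. Qed.
Lemma ordgeMl d p q : ordge d p -> ordge d (p * q).
Proof. by move=> b; rewrite mulrC; apply: ordgeMr. Qed.

Lemma ordgeXn d p k : ordge d p -> ordge (k * d) (p ^+ k).
Proof.
by move=> a; elim: k => [|k IH] //; rewrite exprS mulSn; apply: ordgeM.
Qed.

Lemma ordge_hpart0 d p e : ordge d p -> (e < d)%N -> hpart e p = 0.
Proof.
move=> a ed; apply/mpolyP => m; rewrite mcoeff_hpart mcoeff0.
by case: eqP => // md; apply: a; rewrite md.
Qed.

Lemma homog_ordge d p : p \is d.-homog -> ordge d p.
Proof. by move=> h m md; apply: (homog_coeff0 h); rewrite neq_ltn md. Qed.

Lemma ordge_mderiv d i p : ordge d p -> ordge d.-1 (mderiv i p).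
Proof.
move=> a m md; rewrite mcoeff_deriv a ?mul0rn // mdegD mdeg1.
by move: md; case: d {a} => //= d; rewrite addn1.
Qed.

Lemma ordge1P p : ordge 1 p <-> p.@[fun=> 0] = 0.
Proof.
have E : p.@[fun=> 0] = p@_0%MM.
  rewrite [in LHS](mpolyE p) raddf_sum /=.
  under eq_bigr do rewrite mevalZ mevalX.
  have H (m : 'X_{1..n}) : \prod_i (0 : K) ^+ m i = (m == 0%MM)%:R.
    case: eqP => [->|/eqP nz].
      by rewrite big1 // => i _; rewrite mnm0E expr0.
    have [i mi] : exists i, m i != 0%N.
      apply/existsP; apply: contraNT nz; rewrite negb_exists => /forallP H.
      by apply/eqP/mnmP => i; rewrite mnm0E; apply/eqP; rewrite -[_ == _]negbK.
    by rewrite (bigD1 i) //= expr0n (negbTE mi) mul0r.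
  under eq_bigr do rewrite H.
  rewrite [in RHS](mpolyE p) raddf_sum /=; apply: eq_bigr => m _.
  by rewrite mcoeffZ mcoeffX.
rewrite E; split => [->//|H m]; first by rewrite mdeg0.
by rewrite ltnS leqn0 mdeg_eq0 => /eqP ->.
Qed.

Lemma ordge_neq0 p : p != 0 ->
  exists d, ordge d p /\ hpart d p != 0.
Proof.
move=> nz; have ex : exists d, hpart d p != 0.
  exists (mdeg (mlead p)); apply: contraNneq nz => h0.
  have := mcoeff_hpart (mdeg (mlead p)) p (mlead p).
  by rewrite h0 mcoeff0 eqxx => /esym/eqP; rewrite mleadc_eq0.
exists (ex_minn ex); case: ex_minnP => d hd dmin; split=> // m md.
have := mcoeff_hpart (mdeg m) p m; rewrite eqxx => <-.
have [->|/dmin] := eqVneq (hpart (mdeg m) p) 0; first by rewrite mcoeff0.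
by rewrite leqNgt md.
Qed.

(** Common core of the product rules for lowest forms, top forms and homogeneous factors: the
    hypothesis discards every splitting of the degree [d + e] other than [(d, e)]. *)
Lemma hpartM_gen d e p q :
  (forall k1 k2 : 'X_{1..n}, (mdeg k1 + mdeg k2 = d + e)%N -> mdeg k1 != d ->
    p@_k1 * q@_k2 = 0) ->
  hpart (d + e) (p * q) = hpart d p * hpart e q.
Proof.
move=> H; apply/mpolyP => m; rewrite mcoeff_hpart.
case: eqP => md; last first.
  by rewrite (@homog_coeff0 (d + e)) ?dhomogM ?hpart_homog //; apply/eqP.
rewrite !mcoeffM; apply: eq_bigr => k /eqP mk.
have dk : (mdeg k.1 + mdeg k.2 = d + e)%N by rewrite -md [in RHS]mk mdegD.
rewrite !mcoeff_hpart; case: (eqVneq (mdeg k.1) d) => [kd|kd].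
  by move: dk; rewrite kd => /addnI ->; rewrite eqxx.
by rewrite H // mul0r.
Qed.

Lemma hpartM_low d e p q : ordge d p -> ordge e q ->
  hpart (d + e) (p * q) = hpart d p * hpart e q.
Proof.
move=> a b; apply: hpartM_gen => k1 k2 s; rewrite neq_ltn => /orP[h|h].
  by rewrite a // mul0r.
by rewrite (b k2) ?mulr0 //; lia.
Qed.

Lemma msize_le_coeff d p :
  (msize p <= d)%N <-> (forall m, (d <= mdeg m)%N -> p@_m = 0).
Proof.
split=> [h m dm|h].
  by apply/memN_msupp_eq0/msize_mdeg_ge/(leq_trans h).
rewrite msizeE; apply/bigmax_leqP_seq => m mp _.
by rewrite ltnNge; apply/negP => /h /eqP; rewrite mcoeff_eq0 mp.
Qed.

Lemma hpartM_top d e p q : (msize p <= d.+1)%N -> (msize q <= e.+1)%N ->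
  hpart (d + e) (p * q) = hpart d p * hpart e q.
Proof.
move=> /msize_le_coeff a /msize_le_coeff b.
apply: hpartM_gen => k1 k2 s; rewrite neq_ltn => /orP[h|h].
  by rewrite (b k2) ?mulr0 //; lia.
by rewrite a // mul0r.
Qed.

Lemma homog_msize_le d p : p \is d.-homog -> (msize p <= d.+1)%N.
Proof.
by move=> h; apply/msize_le_coeff => m dm; apply: (homog_coeff0 h); rewrite gtn_eqF.
Qed.

Lemma hpart_tdeg_neq0 p : p != 0 -> hpart (tdeg p) p != 0.
Proof.
move=> nz; have e : tdeg p = mdeg (mlead p) by rewrite /tdeg -(mlead_deg nz).
apply: contraNneq nz => h0; rewrite -mleadc_eq0.
have := mcoeff_hpart (tdeg p) p (mlead p).
by rewrite h0 mcoeff0 e eqxx => <-.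
Qed.

Lemma msize_mderiv d i p : (msize p <= d.+1)%N -> (msize (mderiv i p) <= d)%N.
Proof.
move=> /msize_le_coeff h; apply/msize_le_coeff => m md.
by rewrite mcoeff_deriv h ?mul0rn // mdegD mdeg1 addn1.
Qed.

Lemma msizeM_leq d e p q : (msize p <= d.+1)%N -> (msize q <= e.+1)%N ->
  (msize (p * q) <= (d + e).+1)%N.
Proof.
have [->|p0] := eqVneq p 0; first by rewrite mul0r msize0.
have [->|q0] := eqVneq q 0; first by rewrite mulr0 msize0.
move=> hp hq; rewrite msizeM //.
have aux a b : (a <= d.+1)%N -> (b <= e.+1)%N -> ((a + b).-1 <= (d + e).+1)%N by lia.
exact: aux.
Qed.

Lemma msize_sum_leq d (I : Type) (r : seq I) (P : pred I) (F : I -> {mpoly K[n]}) :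
  (forall i, P i -> (msize (F i) <= d)%N) ->
  (msize (\sum_(i <- r | P i) F i) <= d)%N.
Proof.
move=> H; elim/big_ind: _ => //; first by rewrite msize0.
by move=> x y hx hy; apply: (leq_trans (msizeD_le _ _)); rewrite geq_max hx.
Qed.

End MpolyBasics.

Lemma mderivXU (K : fieldType) n (i j : 'I_n) :
  mderiv j ('X_i : {mpoly K[n]}) = (i == j)%:R.
Proof.
rewrite mderivX mnm1E; case: eqP => [->|_]; last by rewrite scale0r.
rewrite scale1r; have -> : (U_(j) - U_(j))%MM = 0%MM :> 'X_{1..n}.
  by apply/mnmP => l; rewrite mnmBE subnn mnm0E.
by rewrite mpolyX0.
Qed.

(** * Derivations and the chain rule *)

Section Derivations.
Variables (K : fieldType) (n : nat).

(** Laws imposed on a bare function, so that [Xder f], [mderiv i] and constant directional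
    derivatives all fall under the same lemmas. *)
Record derivation (D : {mpoly K[n]} -> {mpoly K[n]}) : Prop := Derivation {
  derD : forall p q, D (p + q) = D p + D q;
  derM : forall p q, D (p * q) = D p * q + p * D q;
  derC : forall c, D c%:MP = 0 }.

Variables (D : {mpoly K[n]} -> {mpoly K[n]}) (dD : derivation D).

Lemma der0 : D 0 = 0. Proof. by rewrite -mpolyC0 derC. Qed.
Lemma derZ c p : D (c *: p) = c *: D p.
Proof. by rewrite -!mul_mpolyC derM // derC // mul0r add0r. Qed.
Lemma derN p : D (- p) = - D p.
Proof. by rewrite -!scaleN1r derZ. Qed.
Lemma derB p q : D (p - q) = D p - D q.
Proof. by rewrite derD // derN. Qed.
Lemma der_sum (I : Type) (r : seq I) (P : pred I) (F : I -> {mpoly K[n]}) :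
  D (\sum_(i <- r | P i) F i) = \sum_(i <- r | P i) D (F i).
Proof. exact: (big_morph D (derD dD) der0). Qed.

Lemma der_exp p k : D (p ^+ k) = (p ^+ k.-1 * D p) *+ k.
Proof.
elim: k => [|k IH]; first by rewrite expr0 -mpolyC1 derC // mulr0n.
rewrite exprS derM // IH /= mulrS [D p * _]mulrC; congr (_ + _).
by case: k {IH} => [|k]; rewrite ?mulr0n ?mulr0 // mulrnAr mulrA -exprS.
Qed.

Lemma der_comp k (p : {mpoly K[k]}) (t : k.-tuple {mpoly K[n]}) :
  D (p \mPo t) = \sum_(i < k) (mderiv i p \mPo t) * D (tnth t i).
Proof.
elim/mpoly_gen_ind: p => [c|i|p q IHp IHq|p q IHp IHq].
- rewrite comp_mpolyC derC // big1 // => i _.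
  by rewrite mderivC comp_mpoly0 mul0r.
- rewrite comp_mpolyXU (bigD1 i) //= mderivXU eqxx comp_mpoly1 mul1r (tnth_nth 0).
  rewrite big1 ?addr0 // => j /negbTE ji.
  by rewrite mderivXU eq_sym ji comp_mpoly0 mul0r.
- rewrite comp_mpolyD derD // IHp IHq -big_split; apply: eq_bigr => i _.
  by rewrite mderivD comp_mpolyD mulrDl.
- rewrite rmorphM derM // IHp IHq mulr_suml mulr_sumr -big_split.
  apply: eq_bigr => i _; rewrite mderivM comp_mpolyD !rmorphM /=; ring.
Qed.

End Derivations.

Lemma Xder_derivation (K : fieldType) n (f : 'I_n -> {mpoly K[n]}) :
  derivation (Xder f).
Proof.
split=> [p q|p q|c]; rewrite /Xder.
- by rewrite -big_split; apply: eq_bigr => i _; rewrite mderivD mulrDr.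
- rewrite mulr_suml mulr_sumr -big_split /=; apply: eq_bigr => i _.
  by rewrite mderivM; ring.
- by rewrite big1 // => i _; rewrite mderivC mulr0.
Qed.

Lemma mderiv_derivation (K : fieldType) n (i : 'I_n) :
  derivation (@mderiv n K i).
Proof.
by split=> [p q|p q|c]; rewrite ?mderivD ?mderivM ?mderivC.
Qed.


Lemma XderXU (K : fieldType) n (f : 'I_n -> {mpoly K[n]}) i :
  Xder f 'X_i = f i.
Proof.
rewrite /Xder (bigD1 i) //= mderivXU eqxx mulr1 big1 ?addr0 // => j /negbTE ji.
by rewrite mderivXU eq_sym ji mulr0.
Qed.

(** * Linear substitutions *)

(** A coefficient matrix with more rows than columns has a nonzero left kernel vector. Every
    dimension count below ends in this inequality. *)
Lemma span_card (K : fieldType) (V : lmodType K) (I J : finType)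
    (x : I -> V) (y : J -> V) (c : I -> J -> K) :
  (forall i, x i = \sum_j c i j *: y j) ->
  (forall u : I -> K, \sum_i u i *: x i = 0 -> forall i, u i = 0) ->
  (#|I| <= #|J|)%N.
Proof.
move=> xE free; rewrite leqNgt; apply/negP => lt.
pose M : 'M[K]_(#|I|, #|J|) := \matrix_(i, j) c (enum_val i) (enum_val j).
have : kermx M != 0.
  rewrite kermx_eq0 /row_free neq_ltn; apply/orP; left.
  exact: leq_ltn_trans (rank_leq_col M) lt.
move=> /rowV0Pn[u /sub_kermxP uM /negP u0]; apply: u0; apply/eqP/rowP => i.
rewrite mxE -(enum_valK i); apply: (free (fun i => u 0 (enum_rank i))).
under eq_bigr do rewrite xE scaler_sumr; rewrite exchange_big big1 //= => j _.
under eq_bigr do rewrite scalerA; rewrite -scaler_suml.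
suff -> : \sum_i0 u 0 (enum_rank i0) * c i0 j = 0 by rewrite scale0r.
transitivity ((u *m M) 0 (enum_rank j)); last by rewrite uM mxE.
rewrite mxE; apply: etrans (reindex (@enum_val I I) _) _.
  exact/onW_bij/enum_val_bij.
by apply: eq_bigr => k _; rewrite mxE !enum_valK enum_rankK.
Qed.

Lemma homog_prod_exp (K : fieldType) n (k : nat) (F : 'I_k -> {mpoly K[n]})
    (d e : 'I_k -> nat) : (forall i, F i \is (d i).-homog) ->
  \prod_i F i ^+ e i \is (\sum_i d i * e i).-homog.
Proof.
move=> H; elim/big_rec2: _ => [|i a p _ hp]; first exact: dhomog1.
by apply: dhomogM => //; apply: dhomogMn.
Qed.

Lemma homogX (K : fieldType) n (m : 'X_{1..n}) : 'X_[K, m] \is (mdeg m).-homog.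
Proof. by rewrite dhomogX. Qed.

Lemma homogXU (K : fieldType) n (i : 'I_n) : ('X_i : {mpoly K[n]}) \is 1.-homog.
Proof. by have := homogX K U_(i)%MM; rewrite mdeg1. Qed.

Section LinearSubst.
Variables (K : fieldType) (n : nat).
Implicit Types (A B T : 'M[K]_n) (p q : {mpoly K[n]}) (v : 'I_n -> K).

Definition mact A v : 'I_n -> K := fun k => \sum_l A k l * v l.

Lemma mact_mul A B v : mact (A *m B) v = mact A (mact B v).
Proof.
apply: boolp.funext => i; rewrite /mact.
under eq_bigr do rewrite mxE mulr_suml.
rewrite exchange_big; apply: eq_bigr => j _ /=; rewrite mulr_sumr.
by apply: eq_bigr => k _; rewrite mulrA.
Qed.

Lemma mact1 v : mact 1%:M v = v.
Proof.
apply: boolp.funext => i; rewrite /mact (bigD1 i) //= mxE eqxx mul1r.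
by rewrite big1 ?addr0 // => j /negbTE ji; rewrite mxE eq_sym ji mul0r.
Qed.

Lemma mactZ A c v : mact A (fun i => c * v i) = fun i => c * mact A v i.
Proof.
apply: boolp.funext => i; rewrite /mact mulr_sumr.
by apply: eq_bigr => j _; rewrite mulrCA.
Qed.

Lemma mactK T v : T \in unitmx -> mact (invmx T) (mact T v) = v.
Proof. by move=> uT; rewrite -mact_mul mulVmx // mact1. Qed.

Definition lsub A p : {mpoly K[n]} :=
  p \mPo [tuple (\sum_(l < n) A k l *: 'X_l) | k < n].

Lemma lsubD A p q : lsub A (p + q) = lsub A p + lsub A q.
Proof. exact: comp_mpolyD. Qed.
Lemma lsubM A p q : lsub A (p * q) = lsub A p * lsub A q.
Proof. exact: rmorphM. Qed.
Lemma lsub0 A : lsub A 0 = 0.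
Proof. exact: comp_mpoly0. Qed.
Lemma lsubC A c : lsub A c%:MP = c%:MP.
Proof. exact: comp_mpolyC. Qed.
Lemma lsubZ A c p : lsub A (c *: p) = c *: lsub A p.
Proof. exact: comp_mpolyZ. Qed.
Lemma lsub_sum A (I : Type) (r : seq I) (P : pred I) (F : I -> {mpoly K[n]}) :
  lsub A (\sum_(i <- r | P i) F i) = \sum_(i <- r | P i) lsub A (F i).
Proof. exact: raddf_sum. Qed.

Lemma lsubXU A i : lsub A 'X_i = \sum_(l < n) A i l *: 'X_l.
Proof. by rewrite /lsub comp_mpolyXU -tnth_nth tnth_mktuple. Qed.

Lemma lsub_eval A p v : (lsub A p).@[v] = p.@[mact A v].
Proof.
rewrite comp_mpoly_meval; apply: meval_eq => i.
rewrite tnth_mktuple raddf_sum; apply: eq_bigr => j _.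
by rewrite /= mevalZ mevalXU.
Qed.

Lemma lsub_comp A B p : lsub B (lsub A p) = lsub (A *m B) p.
Proof.
elim/mpoly_gen_ind: p => [c|i|p q IHp IHq|p q IHp IHq].
- by rewrite !lsubC.
- rewrite !lsubXU lsub_sum.
  under eq_bigr do rewrite lsubZ lsubXU scaler_sumr.
  rewrite exchange_big; apply: eq_bigr => l _ /=.
  by rewrite mxE scaler_suml; apply: eq_bigr => j _; rewrite scalerA.
- by rewrite !lsubD IHp IHq.
- by rewrite !lsubM IHp IHq.
Qed.

Lemma lsub1 p : lsub 1%:M p = p.
Proof.
elim/mpoly_gen_ind: p => [c|i|p q IHp IHq|p q IHp IHq].
- by rewrite !lsubC.
- rewrite lsubXU (bigD1 i) //= mxE eqxx scale1r big1 ?addr0 // => j /negbTE ji.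
  by rewrite mxE eq_sym ji scale0r.
- by rewrite !lsubD IHp IHq.
- by rewrite !lsubM IHp IHq.
Qed.

Lemma lsubK T p : T \in unitmx -> lsub T (lsub (invmx T) p) = p.
Proof. by move=> uT; rewrite lsub_comp mulVmx // lsub1. Qed.

Lemma lsubVK T p : T \in unitmx -> lsub (invmx T) (lsub T p) = p.
Proof. by move=> uT; rewrite lsub_comp mulmxV // lsub1. Qed.

Lemma lsub_eq0 T p : T \in unitmx -> lsub T p = 0 -> p = 0.
Proof. by move=> uT h; rewrite -(lsubVK p uT) h lsub0. Qed.

Lemma lsubX_homog A (m : 'X_{1..n}) : lsub A 'X_[m] \is (mdeg m).-homog.
Proof.
rewrite /lsub comp_mpolyX mdegE.
have -> : (\sum_i m i = \sum_i 1 * m i)%N by apply: eq_bigr => i _; rewrite mul1n.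
apply: homog_prod_exp => i; rewrite tnth_mktuple.
by apply: rpred_sum => j _; apply: rpredZ; exact: homogXU.
Qed.

Lemma hpart_lsub d A p : hpart d (lsub A p) = lsub A (hpart d p).
Proof.
rewrite (mpolyE p) lsub_sum !hpart_sum lsub_sum; apply: eq_bigr => m _.
rewrite lsubZ !hpartZ lsubZ; congr (_ *: _).
have := lsubX_homog A m; have hm := homogX K m.
case: (eqVneq d (mdeg m)) => [->|dm] hl; first by rewrite !hpart_id.
by rewrite !(@hpart_other _ _ _ (mdeg m)) ?lsub0.
Qed.

Lemma msize_leq_hpart d p : (msize p <= d)%N <-> (forall e, (d <= e)%N -> hpart e p = 0).
Proof.
split=> [/msize_le_coeff h e de|h].
  apply/mpolyP => m; rewrite mcoeff_hpart mcoeff0; case: eqP => // me.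
  by rewrite h // me.
apply/msize_le_coeff => m dm; have := mcoeff_hpart (mdeg m) p m.
by rewrite eqxx h // mcoeff0 => <-.
Qed.

Lemma lsub_msize_leq A p : (msize (lsub A p) <= msize p)%N.
Proof.
apply/msize_leq_hpart => e de; rewrite hpart_lsub.
by have /msize_leq_hpart -> // := leqnn (msize p); rewrite lsub0.
Qed.

Lemma lsub_msize T p : T \in unitmx -> msize (lsub T p) = msize p.
Proof.
move=> uT; apply/eqP; rewrite eqn_leq lsub_msize_leq /=.
by rewrite -{1}(lsubVK p uT) lsub_msize_leq.
Qed.

Lemma ordge_hpart d p : ordge d p <-> (forall e, (e < d)%N -> hpart e p = 0).
Proof.
split=> [h e ed|h m md]; first exact: ordge_hpart0 h ed.
by have := mcoeff_hpart (mdeg m) p m; rewrite h // mcoeff0 eqxx => <-.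
Qed.

Lemma lsub_ordge d A p : ordge d p -> ordge d (lsub A p).
Proof.
by move=> /ordge_hpart h; apply/ordge_hpart => e ed; rewrite hpart_lsub h // lsub0.
Qed.

Lemma mderiv_lsub j A p :
  mderiv j (lsub A p) = \sum_k A k j *: lsub A (mderiv k p).
Proof.
rewrite /lsub (der_comp (mderiv_derivation K j)); apply: eq_bigr => k _.
rewrite tnth_mktuple (der_sum (mderiv_derivation K j)) (bigD1 j) //= mderivZ mderivXU eqxx.
rewrite big1 ?addr0; first by rewrite -scalerAr mulr1.
by move=> l lj; rewrite mderivZ mderivXU (negbTE lj) scaler0.
Qed.

(** [conjF f T] is the push-forward of the field under [T]: after the chain rule, [invmx T] from the
    substitution cancels [T] from the conjugation. *)
Lemma Xder_conj (f : 'I_n -> {mpoly K[n]}) T p : T \in unitmx ->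
  Xder (conjF f T) (lsub (invmx T) p) = lsub (invmx T) (Xder f p).
Proof.
move=> uT; rewrite {1}/lsub (der_comp (Xder_derivation _)) /Xder lsub_sum.
apply: eq_bigr => k _; rewrite lsubM mulrC; congr (_ * _).
rewrite tnth_mktuple (_ : \sum_(i < n) _ = Xder (conjF f T) (\sum_(l < n) invmx T k l *: 'X_l)) //.
rewrite (der_sum (Xder_derivation _)).
under eq_bigr do rewrite (derZ (Xder_derivation _)) XderXU /conjF scaler_sumr.
rewrite exchange_big /=.
have E j : \sum_(i < n) invmx T k i *: (T i j *: lsub (invmx T) (f j)) =
   (k == j)%:R *: lsub (invmx T) (f j).
  under eq_bigr do rewrite scalerA.
  rewrite -scaler_suml; congr (_ *: _).
  by have := mulVmx uT => /matrixP/(_ k j); rewrite !mxE.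
rewrite (eq_bigr _ (fun j _ => E j)) (bigD1 k) //= eqxx scale1r big1 ?addr0 //.
by move=> j /negbTE jk; rewrite eq_sym jk scale0r.
Qed.

Lemma topf_conj (f : 'I_n -> {mpoly K[n]}) T d i :
  hpart d (conjF f T i) = conjF (topf f d) T i.
Proof.
rewrite /conjF hpart_sum; apply: eq_bigr => j _.
by rewrite hpartZ -/(lsub (invmx T) (f j)) hpart_lsub.
Qed.

Lemma conjF_eval (f : 'I_n -> {mpoly K[n]}) T i v :
  (conjF f T i).@[v] = mact T (fun j => (f j).@[mact (invmx T) v]) i.
Proof.
rewrite /conjF (raddf_sum (meval v)); apply: eq_bigr => j _.
by rewrite /= mevalZ -/(lsub (invmx T) (f j)) lsub_eval.
Qed.

Lemma conjF_msize (f : 'I_n -> {mpoly K[n]}) T d i :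
  (forall i, (msize (f i) <= d)%N) -> (msize (conjF f T i) <= d)%N.
Proof.
move=> H; apply: msize_sum_leq => j _; apply: (leq_trans (msizeZ_le _ _)).
exact: leq_trans (lsub_msize_leq _ _) (H j).
Qed.

End LinearSubst.

(** * A Nullstellensatz over uncountable fields *)

(** Each point costs one cut: if it lies left of the midpoint, the right half avoids it; otherwise
    the left quarter does, since the midpoint itself may be the point. *)
Lemma subinterval_avoiding (R : realType) (s : seq R) (a b : R) : a < b ->
  exists c d, [/\ a <= c, c < d, d <= b & forall x, x \in s -> ~ (c <= x <= d)].
Proof.
elim: s => [|x s IH] ab; first by exists a, b; split.
have [c [d [ac cd db av]]] := IH ab.
have [cm md] := (midf_lt cd); set m := (c + d) / 2 in cm md.
have [xm|mx] := ltP x m.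
  exists m, d; split=> //; first exact: le_trans ac (ltW cm).
  move=> y; rewrite inE => /orP[/eqP-> /andP[mx _]|/av h /andP[my yd]].
    by move: (lt_le_trans xm mx); rewrite ltxx.
  by apply: h; rewrite yd (le_trans (ltW cm) my).
have [cm' mm] := (midf_lt cm); set m' := (c + m) / 2 in cm' mm.
exists c, m'; split=> //; first exact: le_trans (ltW mm) (le_trans (ltW md) db).
move=> y; rewrite inE => /orP[/eqP-> /andP[_ xm]|/av h /andP[cy ym]].
  by move: (lt_le_trans mm (le_trans mx xm)); rewrite ltxx.
by apply: h; rewrite cy (le_trans ym) // (le_trans (ltW mm)) // ltW.
Qed.

(** Cantor's nested intervals: the interval of step k+1 avoids [S k], and the supremum of the left
    ends lies in all of them. *)
Lemma real_not_countable_union (R : realType) (S : nat -> seq R) :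
  exists x, forall k, x \notin S k.
Proof.
have step (kI : nat * {I : R * R | I.1 < I.2}) :
    exists J : {I : R * R | I.1 < I.2},
    [/\ (sval kI.2).1 <= (sval J).1, (sval J).2 <= (sval kI.2).2 &
     forall x, x \in S kI.1 -> ~ ((sval J).1 <= x <= (sval J).2)].
  case: kI => k [[a b] /= ab].
  have [c [d [ac cd db av]]] := subinterval_avoiding (S k) ab.
  by exists (exist _ (c, d) cd); split.
have [F HF] := boolp.choice step.
have ab0 : ((0, 1) : R * R).1 < ((0, 1) : R * R).2 by rewrite /= ltr01.
pose fix I k := if k is k'.+1 then F (k', I k') else exist _ (0, 1) ab0.
pose a k := (sval (I k)).1; pose b k := (sval (I k)).2.
have ab k : a k < b k by rewrite /a /b; case: (I k).
have aS k : a k <= a k.+1 by have [] := HF (k, I k).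
have bS k : b k.+1 <= b k by have [] := HF (k, I k).
have amono j k : (j <= k)%N -> a j <= a k.
  by move=> /subnKC <-; elim: (k - j)%N => [|l /le_trans]; rewrite ?addn0 // addnS; apply.
have bmono j k : (j <= k)%N -> b k <= b j.
  move=> /subnKC <-; elim: (k - j)%N => [|l h]; rewrite ?addn0 // addnS.
  exact: le_trans (bS _) h.
have aleb j k : a j <= b k.
  apply: le_trans (amono _ _ (leq_maxl j k)) _.
  exact: le_trans (ltW (ab _)) (bmono _ _ (leq_maxr j k)).
pose E : classical_sets.set R := fun x => exists k, x = a k.
have supE k : a k <= sup E <= b k.
  apply/andP; split.
    by apply: ub_le_sup; [exists (b 0%N) => _ [j ->]|exists k].
  by apply: ge_sup; [exists (a k); exists k|move=> _ [j ->]].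
exists (sup E) => k; apply/negP => Sk.
by have [_ _ /(_ _ Sk)] := HF (k, I k); apply; exact: (supE k.+1).
Qed.

(** Uncountability in pigeonhole form. The label [D] is chosen before [M], so that data read from
    the label can bound a dimension before the number of points is fixed. *)
Definition uncountable_type (K : eqType) := forall kappa : K -> nat,
  exists D, forall M, exists s : seq K, [/\ uniq s, size s = M & forall a, a \in s -> kappa a = D].

Lemma complex_uncountable (R : realType) : uncountable_type (complex R).
Proof.
move=> kappa; apply: boolp.contrapT => H.
have fin D : exists s : seq (complex R), forall a, kappa a = D -> a \in s.
  apply: boolp.contrapT => inf; apply: H; exists D; elim=> [|M [s [us ss hs]]].
    by exists [::]; split.
  have [a ka as'] : exists2 a, kappa a = D & a \notin s.
    apply: boolp.contrapT => no; apply: inf; exists s => a ka.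
    by rewrite -[_ \in _]negbK; apply/negP => as'; apply: no; exists a.
  exists (a :: s); split; rewrite /= ?as' ?ss // => x.
  by rewrite inE => /orP[/eqP->|/hs].
have [S HS] := boolp.choice fin.
have [x] := real_not_countable_union (fun k => [seq complex.Re z | z <- S k]).
pose z := real_complex R x; move=> /(_ (kappa z)) /negP; apply.
by apply/mapP; exists z => //; apply: HS.
Qed.

Section Nullstellensatz.
Variables (K : closedFieldType) (n : nat).
Hypothesis uncK : uncountable_type K.

Record ideal (I : {mpoly K[n]} -> Prop) : Prop := Ideal {
  ideal0 : I 0;
  idealD : forall p q, I p -> I q -> I (p + q);
  idealMl : forall p q, I q -> I (p * q) }.

Lemma idealN I p : ideal I -> I p -> I (- p).
Proof. by move=> iI Ip; rewrite -mulN1r; apply: (idealMl iI). Qed.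
Lemma idealB I p q : ideal I -> I p -> I q -> I (p - q).
Proof. by move=> iI Ip Iq; apply: (idealD iI) => //; apply: idealN. Qed.
Lemma idealZ I c p : ideal I -> I p -> I (c *: p).
Proof. by move=> iI Ip; rewrite -mul_mpolyC; apply: (idealMl iI). Qed.
Lemma ideal_sum I (T : Type) (r : seq T) (P : pred T) (F : T -> {mpoly K[n]}) :
  ideal I -> (forall i, P i -> I (F i)) -> I (\sum_(i <- r | P i) F i).
Proof.
by move=> iI H; elim/big_ind: _ => //; [exact: ideal0|exact: idealD].
Qed.

Definition iplus (I : {mpoly K[n]} -> Prop) g := fun p => exists u, I (p - u * g).

Lemma ideal_iplus I g : ideal I -> ideal (iplus I g).
Proof.
move=> iI; split.
- by exists 0; rewrite mul0r subr0; apply: ideal0.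
- move=> p q [u hu] [v hv]; exists (u + v).
  by rewrite mulrDl opprD addrACA; apply: idealD.
- move=> p q [u hu]; exists (p * u).
  by rewrite -mulrA -mulrBr; apply: idealMl.
Qed.

Lemma dependent_family (M d : nat) (u : 'I_M -> {mpoly K[n]}) :
  (forall j, msize (u j) <= d)%N -> (#|{: 'X_{1..n < d}}| < M)%N ->
  exists c : 'I_M -> K, \sum_j c j *: u j = 0 /\ exists j, c j != 0.
Proof.
move=> ud lt; apply: boolp.contrapT => H.
have := @span_card K {mpoly K[n]} 'I_M 'X_{1..n < d} u
  (fun m => 'X_[bmnm m]) (fun j m => (u j)@_(bmnm m)).
rewrite card_ord leqNgt lt => Hs; suff: false by []; apply: Hs.
  by move=> j; apply: mpolywE.
move=> c c0 j; apply/eqP; rewrite -[_ == _]negbK; apply/negP => cj; apply: H.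
by exists c; split=> //; exists j.
Qed.

(* Otherwise u_a (X_i - a) - h^k_a is in I for every a, and k_a and deg u_a are
   constant on an infinite set of a.  A linear relation between these u_a gives P <> 0
   with h^k P(X_i) in I; P splits, and its factors are removed one by one. *)
Lemma nullst_step I h i : ideal I -> (forall k, ~ I (h ^+ k)) ->
  exists a, forall k, ~ iplus I ('X_i - a%:MP) (h ^+ k).
Proof.
move=> iI hI; apply: boolp.contrapT => H.
have ku (a : K) : exists ku : nat * {mpoly K[n]},
    I (h ^+ ku.1 - ku.2 * ('X_i - a%:MP)).
  apply: boolp.contrapT => no; apply: H; exists a => k [u hu].
  by apply: no; exists (k, u).
have {ku}[ku Hku] := boolp.choice ku.
have [D HD] := uncK (fun a => pickle ((ku a).1, msize (ku a).2)).
have peel rs k : I (h ^+ k * \prod_(b <- rs) ('X_i - b%:MP)) -> False.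
  elim: rs k => [|b rs IH] k; first by rewrite big_nil mulr1; apply: hI.
  rewrite big_cons => hk; apply: (IH (k + (ku b).1)%N).
  set Q := \prod_(_ <- _) _ in hk *.
  have -> : h ^+ (k + (ku b).1) * Q =
     h ^+ k * Q * (h ^+ (ku b).1 - (ku b).2 * ('X_i - b%:MP)) +
     (ku b).2 * (h ^+ k * (('X_i - b%:MP) * Q)) by rewrite exprD; ring.
  by apply: (idealD iI); apply: (idealMl iI).
have [s1 [_ s1s s1D]] := HD 1%N.
have [a0 a0s] : exists a0, a0 \in s1.
  by case: s1 s1s {s1D} => // a0 s1 _; exists a0; rewrite mem_head.
set k := (ku a0).1; set d := msize (ku a0).2.
have kd a : pickle ((ku a).1, msize (ku a).2) = D -> (ku a).1 = k /\ msize (ku a).2 = d.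
  rewrite -(s1D a0 a0s) => e.
  by have := pcan_inj (@pickleK _) e => -[-> ->].
have [s [us ss sD]] := HD (#|{: 'X_{1..n < d}}|.+1).
set M := #|_| .+1 in ss.
pose aj (j : 'I_M) := nth 0 s j.
have ajs j : aj j \in s by rewrite mem_nth // ss.
have ajI : injective aj.
  by move=> j j' /eqP; rewrite nth_uniq ?ss // => /eqP/val_inj.
have ukd j := kd _ (sD _ (ajs j)).
have [|//|c [c0 [j0 cj0]]] := @dependent_family M d (fun j => (ku (aj j)).2).
  by move=> j; have [_ ->] := ukd j.
pose P : {poly K} := \sum_j c j *: \prod_(l | l != j) ('X - (aj l)%:P).
have P0 : P != 0.
  apply: contraTneq (oner_neq0 K) => P0; exfalso.
  have : P.[aj j0] = c j0 * \prod_(l | l != j0) (aj j0 - aj l).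
    rewrite /P horner_sum (bigD1 j0) //=.
    rewrite [X in _ + X]big1 ?addr0 ?hornerZ ?horner_prod => [|j jj0].
      by congr (_ * _); apply: eq_bigr => l _; rewrite !hornerE.
    rewrite hornerZ horner_prod (bigD1 j0) 1?eq_sym //=.
    by rewrite hornerXsubC subrr mul0r mulr0.
  rewrite P0 horner0 => /esym/eqP; rewrite mulf_eq0 (negbTE cj0) /=.
  move=> /prodf_eq0[l lj]; rewrite subr_eq0 => /eqP/ajI e.
  by rewrite e eqxx in lj.
have evX b : horner_alg ('X_i : {mpoly K[n]}) ('X - b%:P) = 'X_i - b%:MP.
  by rewrite rmorphB /= horner_algX horner_algC alg_mpolyC.
have [rs Prs] := closed_field_poly_normal P.
suff : I (h ^+ k * horner_alg ('X_i : {mpoly K[n]}) P).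
  have lc (Y : {mpoly K[n]}) : (lead_coef P)^-1%:MP * ((lead_coef P)%:MP * Y) = Y.
    by rewrite mulrA -mpolyCM mulVf ?lead_coef_eq0 ?mpolyC1 ?mul1r.
  rewrite Prs linearZ /= -mul_mpolyC mulr1 rmorph_prod /= mulrCA => hk.
  have := idealMl iI ((lead_coef P)^-1)%:MP hk; rewrite lc.
  by under eq_bigr do rewrite evX; apply: peel.
pose g j : {mpoly K[n]} := 'X_i - (aj j)%:MP.
have -> : h ^+ k * horner_alg ('X_i : {mpoly K[n]}) P =
    \sum_j (c j *: \prod_(l | l != j) g l) * (h ^+ k - (ku (aj j)).2 * g j).
  rewrite raddf_sum mulr_sumr /=.
  have -> : \sum_j (c j *: \prod_(l | l != j) g l) * (h ^+ k - (ku (aj j)).2 * g j)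
     = \sum_j h ^+ k * (c j *: \prod_(l | l != j) g l) -
       \sum_j c j *: (ku (aj j)).2 * \prod_l g l.
    rewrite -sumrB; apply: eq_bigr => j _; rewrite [\prod_l g l](bigD1 j) //=.
    rewrite -!mul_mpolyC; ring.
  rewrite -mulr_suml c0 mul0r subr0; apply: eq_bigr => j _.
  rewrite linearZ /= rmorph_prod mulr_algl; congr (_ * (_ *: _)).
  by apply: eq_bigr => l _; apply: evX.
apply: ideal_sum => // j _; apply: (idealMl iI).
by have [<- _] := ukd j; apply: Hku.
Qed.

Lemma nullst_extend I h (s : seq 'I_n) : ideal I -> (forall k, ~ I (h ^+ k)) ->
  exists J, [/\ ideal J, forall p, I p -> J p, forall k, ~ J (h ^+ k) &
    forall i, i \in s -> exists a, J ('X_i - a%:MP)].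
Proof.
move=> iI hI; elim: s => [|i s [J [iJ IJ hJ sJ]]]; first by exists I; split.
have [a Ha] := nullst_step i iJ hJ.
have JJ p : J p -> iplus J ('X_i - a%:MP) p.
  by exists 0; rewrite mul0r subr0.
exists (iplus J ('X_i - a%:MP)); split=> //.
- exact: ideal_iplus.
- by move=> p /IJ /JJ.
- move=> j; rewrite inE => /orP[/eqP->|/sJ[b hb]].
    by exists a, 1; rewrite mul1r subrr; apply: ideal0.
  by exists b; apply: JJ.
Qed.

(** Keeping all powers of [h], and not only [1], out of the ideal while the X_i - a_i are adjoined
    gives the strong form at once: the final ideal identifies each q with its value at [a], so h(a)
    = 0 would put [h] itself into it. *)
Theorem nullstellensatz I h : ideal I ->
  (forall x : 'I_n -> K, (forall q, I q -> q.@[x] = 0) -> h.@[x] = 0) ->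
  exists k, I (h ^+ k).
Proof.
move=> iI Hh; apply: boolp.contrapT => H.
have hI k : ~ I (h ^+ k) by move=> hk; apply: H; exists k.
have [J [iJ IJ hJ sJ]] := nullst_extend (enum 'I_n) iI hI.
have [a Ha] := boolp.choice (fun i => sJ i (mem_enum _ i)).
have ev q : J (q - q.@[a]%:MP).
  elim/mpoly_gen_ind: q => [c|i|p q hp hq|p q hp hq].
  - by rewrite mevalC subrr; apply: ideal0.
  - by rewrite mevalXU.
  - by rewrite mevalD mpolyCD opprD addrACA; apply: idealD.
  - have -> : p * q - (p * q).@[a]%:MP =
       q * (p - p.@[a]%:MP) + p.@[a]%:MP * (q - q.@[a]%:MP).
      by rewrite mevalM mpolyCM; ring.
    by apply: (idealD iJ); apply: (idealMl iJ).
have h0 : h.@[a] = 0.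
  apply: Hh => q /IJ Jq; apply/eqP; rewrite -[_ == _]negbK; apply/negP => q0.
  apply: (hJ 0%N); rewrite expr0.
  have := idealB iJ Jq (ev q); rewrite opprB addrCA subrr addr0 => hc.
  by have := idealMl iJ (q.@[a]^-1)%:MP hc; rewrite -mpolyCM mulVf ?mpolyC1.
by apply: (hJ 1%N); rewrite expr1 -[h]subr0 -(mpolyC0 n) -h0; apply: ev.
Qed.

End Nullstellensatz.

(** * Gauss lemma and elimination *)

Section Divisibility.
Variable A : idomainType.
Implicit Types p q d : A.

Definition divides d p := exists q, p = d * q.
Definition irreducible_elt p := [/\ p != 0, p \isn't a GRing.unit &
  forall a b, p = a * b -> a \is a GRing.unit \/ b \is a GRing.unit].
Definition prime_elt p := [/\ p != 0, p \isn't a GRing.unit &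
  forall a b, divides p (a * b) -> divides p a \/ divides p b].

Lemma divides_mulr d p q : divides d p -> divides d (p * q).
Proof. by case=> c ->; exists (c * q); rewrite mulrA. Qed.
Lemma divides_mull d p q : divides d q -> divides d (p * q).
Proof. by rewrite mulrC; apply: divides_mulr. Qed.
Lemma dividesD d p q : divides d p -> divides d q -> divides d (p + q).
Proof. by move=> [a ->] [b ->]; exists (a + b); rewrite mulrDr. Qed.
Lemma dividesB d p q : divides d p -> divides d q -> divides d (p - q).
Proof. by move=> [a ->] [b ->]; exists (a - b); rewrite mulrBr. Qed.
Lemma divides0 d : divides d 0.
Proof. by exists 0; rewrite mulr0. Qed.
Lemma divides_sum d (I : Type) (r : seq I) (P : pred I) (F : I -> A) :
  (forall i, P i -> divides d (F i)) -> divides d (\sum_(i <- r | P i) F i).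
Proof.
by move=> H; elim/big_ind: _ => //; [exact: divides0|exact: dividesD].
Qed.

(** Existence of prime factorisations, phrased as a terminating recursion: splitting off a prime
    decreases the measure. *)
Definition splits_primes := exists mu : A -> nat, forall b, b != 0 ->
  b \isn't a GRing.unit -> exists pi c, [/\ prime_elt pi, b = pi * c & (mu c < mu b)%N].

End Divisibility.

(** * Divisibility along a ring isomorphism *)

Section DivisibilityTransfer.
Variables (A A' : idomainType) (f : A -> A') (g : A' -> A).
Hypotheses (fM : forall x y, f (x * y) = f x * f y) (f0 : f 0 = 0) (f1 : f 1 = 1).
Hypotheses (fK : cancel f g) (gK : cancel g f).

Lemma transferM x y : g (x * y) = g x * g y.
Proof. by rewrite -{1}(gK x) -{1}(gK y) -fM fK. Qed.

Lemma transfer_eq0 p : (f p == 0) = (p == 0).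
Proof. by rewrite -f0 (can_eq fK). Qed.

Lemma transfer_unit p : (f p \is a GRing.unit) = (p \is a GRing.unit).
Proof.
apply/idP/idP => /unitrP[q [h1 h2]]; apply/unitrP; [exists (g q)|exists (f q)].
  have e : g q * p = 1 by rewrite -{1}(fK p) -transferM h1 -f1 fK.
  by split; rewrite // mulrC.
by rewrite -!fM h1 h2 f1.
Qed.

Lemma transfer_irreducible p : irreducible_elt p -> irreducible_elt (f p).
Proof.
move=> [p0 pu pf]; split; rewrite ?transfer_eq0 ?transfer_unit // => a b ab.
rewrite -(gK a) -(gK b) !transfer_unit; apply: pf.
by rewrite -transferM -ab fK.
Qed.

Lemma transfer_divides d p : divides (f d) (f p) -> divides d p.
Proof. by case=> q e; exists (g q); rewrite -{1}(fK p) e transferM fK. Qed.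

Lemma transfer_prime p : prime_elt (f p) -> prime_elt p.
Proof.
move=> [p0 pu pp]; split; rewrite -?transfer_eq0 -?transfer_unit // => a b [c abE].
have [|h|h] := pp (f a) (f b); [|left|right]; last 2 first.
- exact: transfer_divides.
- exact: transfer_divides.
by exists (f c); rewrite -!fM abE.
Qed.

End DivisibilityTransfer.

(** * Gauss's lemma for polynomials in one variable *)

Section Gauss.
Variable B : idomainType.
Hypothesis splitB : splits_primes B.
Implicit Types (P Q : {poly B}) (b c : B).

Lemma divides_polyC c P : divides c%:P P <-> forall i, divides c P`_i.
Proof.
split=> [[Q ->] i|H]; first by exists Q`_i; rewrite coefCM.
have [q hq] := boolp.choice H.
exists (\poly_(i < size P) q i); apply/polyP => i.
rewrite coefCM coef_poly; case: ltnP => [_|h]; first exact: hq.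
by rewrite mulr0 nth_default.
Qed.

Lemma first_nondivisible c P : ~ divides c%:P P ->
  exists i, ~ divides c P`_i /\ forall k, (k < i)%N -> divides c P`_k.
Proof.
move=> H; have ex : exists i, boolp.asbool (~ divides c P`_i).
  apply: boolp.contrapT => no; apply: H; apply/divides_polyC => i.
  by apply: boolp.contrapT => h; apply: no; exists i; apply/boolp.asboolP.
case: (ex_minnP ex) => i /boolp.asboolP hi mini; exists i; split=> // k ki.
apply: boolp.contrapT => h; have := mini k; rewrite leqNgt ki => /(_ _)/negP; apply.
  by apply/boolp.asboolP.
by [].
Qed.

(** If [i] and [j] are the first indices where [P] and [Q] have coefficients not divisible by [c],
    all terms but one of the coefficient of index [i + j] of the product are divisible by [c]. *)
Lemma prime_polyC c : prime_elt c -> prime_elt c%:P.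
Proof.
move=> [c0 cu cp]; split; first by rewrite polyC_eq0.
  by rewrite poly_unitE coefC /= negb_and cu orbT.
move=> P Q cPQ; apply: boolp.contrapT => H.
have [/first_nondivisible[i [hi li]] /first_nondivisible[j [hj lj]]] :
  ~ divides c%:P P /\ ~ divides c%:P Q.
  by split=> h; apply: H; [left|right].
have /divides_polyC/(_ (i + j)%N) := cPQ; rewrite coefM.
have lt : (i < (i + j).+1)%N by rewrite ltnS leq_addr.
rewrite (bigD1 (Ordinal lt)) //= addKn => h.
suff : divides c (P`_i * Q`_j) by move=> /cp[].
rewrite -[P`_i * _](addrK (\sum_(k < (i + j).+1 | k != Ordinal lt) P`_k * Q`_(i + j - k))).
apply: dividesB => //; apply: divides_sum => k /eqP ki.
have [kli|ilk] := ltnP k i; first by apply/divides_mulr/li.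
apply/divides_mull/lj; have : (nat_of_ord k <> i)%N by move=> e; apply: ki; apply: val_inj.
by have := ltn_ord k; lia.
Qed.

Definition primitive_poly Q := forall c, prime_elt c -> ~ divides c%:P Q.

(** The constant [b] is removed prime by prime: a prime dividing Q R divides [R], because [Q] is
    primitive. *)
Lemma primitive_cancel Q b P R : primitive_poly Q -> b != 0 ->
  b%:P * P = Q * R -> divides Q P.
Proof.
move=> prQ; have [mu Hmu] := splitB; move: {2}(mu b).+1 (ltnSn (mu b)) => k.
elim: k b P R => // k IH b P R mub b0 e.
have [ub|nub] := boolP (b \is a GRing.unit).
  exists (b^-1%:P * R).
  by rewrite mulrCA -e mulrA -polyCM mulVr // polyC1 mul1r.
have [c [d [pc bE mud]]] := Hmu b b0 nub.
have [c0 _ _] := pc; have d0 : d != 0 by apply: contraNneq b0; rewrite bE => ->; rewrite mulr0.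
have cp := prime_polyC pc; have [_ _ /(_ Q R)] := cp.
rewrite -e bE polyCM -mulrA => -[|/(prQ _ pc)//|[R' R'E]]; first by exists (d%:P * P).
apply: (IH d P R') => //; first exact: leq_trans mud _.
apply: (@mulfI _ c%:P); first by rewrite polyC_eq0.
by rewrite mulrA -polyCM -bE e R'E mulrCA.
Qed.

(** Each prime of [c] divides [D] or [R] and can be cancelled there without changing a degree. This
    turns a factorisation over the fraction field into one over [B]. *)
Lemma clear_denominator c Q D R : c != 0 -> Q != 0 -> c%:P * Q = D * R ->
  exists D' R', [/\ Q = D' * R', size D' = size D & size R' = size R].
Proof.
have [mu Hmu] := splitB; move: {2}(mu c).+1 (ltnSn (mu c)) => k.
elim: k c D R => // k IH c D R muc c0 Q0 e.
have [uc|nuc] := boolP (c \is a GRing.unit).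
  exists (c^-1%:P * D), R; split=> //.
    by rewrite -mulrA -e mulrA -polyCM mulVr // polyC1 mul1r.
  by rewrite mul_polyC size_scale // invr_eq0.
have [p [d [pp cE mud]]] := Hmu c c0 nuc.
have [p0 _ _] := pp; have d0 : d != 0 by apply: contraNneq c0; rewrite cE => ->; rewrite mulr0.
have pP0 : p%:P != 0 by rewrite polyC_eq0.
have pP := prime_polyC pp; have [_ _ /(_ D R)] := pP.
rewrite -e cE polyCM -mulrA => -[|[D' DE]|[R' RE]]; first by exists (d%:P * Q).
  have [|//||D2 [R2 [QE sD sR]]] := IH d D' R _ d0.
  - exact: leq_trans mud _.
  - apply: (mulfI pP0).
    by rewrite mulrA -polyCM -cE e DE mulrA.
  exists D2, R2; split=> //.
  by rewrite sD DE mul_polyC size_scale.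
have [|//||D2 [R2 [QE sD sR]]] := IH d D R' _ d0.
- exact: leq_trans mud _.
- apply: (mulfI pP0).
  by rewrite mulrA -polyCM -cE e RE mulrCA.
exists D2, R2; split=> //.
by rewrite sR RE mul_polyC size_scale.
Qed.

Lemma irreducible_primitive Q : irreducible_elt Q -> (1 < size Q)%N -> primitive_poly Q.
Proof.
move=> [Q0 _ Qi] sQ c [c0 cu _] [R QE].
have [|] := Qi _ _ QE; first by rewrite poly_unitE coefC /= (negbTE cu) andbF.
rewrite poly_unitE => /andP[/eqP sR _].
by move: sQ; rewrite QE mul_polyC size_scale // sR.
Qed.

(** If the gcd over the fraction field is constant, Bezout's identity gives a nonzero constant [c]
    once denominators are cleared. Otherwise irreducibility makes the gcd a scalar multiple of [Q],
    and primitivity removes the scalars. *)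
Lemma eliminate Q P : irreducible_elt Q -> (1 < size Q)%N ->
  divides Q P \/ exists u v c, c != 0 /\ u * Q + v * P = c%:P.
Proof.
move=> Qi sQ; have [Q0 _ Qf] := Qi; set g := gcdp Q P.
have g0 : g != 0 by rewrite gcdp_eq0 negb_and Q0.
have [/eqP sg|sg] := boolP (size g == 1%N).
  right; have [[u v] /= /Pdiv.Idomain.eqpP[[c d] /= /andP[c0 d0]]] := Pdiv.Idomain.Bezoutp Q P.
  rewrite -/g => e; have [a a0 ga] : exists2 a, a != 0 & g = a%:P by apply/size_poly1P/eqP.
  exists (c *: u), (c *: v), (d * a); split; first by rewrite mulf_neq0.
  by rewrite -!scalerAl -scalerDr e ga -mul_polyC polyCM.
left; have {}sg : (1 < size g)%N.
  by rewrite ltn_neqAle eq_sym sg size_poly_gt0.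
have /Pdiv.Idomain.dvdpP[[c D] /= c0 QE] := dvdp_gcdl Q P.
have /Pdiv.Idomain.dvdpP[[d E] /= d0 PE] := dvdp_gcdr Q P.
rewrite -/g in QE PE.
have [|D' [R' [QE' sD sR]]] := clear_denominator (D := D) (R := g) c0 Q0.
  by rewrite mul_polyC.
have sD1 : size D = 1%N.
  have [] := Qf _ _ QE'; rewrite poly_unitE => /andP[/eqP h _]; first by rewrite -sD.
  by move: sg; rewrite -sR h.
have [a a0 Da] : exists2 a, a != 0 & D = a%:P by apply/size_poly1P/eqP.
apply: (@primitive_cancel Q (a * d) P (E * c%:P)).
- exact: irreducible_primitive.
- by rewrite mulf_neq0.
- rewrite polyCM -mulrA [d%:P * _]mul_polyC PE mulrCA.
  by rewrite -Da -QE -mul_polyC; ring.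
Qed.

Lemma eliminate_transfer (A : idomainType) (f : A -> {poly B}) (g : {poly B} -> A)
    (phi psi : A) :
  (forall x y, f (x * y) = f x * f y) -> f 0 = 0 -> f 1 = 1 ->
  cancel f g -> cancel g f -> (forall x y, g (x + y) = g x + g y) ->
  irreducible_elt phi -> (1 < size (f phi))%N ->
  divides phi psi \/ exists u v c, c != 0 /\ u * phi + v * psi = g c%:P.
Proof.
move=> fM f0 f1 fK gK gD phii s1.
have [h|[u [v [c [c0 e]]]]] :=
  eliminate (f psi) (transfer_irreducible fM f0 f1 fK gK phii) s1.
  by left; apply: (transfer_divides fM fK gK).
right; exists (g u), (g v), c; split=> //.
by rewrite -e gD !(transferM fM fK gK) !fK.
Qed.

(** A constant [Q] is handled by the hypothesis on [B]. Otherwise, if [Q] does not divide [P], then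
    u Q + v P = c shows that c R is a multiple of [Q], and [c] cancels. *)
Lemma irreducible_prime Q :
  (forall c, irreducible_elt c -> prime_elt c) ->
  irreducible_elt Q -> prime_elt Q.
Proof.
move=> primeB Qi; have [Q0 Qu Qf] := Qi.
have [sQ|sQ] := leqP (size Q) 1.
  have [c QE] : exists c, Q = c%:P by exists Q`_0; apply: size1_polyC.
  have uC (x : B) : (x%:P \is a GRing.unit) = (x \is a GRing.unit).
    rewrite poly_unitE coefC /= size_polyC andb_idl //.
    by case: (eqVneq x 0) => [->|//]; rewrite unitr0.
  rewrite QE in Q0 Qu Qf *; apply/prime_polyC/primeB; split.
  - by rewrite -polyC_eq0.
  - by rewrite -uC.
  - by move=> x y xy; have := Qf x%:P y%:P; rewrite !uC; apply; rewrite -polyCM -xy.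
split=> // P R [S PRS].
have [QP|[u [v [c [c0 e]]]]] := eliminate P Qi sQ; [by left|right].
apply: (@primitive_cancel Q c R (u * R + v * S)) => //.
  exact: irreducible_primitive.
by rewrite -e mulrDr mulrDl -[v * P * R]mulrA PRS; ring.
Qed.

End Gauss.

(** * Isolating one variable *)

Section SeparateVariable.
Variables (K : fieldType) (n : nat) (j : 'I_n.+1).

Definition sep_var (i : 'I_n.+1) : {poly {mpoly K[n]}} :=
  if unlift j i is Some k then ('X_k)%:P else 'X.

(** With [unsep], the isomorphism between polynomials in n+1 variables and polynomials in ['X_j]
    over the ring in the others. The index [j] is free because the variable to eliminate is imposed
    by the geometry. *)
Definition sep (p : {mpoly K[n.+1]}) : {poly {mpoly K[n]}} :=
  mmap (polyC \o @mpolyC n K) sep_var p.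

Definition unsepC (p : {mpoly K[n]}) : {mpoly K[n.+1]} :=
  p \mPo [tuple 'X_(lift j k) | k < n].

Definition unsep (P : {poly {mpoly K[n]}}) : {mpoly K[n.+1]} :=
  (map_poly unsepC P).['X_j].

Lemma sepD p q : sep (p + q) = sep p + sep q.
Proof. exact: raddfD. Qed.
Lemma sepM p q : sep (p * q) = sep p * sep q.
Proof. exact: rmorphM. Qed.
Lemma sepC c : sep c%:MP = (c%:MP)%:P.
Proof. exact: mmapC. Qed.
Lemma sepXU i : sep 'X_i = sep_var i.
Proof. by rewrite /sep mmapX mmap1U. Qed.

HB.instance Definition _ := GRing.RMorphism.copy unsepC
  (comp_mpoly [tuple 'X_(lift j k) | k < n]).

Lemma unsepD P Q : unsep (P + Q) = unsep P + unsep Q.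
Proof. by rewrite /unsep rmorphD hornerD. Qed.
Lemma unsepM P Q : unsep (P * Q) = unsep P * unsep Q.
Proof. by rewrite /unsep rmorphM hornerM. Qed.
Lemma unsep_polyC c : unsep c%:P = unsepC c.
Proof. by rewrite /unsep map_polyC hornerC. Qed.
Lemma unsepX : unsep 'X = 'X_j.
Proof. by rewrite /unsep map_polyX hornerX. Qed.

Lemma unsepC_C c : unsepC c%:MP = c%:MP.
Proof. exact: comp_mpolyC. Qed.
Lemma unsepC_XU k : unsepC 'X_k = 'X_(lift j k).
Proof. by rewrite /unsepC comp_mpolyXU -tnth_nth tnth_mktuple. Qed.

Lemma sep0 : sep 0 = 0.
Proof. exact: mmap0. Qed.
Lemma unsep0 : unsep 0 = 0.
Proof. by rewrite /unsep rmorph0 horner0. Qed.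

(* Comparing instances of these two maps by unfolding is prohibitively slow. *)
#[local] Opaque sep unsep.

Lemma sepK p : unsep (sep p) = p.
Proof.
elim/mpoly_gen_ind: p => [c|i|p q IHp IHq|p q IHp IHq].
- by rewrite sepC unsep_polyC unsepC_C.
- rewrite sepXU /sep_var; case: unliftP => [k ->|->]; last exact: unsepX.
  by rewrite unsep_polyC unsepC_XU.
- by rewrite sepD unsepD; exact: (congr2 +%R IHp IHq).
- by rewrite sepM unsepM; exact: (congr2 *%R IHp IHq).
Qed.

Lemma sep_unsepC c : sep (unsepC c) = c%:P.
Proof.
elim/mpoly_gen_ind: c => [c|i|p q IHp IHq|p q IHp IHq].
- by rewrite unsepC_C sepC.
- by rewrite unsepC_XU sepXU /sep_var liftK.
- by rewrite rmorphD sepD polyCD; exact: (congr2 +%R IHp IHq).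
- by rewrite rmorphM sepM polyCM; exact: (congr2 *%R IHp IHq).
Qed.

Lemma unsepK P : sep (unsep P) = P.
Proof.
elim/poly_ind: P => [|P c IH].
  by rewrite unsep0 sep0.
rewrite unsepD unsepM sepD sepM IH unsepX unsep_polyC sep_unsepC sepXU /sep_var.
by rewrite unlift_none.
Qed.

Lemma sep1 : sep 1 = 1.
Proof. by rewrite -mpolyC1 sepC mpolyC1 polyC1. Qed.

Lemma sep_eq0 p : (sep p == 0) = (p == 0).
Proof. exact: (transfer_eq0 sep0 sepK). Qed.

Lemma sep_irreducible (p : {mpoly K[n.+1]}) :
  irreducible_elt p -> irreducible_elt (sep p).
Proof. exact: (transfer_irreducible sepM sep0 sep1 sepK unsepK). Qed.

Lemma sep_prime (p : {mpoly K[n.+1]}) : prime_elt (sep p) -> prime_elt p.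
Proof. exact: (transfer_prime sepM sep0 sep1 sepK unsepK). Qed.

Lemma mderiv_unsepC c : mderiv j (unsepC c) = 0.
Proof.
rewrite /unsepC (der_comp (mderiv_derivation K j)) big1 // => k _.
by rewrite tnth_mktuple mderivXU eq_sym (negbTE (neq_lift j k)) mulr0.
Qed.

End SeparateVariable.

(** * Factoriality of polynomial rings over a field *)

Section MpolyFactorial.
Variable K : fieldType.

Lemma mpoly_unitE n (p : {mpoly K[n]}) : (p \is a GRing.unit) = (msize p == 1%N).
Proof.
have -> : (p \is a GRing.unit) = (p == (p@_0)%:MP) && (p@_0 \in GRing.unit) by [].
rewrite unitfE; apply/andP/idP => [[/eqP pE p0]|/msize_poly1P[c c0 ->]].
  by apply/msize_poly1P; exists p@_0.
by rewrite mcoeffC eqxx mulr1.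
Qed.

Lemma mirreducibleE n (p : {mpoly K[n]}) : mirreducible p <-> irreducible_elt p.
Proof.
have nc (q : {mpoly K[n]}) : q != 0 -> nonconstant q <-> q \isn't a GRing.unit.
  by move=> q0; rewrite mpoly_unitE /nonconstant ltn_neqAle eq_sym lt0n msize_poly_eq0 q0 andbT.
split=> [[pn pf]|[p0 pu pf]].
  have p0 : p != 0 by apply: contraTneq pn => ->; rewrite /nonconstant msize0.
  split=> //; first by apply/nc.
  move=> a b pE; have /andP[a0 b0] : (a != 0) && (b != 0) by rewrite -negb_or -mulf_eq0 -pE.
  have [h|h] := pf _ _ pE; [left|right]; rewrite -[_ \is a _]negbK; apply/negP => /nc; auto.
split; first exact/nc.
move=> a b pE; have /andP[a0 b0] : (a != 0) && (b != 0) by rewrite -negb_or -mulf_eq0 -pE.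
have [h|h] := pf _ _ pE; [left|right] => /nc; rewrite h => hh; by have := hh _; auto.
Qed.

Lemma irreducible_factor n (b : {mpoly K[n]}) : b != 0 -> b \isn't a GRing.unit ->
  exists p c, [/\ irreducible_elt p, b = p * c & (msize c < msize b)%N].
Proof.
have sz (x y : {mpoly K[n]}) : x != 0 -> y != 0 -> x \isn't a GRing.unit ->
    (msize y < msize (x * y))%N.
  move=> x0 y0; rewrite mpoly_unitE msizeM //; rewrite -msize_poly_eq0 in x0.
  by move: (msize x) (msize y) x0 => a c a0 a1; lia.
move: {2}(msize b).+1 (ltnSn (msize b)) => k; elim: k b => // k IH b bk b0 bu.
have [bi|nbi] := boolp.EM (irreducible_elt b).
  exists b, 1; rewrite mulr1; split=> //.
  by have := sz b 1 b0 (oner_neq0 _) bu; rewrite mulr1.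
have [x [y [bE xu yu]]] : exists x y, [/\ b = x * y, x \isn't a GRing.unit & y \isn't a GRing.unit].
  apply: boolp.contrapT => no; apply: nbi; split=> // x y bE.
  apply: boolp.contrapT => h; apply: no; exists x, y; split=> //; apply/negP => h'.
    by apply: h; left.
  by apply: h; right.
have /andP[x0 y0] : (x != 0) && (y != 0) by rewrite -negb_or -mulf_eq0 -bE.
have xb : (msize x < msize b)%N by rewrite bE mulrC; apply: sz.
have [p [c [pi xE cx]]] := IH x (leq_trans xb bk) x0 xu.
exists p, (c * y); split; [exact: pi|by rewrite mulrA -xE|].
have c0 : c != 0 by apply: contraNneq x0; rewrite xE => ->; rewrite mulr0.
have [_ pu _] := pi; have [p0 _ _] := pi.
rewrite bE xE -mulrA; apply: sz => //; exact: mulf_neq0.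
Qed.

(** Induction on the number of variables. Without variables nonzero elements are units, so nothing
    is irreducible; the step is [irreducible_prime], with [msize] as the measure of
    factorisation. *)
Lemma mpoly_irreducible_prime n (p : {mpoly K[n]}) : irreducible_elt p -> prime_elt p.
Proof.
elim: n p => [|n IH] p pi.
  have [p0 pu _] := pi; exfalso; move/negP: pu; apply.
  rewrite mpoly_unitE; apply/msize_poly1P; exists p@_0; last exact: nvar0_mpolyC.
  by apply: contraNneq p0 => e; rewrite (nvar0_mpolyC p) e mpolyC0.
apply: (sep_prime (j := ord0)); apply: irreducible_prime => //; last exact: sep_irreducible.
exists (fun q => msize q) => b b0 bu.
have [q [c [qi qE cb]]] := irreducible_factor b0 bu.
by exists q, c; split=> //; apply: IH.
Qed.

(* If phi does not involve X_j it is itself the eliminant. *)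
Lemma mpoly_eliminate n (j : 'I_n.+1) (phi psi : {mpoly K[n.+1]}) :
  mirreducible phi -> ~ mdivides phi psi ->
  exists u v, u * phi + v * psi != 0 /\ mderiv j (u * phi + v * psi) = 0.
Proof.
move=> /mirreducibleE phii nd; have [phi0 _ _] := phii.
have sphii := sep_irreducible j phii.
have [s1|s1] := leqP (size (sep j phi)) 1.
  exists 1, 0; rewrite mul0r addr0 mul1r; split=> //.
  by rewrite -(sepK j phi) (size1_polyC s1) unsep_polyC mderiv_unsepC.
have split_n : splits_primes {mpoly K[n]}.
  exists (fun q => msize q) => b b0 bu.
  have [q [c [qi qE cb]]] := irreducible_factor b0 bu.
  by exists q, c; split=> //; apply: mpoly_irreducible_prime.
have [//|[u [v [c [c0 E]]]]] := @eliminate_transfer _ split_n _ (sep j) (unsep j) phi psi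
  (sepM j) (sep0 K j) (sep1 K j) (sepK j) (unsepK j) (unsepD j) phii s1.
have {}E : u * phi + v * psi = unsepC j c by apply: etrans E (unsep_polyC j c).
exists u, v; rewrite E; split; last exact: mderiv_unsepC.
apply: contraNneq c0 => c0; have := sep_unsepC j c.
by rewrite c0 sep0 => /esym/eqP; rewrite polyC_eq0.
Qed.

End MpolyFactorial.

(** * Semi-invariants of a vector field at a nonresonant singularity *)

Section MoreBasics.
Variables (K : fieldType) (n : nat).
Implicit Types (p q : {mpoly K[n]}) (m : 'X_{1..n}).

Lemma mulX_mderivX (i : 'I_n) m :
  'X_i * mderiv i 'X_[m] = (m i)%:R *: 'X_[m] :> {mpoly K[n]}.
Proof.
rewrite mderivX -scalerAr -mpolyXD; case: (posnP (m i)) => [->|mi].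
  by rewrite !scale0r.
by rewrite addmC submK // lep1mP -lt0n.
Qed.

Lemma mcoeff_mulX_mderiv (i : 'I_n) p m : ('X_i * mderiv i p)@_m = (m i)%:R * p@_m.
Proof.
elim/mpolyind: p => [|c m' p _ _ IH]; first by rewrite mderiv0 mulr0 mcoeff0 mulr0.
rewrite mderivD mulrDr !mcoeffD IH mulrDr; congr (_ + _).
rewrite mderivZ -scalerAr mulX_mderivX !mcoeffZ mcoeffX.
by case: eqP => [->|_]; rewrite ?mulr0 // !mulr1 mulrC.
Qed.

Lemma ordge_eqP d p : ordge d p -> (forall m, mdeg m = d -> p@_m = 0) -> ordge d.+1 p.
Proof.
move=> h H m; rewrite ltnS leq_eqVlt => /orP[/eqP/H//|]; exact: h.
Qed.

Lemma ordgeX m : ordge (mdeg m) ('X_[m] : {mpoly K[n]}).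
Proof. exact/homog_ordge/homogX. Qed.

Lemma ordgeXU (i : 'I_n) : ordge 1 ('X_i : {mpoly K[n]}).
Proof. exact/homog_ordge/homogXU. Qed.

(** Serves both the approximate eigencoordinates at a singularity and the local coordinates at a
    nondegenerate zero. *)
Lemma prod_lowest (G : 'I_n -> {mpoly K[n]}) m :
  (forall i, ordge 2 (G i - 'X_i)) -> ordge (mdeg m).+1 (\prod_i G i ^+ m i - 'X_[m]).
Proof.
move=> GX.
(* [S d] relates polynomials of order at least [d] with the same form of degree [d]; it is
   multiplicative. *)
pose S d p q := ordge d p /\ ordge d.+1 (p - q).
have SM d e p q p' q' : S d p q -> S e p' q' -> ordge d q -> S (d + e)%N (p * p') (q * q').
  move=> [a1 a2] [b1 b2] a3; split; first exact: ordgeM.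
  have -> : p * p' - q * q' = (p - q) * p' + q * (p' - q') by ring.
  by apply: ordgeD; [rewrite -addSn|rewrite -addnS]; apply: ordgeM.
have Sz i : S 1%N (G i) 'X_i.
  split; last exact: GX.
  by rewrite -[G i](subrK 'X_i); apply: ordgeD; [exact: ordgeW (GX i)|exact: ordgeXU].
rewrite mpolyXE_id mdegE.
suff : S (\sum_i m i)%N (\prod_i G i ^+ m i) (\prod_i 'X_i ^+ m i) by case.
elim/big_rec3: _ => [|i p q d _ IH].
  by split=> //; rewrite subrr; apply: ordge_0.
have Sk k : S k (G i ^+ k) ('X_i ^+ k) /\ ordge k ('X_i ^+ k : {mpoly K[n]}).
  elim: k => [|k [IHk ok]].
    by rewrite !expr0; split=> //; split=> //; rewrite subrr; apply: ordge_0.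
  rewrite !exprS -add1n; split; first by apply: SM => //; apply: ordgeXU.
  by apply: ordgeM => //; apply: ordgeXU.
by have [S1 S2] := Sk (m i); apply: SM.
Qed.

End MoreBasics.

Section LocalTheory.
Variables (K : numFieldType) (n : nat) (h : 'I_n -> {mpoly K[n]}) (lam : 'I_n -> K).
Implicit Types (p q : {mpoly K[n]}) (m a b : 'X_{1..n}).

(** The eigenvalue of the linear field with components lam_i x_i on the monomial of exponent [m]. *)
Definition wt (m : 'X_{1..n}) : K := \sum_i (m i)%:R * lam i.

Hypothesis h_lin : forall i, ordge 2 (h i - lam i *: 'X_i).
Hypothesis nonres : forall a b, wt a = wt b -> (mdeg a <= mdeg b)%N -> (a <= b)%MM.

Local Notation X := (Xder h).
Let dX := Xder_derivation h.

Lemma h_ordge1 i : ordge 1 (h i).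
Proof.
rewrite -[h i](subrK (lam i *: 'X_i)); apply: ordgeD; first exact: ordgeW (h_lin i).
exact/ordgeZ/ordgeXU.
Qed.

Lemma X_ordge d p : ordge d p -> ordge d (X p).
Proof.
move=> hp; apply: ordge_sum => i _.
apply: (@ordgeW _ _ (1 + d.-1)); first by case: (d).
by apply: ordgeM; [exact: h_ordge1|exact: ordge_mderiv].
Qed.

Lemma X_coeff d p m : ordge d p -> mdeg m = d -> (X p)@_m = wt m * p@_m.
Proof.
move=> hp md; have -> : X p = \sum_i (h i - lam i *: 'X_i) * mderiv i p
    + \sum_i lam i *: ('X_i * mderiv i p).
  rewrite -big_split; apply: eq_bigr => i _ /=.
  by rewrite mulrBl -scalerAl subrK.
rewrite mcoeffD (_ : (\sum_i (h i - _) * _)@_m = 0); last first.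
  apply: (@ordge_sum _ _ d.+1); last by rewrite md.
  move=> i _; apply: (@ordgeW _ _ (2 + d.-1)); first by case: (d).
  by apply: ordgeM; [exact: h_lin|exact: ordge_mderiv].
rewrite add0r raddf_sum /= /wt mulr_suml; apply: eq_bigr => i _.
by rewrite mcoeffZ mcoeff_mulX_mderiv mulrA [lam i * _]mulrC.
Qed.

Definition Y w p := X p - w *: p.

Lemma YD w p q : Y w (p + q) = Y w p + Y w q.
Proof. by rewrite /Y (derD dX) scalerDr opprD addrACA. Qed.
Lemma YZ w c p : Y w (c *: p) = c *: Y w p.
Proof. by rewrite /Y (derZ dX) scalerBr !scalerA [w * c]mulrC. Qed.
Lemma YC v w p : Y v (Y w p) = Y w (Y v p).
Proof.
by rewrite /Y !(derB dX) !(derZ dX) -!mul_mpolyC; ring.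
Qed.
Lemma YM u v p q : Y (u + v) (p * q) = Y u p * q + p * Y v q.
Proof. by rewrite /Y (derM dX) -!mul_mpolyC mpolyCD; ring. Qed.
Lemma Y_ordge w d p : ordge d p -> ordge d (Y w p).
Proof. by move=> hp; apply: ordgeB; [exact: X_ordge|exact: ordgeZ]. Qed.
Lemma Y_coeff w d p m : ordge d p -> mdeg m = d -> (Y w p)@_m = (wt m - w) * p@_m.
Proof. by move=> hp md; rewrite mcoeffB mcoeffZ (X_coeff hp md) mulrBl. Qed.

Lemma iterY_ordge w k d p : ordge d p -> ordge d (iter k (Y w) p).
Proof. by move=> hp; elim: k => //= k; apply: Y_ordge. Qed.
Lemma iterYD w k p q : iter k (Y w) (p + q) = iter k (Y w) p + iter k (Y w) q.
Proof. by elim: k => //= k ->; rewrite YD. Qed.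
Lemma iterYZ w k c p : iter k (Y w) (c *: p) = c *: iter k (Y w) p.
Proof. by elim: k => //= k ->; rewrite YZ. Qed.

(** Generalised eigenvectors of weight [w] in the quotient by order [N]: some power of X - w sends
    [p] into order [N]. *)
Definition geneig w N p := exists k, ordge N (iter k (Y w) p).

Lemma geneigD w N p q : geneig w N p -> geneig w N q -> geneig w N (p + q).
Proof.
move=> [k hk] [l hl]; exists (k + l)%N; rewrite iterYD; apply: ordgeD.
  by rewrite addnC iterD; apply: iterY_ordge.
by rewrite iterD; apply: iterY_ordge.
Qed.
Lemma geneigZ w N c p : geneig w N p -> geneig w N (c *: p).
Proof. by move=> [k hk]; exists k; rewrite iterYZ; apply: ordgeZ. Qed.
Lemma geneig0 w N : geneig w N 0.
Proof. by exists 0%N; apply: ordge_0. Qed.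
Lemma geneig_sum w N (I : Type) (r : seq I) (P : pred I) (F : I -> {mpoly K[n]}) :
  (forall i, P i -> geneig w N (F i)) -> geneig w N (\sum_(i <- r | P i) F i).
Proof. by move=> H; elim/big_ind: _ => //; [exact: geneig0|exact: geneigD]. Qed.

(** By the Leibniz rule X - (u + v) acts on one factor at a time as X - u or X - v; [k + l]
    applications exhaust at least one factor. *)
Lemma geneigM u v N p q : geneig u N p -> geneig v N q -> geneig (u + v) N (p * q).
Proof.
move=> [k hk] [l hl]; exists (k + l)%N; move: {2}(k + l)%N (leqnn (k + l)) => s.
elim: s k l p q hk hl => [|s IH] [|k] [|l] p q hk hl hs.
- exact: ordgeMl.
- by move: hs.
- by move: hs.
- by move: hs.
- by apply/iterY_ordge/ordgeMl.
- by apply/iterY_ordge/ordgeMl.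
- by apply/iterY_ordge/ordgeMr.
rewrite addSn iterSr YM iterYD; apply: ordgeD.
  by apply: IH => //; rewrite -?iterSr //; move: hs; rewrite addSn ltnS.
rewrite -addSnnS; apply: IH => //; rewrite -?iterSr //.
by move: hs; rewrite addnS ltnS.
Qed.

Lemma geneig1 N : geneig 0 N 1.
Proof.
exists 1%N; rewrite /= /Y scale0r subr0 -mpolyC1 (derC dX); exact: ordge_0.
Qed.

Lemma geneig_lowest w N d p m : geneig w N p -> ordge d p -> (d < N)%N ->
  mdeg m = d -> p@_m != 0 -> wt m = w.
Proof.
move=> [k hk] hp dN md pm.
have E : forall k, (iter k (Y w) p)@_m = (wt m - w) ^+ k * p@_m.
  elim=> [|j IH]; first by rewrite expr0 mul1r.
  by rewrite /= (Y_coeff w (iterY_ordge w j hp) md) IH exprS mulrA.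
have := hk m; rewrite md dN E => /(_ isT)/eqP; rewrite mulf_eq0 (negbTE pm) orbF.
by rewrite expf_eq0 subr_eq0 => /andP[_ /eqP].
Qed.

(* Projection onto the generalised eigenspace of weight w, modulo order N:
   divide out X - wt b for all the other weights of degree < N. *)
Definition wstep w b p := if wt b == w then p else (w - wt b)^-1 *: Y (wt b) p.
Definition wlevel w d p := foldr (wstep w) p
  [seq b <- map (@bmnm _ _) (enum {: 'X_{1..n < d.+1}}) | mdeg b == d].
Fixpoint wproj w N p := if N is d.+1 then wlevel w d (wproj w d p) else p.

Lemma Y_wstep v w b p : Y v (wstep w b p) = wstep w b (Y v p).
Proof. by rewrite /wstep; case: ifP => // _; rewrite YZ YC. Qed.

Lemma iterY_wlevel v w k d p : iter k (Y v) (wlevel w d p) = wlevel w d (iter k (Y v) p).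
Proof.
have E q : Y v (wlevel w d q) = wlevel w d (Y v q).
  by rewrite /wlevel; elim: [seq _ <- _ | _] => //= b s IH; rewrite Y_wstep IH.
by elim: k => //= k ->; rewrite E.
Qed.

Lemma wstep_ordge w b d p : ordge d p -> ordge d (wstep w b p).
Proof. by rewrite /wstep; case: ifP => // _ hp; apply/ordgeZ/Y_ordge. Qed.

(** On forms of degree [d] the field acts diagonally by [wt]. The level has killed all coefficients
    of weight other than [w], and X - w kills the remaining ones. *)
Lemma Y_wlevel w d p : ordge d p -> ordge d.+1 (Y w (wlevel w d p)).
Proof.
move=> hp; rewrite /wlevel; set s := [seq _ <- _ | _].
have hs : forall s', ordge d (foldr (wstep w) p s').
  by elim=> //= b s' IH; apply: wstep_ordge.
apply: ordge_eqP; first exact: Y_ordge.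
move=> m md; rewrite (Y_coeff w (hs s) md).
have [->|wm] := eqVneq (wt m) w; first by rewrite subrr mul0r.
have ms : m \in s.
  have lt : (mdeg m < d.+1)%N by rewrite md.
  rewrite mem_filter md eqxx /=; apply/mapP; exists (BMultinom lt) => //.
  by rewrite mem_enum.
suff -> : (foldr (wstep w) p s)@_m = 0 by rewrite mulr0.
elim: s ms => //= b s IH; rewrite inE => /orP[/eqP<-|ms].
  rewrite {1}/wstep (negbTE wm) mcoeffZ (Y_coeff _ (hs s) md) subrr mul0r.
  by rewrite mulr0.
rewrite {1}/wstep; case: ifP => _; first exact: IH.
by rewrite mcoeffZ (Y_coeff _ (hs s) md) IH // !mulr0.
Qed.

Lemma wproj_geneig w N p : geneig w N (wproj w N p).
Proof.
exists N; elim: N => //= d IH; rewrite iterY_wlevel; exact: Y_wlevel.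
Qed.

(** The projection is a composite of the maps (w - v)^-1 (X - v) with v different from [w], so it
    inherits whatever these preserve. *)
Lemma wproj_ind w N (Q : {mpoly K[n]} -> Prop) p :
  (forall v q, v != w -> Q q -> Q ((w - v)^-1 *: Y v q)) -> Q p -> Q (wproj w N p).
Proof.
move=> step Qp; elim: N => //= d IH; rewrite /wlevel.
elim: [seq _ <- _ | _] => //= b s IHs; rewrite {1}/wstep.
by case: eqVneq => // vw; apply: step.
Qed.

(** Coordinates tangent to the ['X_i] that are generalised eigenvectors modulo order [N]. They stand
    in for a formal normal form. *)
Definition zhat N i := wproj (lam i) N 'X_i.

Lemma zhat_lin N i : ordge 2 (zhat N i - 'X_i).
Proof.
apply: (@wproj_ind _ _ (fun q => ordge 2 (q - 'X_i))); last first.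
  by rewrite subrr; apply: ordge_0.
move=> v q vw hq.
have nz : lam i - v != 0 by rewrite subr_eq0 eq_sym.
have -> : (lam i - v)^-1 *: Y v q - 'X_i =
  (lam i - v)^-1 *: (Y v (q - 'X_i) + (h i - lam i *: 'X_i)).
  rewrite -[X in _ - X]scale1r -(mulVf nz) -scalerA -scalerBr; congr (_ *: _).
  rewrite /Y (derB dX) XderXU scalerBr scalerBl !opprB !addrA; ring.
by apply/ordgeZ/ordgeD => //; apply: Y_ordge.
Qed.

Definition zmon N m := \prod_i zhat N i ^+ m i.

Lemma zmonD N a b : zmon N (a + b)%MM = zmon N a * zmon N b.
Proof.
by rewrite /zmon -big_split; apply: eq_bigr => i _; rewrite mnmDE exprD.
Qed.

Lemma zmon_geneig N m : geneig (wt m) N (zmon N m).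
Proof.
rewrite /wt /zmon; elim/big_rec2: _ => [|i w p _ IH]; first exact: geneig1.
apply: geneigM => //; elim: (m i) => [|k IHk]; first by rewrite mul0r; apply: geneig1.
rewrite exprS mulrS mulrDl mul1r; apply: geneigM => //.
exact: wproj_geneig.
Qed.

Lemma zmon_lowest N m : ordge (mdeg m).+1 (zmon N m - 'X_[m]).
Proof. exact/prod_lowest/zhat_lin. Qed.

Lemma zmon_ordge N m : ordge (mdeg m) (zmon N m).
Proof.
rewrite -[zmon N m](subrK 'X_[m]); apply: ordgeD; last exact: ordgeX.
exact: ordgeW (leqnSn _) (@zmon_lowest N m).
Qed.

Lemma zmon_coeff N m m' : mdeg m' = mdeg m -> (zmon N m)@_m' = (m == m')%:R.
Proof.
move=> e; rewrite -mcoeffX; apply/eqP; rewrite -subr_eq0 -mcoeffB.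
by rewrite (@zmon_lowest N m) // e.
Qed.

(** The monomials of the lowest form of [p] have weight [wt a] and degree at least [mdeg a], so
    [nonres] makes them multiples of the monomial [a]. Subtracting the corresponding multiples of
    [zmon N a] raises the order and keeps the weight. *)
Lemma peel N a w p : geneig w N p -> wt a = w -> ordge (mdeg a) p ->
  exists q, ordge N (p - q * zmon N a).
Proof.
move=> gp wa op0; have [d ad op] : exists2 d, (mdeg a <= d)%N & ordge d p by exists (mdeg a).
clear op0.
move: {2}(N - d)%N (leqnn (N - d)) => k.
elim: k d p ad gp op => [|k IH] d p ad gp op kd.
  by exists 0; rewrite mul0r subr0; apply: ordgeW op; rewrite -subn_eq0 -leqn0.
have [Nd|dN] := leqP N d.
  by exists 0; rewrite mul0r subr0; apply: ordgeW op.
have wm m : m \in msupp (hpart d p) -> mdeg m = d /\ wt m = w.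
  rewrite mcoeff_msupp mcoeff_hpart; case: (mdeg _ =P d) => [md pm|_]; last by rewrite eqxx.
  by split=> //; apply: geneig_lowest gp op dN md pm.
pose s := \sum_(m <- msupp (hpart d p)) p@_m *: zmon N m.
have [||||q hq] := IH d.+1 (p - s); first exact: leqW ad.
- apply: geneigD => //; rewrite -scaleN1r; apply: geneigZ.
  rewrite /s big_seq; apply: geneig_sum => m /wm[md <-].
  by apply/geneigZ/zmon_geneig.
- apply: ordge_eqP.
    apply: ordgeB => //; rewrite /s big_seq; apply: ordge_sum => m /wm[md _].
    by apply: ordgeZ; rewrite -md; apply: zmon_ordge.
  move=> m md; rewrite mcoeffB /s raddf_sum /=.
  rewrite -[in X in X - _](_ : (hpart d p)@_m = p@_m); last first.
    by rewrite mcoeff_hpart md eqxx.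
  rewrite [X in _ - X](_ : _ = (hpart d p)@_m) ?subrr //.
  rewrite [in RHS](mpolyE (hpart d p)) raddf_sum /= !big_seq.
  apply: eq_bigr => m' /wm[md' _]; rewrite !mcoeffZ zmon_coeff ?md' // mcoeffX.
  by rewrite mcoeff_hpart md' eqxx.
- by rewrite subnS; move: kd; case: (N - d)%N.
exists (q + \sum_(m <- msupp (hpart d p)) p@_m *: zmon N (m - a)).
rewrite mulrDl opprD addrA [p - _ - _]addrAC.
suff -> : (\sum_(m <- msupp (hpart d p)) p@_m *: zmon N (m - a)) * zmon N a = s by [].
rewrite mulr_suml /s !big_seq; apply: eq_bigr => m /wm[md wmm].
rewrite -scalerAl -zmonD submK //; apply: nonres; rewrite ?wa // md //.
Qed.

Definition lowest a p := p@_a != 0 /\ ordge (mdeg a) p.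

Lemma lowest_exists p : p != 0 -> exists a, lowest a p.
Proof.
move=> /ordge_neq0[d [op hp]]; have := mlead_supp hp.
rewrite mcoeff_msupp mcoeff_hpart; case: (mdeg _ =P d) => [md pm|_]; last by rewrite eqxx.
by exists (mlead (hpart d p)); split=> //; rewrite md.
Qed.

Lemma lowest_weight kap phi a : X phi = kap * phi -> lowest a phi -> wt a = kap@_0%MM.
Proof.
move=> e [pa oa]; apply: (mulIf pa); rewrite -(X_coeff oa erefl) e.
have := mcoeff_hpart (0 + mdeg a) (kap * phi) a; rewrite eqxx => <-.
rewrite hpartM_low // (_ : hpart 0 kap = (kap@_0%MM)%:MP).
  by rewrite mcoeffCM mcoeff_hpart eqxx.
apply/mpolyP => m; rewrite mcoeff_hpart mcoeffC mdeg_eq0.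
by case: eqP => [->|]; rewrite ?mulr1 ?mulr0.
Qed.

Lemma unit_mod_ordge N (g : {mpoly K[n]}) : ordge 1 (1 - g) -> exists g', ordge N (1 - g' * g).
Proof.
move=> og; exists (\sum_(i < N) (1 - g) ^+ i).
have -> : 1 - (\sum_(i < N) (1 - g) ^+ i) * g = (1 - g) ^+ N.
  rewrite -[RHS](subrK 1) subrX1 (_ : 1 - g - 1 = - g); last by ring.
  by rewrite mulrC mulNr addrC.
by rewrite -{1}[N]muln1; apply: ordgeXn.
Qed.

(** Each factor (w - v)^-1 (X - v) of the projection sends g phi to g' phi with g'(0) = g(0) = 1,
    because kap(0) = w. So the projection multiplies [phi] by a unit; [peel] applies to the result,
    and the unit is inverted modulo order [N]. *)
Theorem semi_invariant_normal_form N kap phi a :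
  X phi = kap * phi -> lowest a phi -> exists q, ordge N (phi - q * zmon N a).
Proof.
move=> e low; have wa := lowest_weight e low; have [pa oa] := low.
set w := kap@_0%MM in wa.
have [g [gE og]] : exists g : {mpoly K[n]}, wproj w N phi = g * phi /\ ordge 1 (1 - g).
  apply: (@wproj_ind _ _ (fun q => exists g, q = g * phi /\ ordge 1 (1 - g))); last first.
    by exists 1; rewrite mul1r subrr; split=> //; apply: ordge_0.
  move=> v q vw [g [-> og]].
  have nz : w - v != 0 by rewrite subr_eq0 eq_sym.
  exists ((w - v)^-1 *: (X g + g * kap - v *: g)); split.
    rewrite -scalerAl; congr (_ *: _); rewrite /Y (derM dX) e.
    by rewrite -!mul_mpolyC; ring.
  have -> : 1 - (w - v)^-1 *: (X g + g * kap - v *: g) =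
     (w - v)^-1 *: (X (1 - g) + (1 - g) * kap - v *: (1 - g) - (kap - w%:MP)).
    rewrite -[1 in LHS](scale1r) -{1}(mulVf nz) -scalerA -scalerBr; congr (_ *: _).
    rewrite (derB dX) -mpolyC1 (derC dX) mpolyC1 -!mul_mpolyC mpolyCB; ring.
  apply/ordgeZ/ordgeB.
    apply: ordgeB; last exact: ordgeZ.
    by apply: ordgeD; [exact: X_ordge|exact: ordgeMl].
  move=> m; rewrite ltnS leqn0 mdeg_eq0 => /eqP ->.
  by rewrite mcoeffB mcoeffC eqxx mulr1 subrr.
have [|q hq] := @peel N a w (wproj w N phi) (wproj_geneig _ _ _) wa.
  by rewrite gE; apply: ordgeMr.
have [g' hg'] := unit_mod_ordge N og.
exists (g' * q).
have -> : phi - g' * q * zmon N a = (1 - g' * g) * phi + g' * (g * phi - q * zmon N a) by ring.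
by apply: ordgeD; [exact: ordgeMl|rewrite -gE; exact: ordgeMr].
Qed.

(** A common formal factor with linear part ['X_k], known only through approximations. The factors
    for different [N] need not be compatible. *)
Definition common_branch k phi psi := forall N, exists z,
  [/\ ordge 2 (z - 'X_k), exists q, ordge N (phi - q * z) & exists q, ordge N (psi - q * z)].

Lemma pair_common_branch k kap kap' phi psi a b :
  X phi = kap * phi -> X psi = kap' * psi -> lowest a phi -> lowest b psi ->
  (0 < a k)%N -> (0 < b k)%N -> common_branch k phi psi.
Proof.
move=> e e' la lb ak bk N; exists (zhat N k).
have div m : (0 < m k)%N -> exists c, zmon N m = c * zhat N k.
  move=> mk; exists (zmon N (m - U_(k))).
  have -> : zhat N k = zmon N U_(k).
    rewrite /zmon (bigD1 k) //= mnm1E eqxx expr1 big1 ?mulr1 // => i ik.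
    by rewrite mnm1E eq_sym (negbTE ik) expr0.
  by rewrite -zmonD submK // lep1mP -lt0n.
have [c ce] := div a ak; have [d de] := div b bk.
have [q hq] := semi_invariant_normal_form N e la.
have [q' hq'] := semi_invariant_normal_form N e' lb.
split; first exact: zhat_lin.
  by exists (q * c); rewrite -mulrA -ce.
by exists (q' * d); rewrite -mulrA -de.
Qed.

(** The derivative of a multiple of z^2 is a multiple of z. *)
Lemma double_common_branch k kap phi a D : derivation D ->
  (forall d p, ordge d p -> ordge d.-1 (D p)) ->
  X phi = kap * phi -> lowest a phi -> (1 < a k)%N -> common_branch k phi (D phi).
Proof.
(* One spare order, which [D] consumes. *)
move=> dD oD e la ak N; exists (zhat N.+1 k).
have [c ce] : exists c, zmon N.+1 a = c * zhat N.+1 k ^+ 2.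
  exists (zmon N.+1 (a - (U_(k) + U_(k)))).
  have -> : zhat N.+1 k ^+ 2 = zmon N.+1 (U_(k) + U_(k))%MM.
    rewrite /zmon (bigD1 k) //= mnmDE mnm1E eqxx big1 ?mulr1 // => i ik.
    by rewrite mnmDE mnm1E eq_sym (negbTE ik) expr0.
  rewrite -zmonD submK //; apply/mnm_lepP => i; rewrite mnmDE mnm1E.
  by case: eqP => [<-|]; rewrite ?addn0.
have [q hq] := semi_invariant_normal_form N.+1 e la.
set z := zhat N.+1 k in ce *; rewrite ce in hq.
split; first exact: zhat_lin.
  exists (q * c * z); rewrite (_ : q * c * z * z = q * (c * z ^+ 2)); last by ring.
  exact: ordgeW (leqnSn N) hq.
exists (D (q * c) * z + q * c * (D z *+ 2)).
have := oD _ _ hq; rewrite (derB dD) mulrA (derM dD) (der_exp dD) /= expr1.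
set A := D phi; set B := D _; set C := D z.
by rewrite (_ : A - _ = A - (B * z + q * c * (C *+ 2)) * z) //; ring.
Qed.

(** The lowest form P of the combination is divisible by x_k, and the directional derivative D along
    [w] kills P. Since D x_k is the nonzero constant w_k, writing P = x_k^(e+1) Q gives x_k^e ((e+1)
    w_k Q + x_k D Q) = 0, so x_k divides Q. In characteristic 0 every power of x_k then divides P,
    against its degree. *)
Lemma no_common_branch k phi psi u v (w : 'I_n -> K) :
  common_branch k phi psi -> u * phi + v * psi != 0 -> w k != 0 ->
  \sum_l w l *: mderiv l (u * phi + v * psi) = 0 -> False.
Proof.
move=> br; set r := u * phi + v * psi => r0 wk dr.
have {}br N : exists z q, ordge 2 (z - 'X_k) /\ ordge N (r - q * z).
  have [z [oz [q hq] [q' hq']]] := br N; exists z, (u * q + v * q'); split=> //.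
  have -> : r - (u * q + v * q') * z = u * (phi - q * z) + v * (psi - q' * z).
    by rewrite /r; ring.
  by apply: ordgeD; apply: ordgeMr.
have [d [od hd]] := ordge_neq0 r0.
have [S hS] : exists S, hpart d r = 'X_k * S.
  have [z [q [oz oq]]] := br d.+1.
  have oz1 : ordge 1 z.
    rewrite -[z](subrK 'X_k); apply: ordgeD; last exact: ordgeXU.
    exact: ordgeW oz.
  have hz : hpart 1 z = 'X_k.
    rewrite -[z](subrK 'X_k) hpartD (ordge_hpart0 oz) // add0r.
    exact/hpart_id/homogXU.
  have rE : hpart d r = hpart d (q * z).
    apply/eqP; rewrite -subr_eq0 -raddfB /=; apply/eqP.
    exact: ordge_hpart0 oq (ltnSn _).
  have q0 : q != 0 by apply: contraNneq hd => q0; rewrite rE q0 mul0r /hpart pihomog0.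
  have [e [oe he]] := ordge_neq0 q0.
  have oqz : ordge d (q * z).
    rewrite -[q * z](subKr r); apply: ordgeB => //; exact: ordgeW oq.
  have ed : (d <= e + 1)%N.
    rewrite leqNgt; apply/negP => lt; have := ordge_hpart0 oqz lt.
    rewrite hpartM_low // hz => /eqP; rewrite mulf_eq0 (negbTE he) /=.
    by move=> /eqP/(congr1 (mcoeff U_(k)%MM)) /eqP; rewrite mcoeffXU eqxx mcoeff0 oner_eq0.
  rewrite rE; case: d {od hd rE oq oqz br} ed => [|d] ed.
    by exists 0; rewrite mulr0; apply: (ordge_hpart0 (d := 1)) => //; apply: ordgeMr.
  exists (hpart d q); rewrite -addn1 hpartM_low ?hz 1?mulrC //.
  by apply: ordgeW oe; move: ed; rewrite addn1 ltnS.
case: d od hd hS => [|d] od hd hS.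
  have := congr1 (hpart 0) hS; rewrite (hpart_id (hpart_homog _ _)) => e.
  move: hd; rewrite e (ordge_hpart0 (d := 1)) ?eqxx //.
  by apply: ordgeMl; apply: ordgeXU.
set P := hpart d.+1 r in hd hS.
have dP : \sum_l w l *: mderiv l P = 0.
  transitivity (hpart d (\sum_l w l *: mderiv l r)).
    by rewrite hpart_sum; apply: eq_bigr => l _; rewrite hpartZ hpart_mderiv.
  by rewrite dr /hpart pihomog0.
pose D p : {mpoly K[n]} := \sum_l w l *: mderiv l p.
have dD : derivation D.
  split=> [p q|p q|c]; rewrite /D.
  - by rewrite -big_split; apply: eq_bigr => l _; rewrite mderivD scalerDr.
  - rewrite mulr_suml mulr_sumr -big_split /=; apply: eq_bigr => l _.
    by rewrite mderivM scalerDr scalerAl scalerAr.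
  - by rewrite big1 // => l _; rewrite mderivC scaler0.
have DX : D 'X_k = (w k)%:MP.
  rewrite /D (bigD1 k) //= mderivXU eqxx big1 ?addr0; first by rewrite -alg_mpolyC.
  by move=> l lk; rewrite mderivXU eq_sym (negbTE lk) scaler0.
have desc e : exists Q, P = 'X_k ^+ e.+1 * Q.
  elim: e => [|e [Q PE]]; first by exists S; rewrite expr1.
  have : D P = 0 by [].
  rewrite PE (derM dD) (der_exp dD) DX exprS /= => H.
  have X0 : ('X_k ^+ e : {mpoly K[n]}) != 0.
    rewrite expf_neq0 //; apply/eqP => /(congr1 (mcoeff U_(k)%MM)) /eqP.
    by rewrite mcoeffXU eqxx mcoeff0 oner_eq0.
  have E : 'X_k ^+ e * ((w k)%:MP * Q *+ e.+1 + 'X_k * D Q) = 0.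
    by apply: etrans H; rewrite mulrDr mulrnAr mulrnAl; congr (_ *+ _ + _); ring.
  move/eqP: E; rewrite mulf_eq0 (negbTE X0) /= mul_mpolyC -scaler_nat scalerA.
  rewrite addr_eq0 => /eqP {}H.
  have nz : e.+1%:R * w k != 0 by rewrite mulf_neq0 ?pnatr_eq0.
  have QE : Q = - (e.+1%:R * w k)^-1 *: ('X_k * D Q).
    by rewrite scaleNr -scalerN -H scalerA mulVf // scale1r.
  exists (- (e.+1%:R * w k)^-1 *: D Q).
  rewrite {1}QE -!scalerAr; congr (_ *: _).
  by rewrite !exprS; ring.
have [Q PE] := desc d.+1; move: hd; rewrite /P -(hpart_id (hpart_homog d.+1 r)) -/P PE.
rewrite (ordge_hpart0 (d := d.+2)) ?eqxx //; apply: ordgeMl.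
by rewrite -[X in ordge X]muln1; apply: ordgeXn; apply: ordgeXU.
Qed.

End LocalTheory.

(** * The Poincare transform *)

Section NonVanishing.
Variable K : numFieldType.

Lemma poly_nonroot (p : {poly K}) : p != 0 -> exists x, p.[x] != 0.
Proof.
move=> p0; apply: boolp.contrapT => no.
pose s : seq K := [seq i%:R | i <- iota 0 (size p)].
have us : uniq s.
  by rewrite map_inj_uniq ?iota_uniq // => i j /eqP; rewrite eqr_nat => /eqP.
have rs : all (root p) s.
  apply/allP => x _; rewrite rootE -[_ == _]negbK; apply/negP => h.
  by apply: no; exists x.
by have := max_poly_roots p0 rs us; rewrite size_map size_iota ltnn.
Qed.

Lemma meval_sep n (p : {mpoly K[n.+1]}) (v : 'I_n.+1 -> K) :
  p.@[v] = (map_poly (meval (fun k => v (lift ord0 k))) (sep ord0 p)).[v ord0].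
Proof.
elim/mpoly_gen_ind: p => [c|i|p q IHp IHq|p q IHp IHq].
- by rewrite sepC map_polyC hornerC /= !mevalC.
- rewrite sepXU /sep_var mevalXU; case: unliftP => [k ->|->].
    by rewrite map_polyC hornerC /= mevalXU.
  by rewrite map_polyX hornerX.
- by rewrite mevalD IHp IHq sepD [in RHS]rmorphD /= hornerD.
- by rewrite mevalM IHp IHq sepM [in RHS]rmorphM /= hornerM.
Qed.

Lemma mpoly_nonvanishing n (p : {mpoly K[n]}) : p != 0 -> exists v, p.@[v] != 0.
Proof.
elim: n p => [|n IH] p p0.
  by exists (fun=> 0); rewrite (nvar0_mpolyC p) mevalC -(mpolyC_eq0 0) -nvar0_mpolyC.
have sp0 : sep ord0 p != 0 by rewrite sep_eq0.
have [w hw] : exists w, (lead_coef (sep ord0 p)).@[w] != 0.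
  by apply: IH; rewrite lead_coef_eq0.
have [x hx] : exists x, (map_poly (meval w) (sep ord0 p)).[x] != 0.
  apply: poly_nonroot; apply: contraNneq hw => e.
  have := coef_map (meval w) (sep ord0 p) (size (sep ord0 p)).-1.
  by rewrite e coef0 => /esym /= ->.
exists (fun i => if unlift ord0 i is Some k then w k else x).
rewrite meval_sep unlift_none.
by have -> : (fun k => if unlift ord0 (lift ord0 k) is Some k0 then w k0 else x) = w
  by apply: boolp.funext => k; rewrite liftK.
Qed.

End NonVanishing.

Section Gradient.
Variables (K : fieldType) (n : nat).
Implicit Types (p q : {mpoly K[n]}) (u v : 'I_n -> K).

Definition grad p v u := \sum_k (mderiv k p).@[v] * u k.

Lemma grad_lsub (A : 'M[K]_n) p v u :
  grad (lsub A p) v u = grad p (mact A v) (mact A u).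
Proof.
rewrite /grad; under eq_bigr => k _.
  rewrite mderiv_lsub (raddf_sum (meval v)) mulr_suml /=.
  under eq_bigr do rewrite mevalZ lsub_eval.
  over.
rewrite exchange_big; apply: eq_bigr => k _; rewrite /mact mulr_sumr.
by apply: eq_bigr => l _; rewrite mulrCA mulrA.
Qed.

Lemma grad_euler d p v : p \is d.-homog -> grad p v v = d%:R * p.@[v].
Proof.
move=> /euler/(congr1 (meval v)); rewrite mevalZ => <-.
rewrite (raddf_sum (meval v)); apply: eq_bigr => k _.
by rewrite /= mevalM mevalXU mulrC.
Qed.

Lemma gradZ c p v u : grad (c *: p) v u = c * grad p v u.
Proof.
by rewrite /grad mulr_sumr; apply: eq_bigr => k _; rewrite mderivZ mevalZ mulrA.
Qed.

Lemma grad_sum (I : Type) (r : seq I) (P : pred I) (F : I -> {mpoly K[n]}) v u :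
  grad (\sum_(i <- r | P i) F i) v u = \sum_(i <- r | P i) grad (F i) v u.
Proof.
rewrite /grad exchange_big; apply: eq_bigr => k _.
rewrite (der_sum (mderiv_derivation K k)) (raddf_sum (meval v)) mulr_suml.
by [].
Qed.

Lemma ordge2_grad0 p u : ordge 2 p -> grad p (fun=> 0) u = 0.
Proof.
move=> op; rewrite /grad big1 // => k _.
by have /ordge1P -> := ordge_mderiv k op; rewrite mul0r.
Qed.

Lemma linear_part p : ordge 1 p ->
  ordge 2 (p - \sum_l (mderiv l p).@[fun=> 0] *: 'X_l).
Proof.
move=> op; apply: ordge_eqP.
  apply: ordgeB => //; apply: ordge_sum => l _; exact/ordgeZ/ordgeXU.
move=> m /eqP/mdeg1P[i /eqP->]; rewrite mcoeffB raddf_sum /= (bigD1 i) //=.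
rewrite big1 => [|j ji]; last by rewrite mcoeffZ mcoeffXU (negbTE ji) mulr0.
rewrite mcoeffZ mcoeffXU eqxx mulr1 addr0.
have E q : q.@[fun=> 0] = q@_0%MM.
  have /ordge1P : ordge 1 (q - (q@_0%MM)%:MP).
    move=> m'; rewrite ltnS leqn0 mdeg_eq0 => /eqP ->.
    by rewrite mcoeffB mcoeffC eqxx mulr1 subrr.
  by rewrite mevalB mevalC => /eqP; rewrite subr_eq0 => /eqP.
by rewrite E mcoeff_deriv add0m mnm0E subrr.
Qed.

End Gradient.

(** * Dehomogenisation in the chart of the Poincare transform *)

Section Star.
Variables (K : numFieldType) (n : nat).
Implicit Types (p q : {mpoly K[n.+1]}).

(** Index shift of the chart: the variable [wid l] stands for the homogeneous coordinate
    [lift ord0 l], and [ord_max] is the homogenising variable, whose zero set is the hyperplane at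
    infinity. *)
Definition wid (l : 'I_n) : 'I_n.+1 := widen_ord (leqnSn n) l.
Definition dirac0 : 'I_n.+1 -> K := fun i => ((i : nat) == 0%N)%:R.
Local Notation yl := ('X_ord_max : {mpoly K[n.+1]}).
Local Notation dsub := (dehom_sub K n.+1).

Lemma Xn_ord (i : 'I_n.+1) : Xn K n.+1 i = 'X_i.
Proof. by rewrite /Xn insubT //=; congr 'X_ _; apply: val_inj. Qed.

Lemma dehom0 : tnth dsub ord0 = 1.
Proof. by rewrite tnth_mktuple. Qed.

Lemma dehomS (l : 'I_n) : tnth dsub (lift ord0 l) = 'X_(wid l).
Proof. by rewrite tnth_mktuple -(Xn_ord (wid l)). Qed.

(** Homogenise to degree [d], then set the first coordinate to 1. With [d] a parameter instead of
    the degree of [p], the operation is additive, and multiplicative when degree bounds add. *)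
Definition star d p : {mpoly K[n.+1]} :=
  \sum_(j < d.+1) (hpart j p \mPo dsub) * yl ^+ (d - j).

Lemma star_homog d j p : p \is j.-homog -> (j <= d)%N ->
  star d p = (p \mPo dsub) * yl ^+ (d - j).
Proof.
move=> hp jd; rewrite /star (bigD1 (inord j)) //= inordK ?ltnS // hpart_id //.
rewrite big1 ?addr0 // => i ij; rewrite (@hpart_other _ _ _ j) ?comp_mpoly0 ?mul0r //.
by apply: contraNneq ij => e; apply/eqP/val_inj; rewrite /= inordK ?ltnS.
Qed.

Lemma starD d p q : star d (p + q) = star d p + star d q.
Proof.
by rewrite /star -big_split; apply: eq_bigr => j _; rewrite hpartD comp_mpolyD mulrDl.
Qed.

Lemma star0 d : star d 0 = 0.
Proof.
by rewrite /star big1 // => j _; rewrite /hpart pihomog0 comp_mpoly0 mul0r.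
Qed.

Lemma star_sum d (I : Type) (r : seq I) (P : pred I) (F : I -> {mpoly K[n.+1]}) :
  star d (\sum_(i <- r | P i) F i) = \sum_(i <- r | P i) star d (F i).
Proof. exact: (big_morph (star d) (starD d) (star0 d)). Qed.

Lemma homog_partition d p : (msize p <= d.+1)%N -> p = \sum_(j < d.+1) hpart j p.
Proof. exact: pihomog_partitionE. Qed.

Lemma starM d e p q : (msize p <= d.+1)%N -> (msize q <= e.+1)%N ->
  star (d + e) (p * q) = star d p * star e q.
Proof.
move=> sp sq; rewrite {1}(homog_partition sp) {1}(homog_partition sq).
rewrite mulr_suml star_sum /star mulr_suml; apply: eq_bigr => i _.
rewrite mulr_sumr -/(star (d + e) _) star_sum mulr_sumr; apply: eq_bigr => j _.
have [il jl] := (ltn_ord i, ltn_ord j); rewrite !ltnS in il jl.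
rewrite (@star_homog _ (i + j)) ?leq_add ?dhomogM ?hpart_homog //.
rewrite rmorphM /= (_ : (d + e - (i + j) = (d - i) + (e - j))%N) ?exprD; last by lia.
ring.
Qed.

Lemma star_eval0 d p : (star d p).@[fun=> 0] = (hpart d p).@[dirac0].
Proof.
rewrite /star (raddf_sum (meval _)) /= big_ord_recr /= subnn expr0 mulr1.
rewrite big1 ?add0r => [|j _].
  rewrite comp_mpoly_meval; apply: meval_eq => i.
  case: (unliftP ord0 i) => [l ->|->]; first by rewrite dehomS mevalXU.
  by rewrite dehom0 meval1.
by rewrite mevalM rmorphXn /= mevalXU expr0n subn_eq0 leqNgt ltn_ord mulr0.
Qed.

Lemma star_top d p : exists w, star d p = (hpart d p \mPo dsub) + w * yl.
Proof.
exists (\sum_(j < d) (hpart j p \mPo dsub) * yl ^+ (d - j).-1).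
rewrite /star big_ord_recr /= subnn expr0 mulr1 addrC; congr (_ + _).
rewrite mulr_suml; apply: eq_bigr => j _.
by rewrite -mulrA -exprSr prednK // subn_gt0 ltn_ord.
Qed.

Lemma mulXU_neq0 (i : 'I_n.+1) p : p != 0 -> 'X_i * p != 0.
Proof.
move=> p0; rewrite mulf_neq0 //; apply/eqP => /(congr1 (mcoeff U_(i)%MM)) /eqP.
by rewrite mcoeffXU eqxx mcoeff0 oner_eq0.
Qed.

(** At a point x with p(x) and x_0 nonzero, the chart point with last coordinate c = 1/x_0 and the
    others c x_l gives [star d p] the value c^d p(x). *)
Lemma star_neq0 d p : p != 0 -> (msize p <= d.+1)%N -> star d p != 0.
Proof.
move=> p0 sp; have [x] := mpoly_nonvanishing (mulXU_neq0 ord0 p0).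
rewrite mevalM mevalXU mulf_eq0 negb_or => /andP[x0 px].
pose c := (x ord0)^-1; have c0 : c != 0 by rewrite invr_eq0.
pose y : 'I_n.+1 -> K := fun i => if unlift ord_max i is Some l then c * x (lift ord0 l) else c.
have ymax : y ord_max = c by rewrite /y unlift_none.
have ywid l : y (wid l) = c * x (lift ord0 l).
  have -> : wid l = lift ord_max l by apply: val_inj; rewrite /= /bump leqNgt ltn_ord.
  by rewrite /y liftK.
suff E : (star d p).@[y] = c ^+ d * p.@[x].
  apply: contraNneq px => s0; move/eqP: E.
  by rewrite s0 meval0 eq_sym mulf_eq0 expf_eq0 (negbTE c0) andbF.
rewrite {2}(homog_partition sp) /star !(raddf_sum (meval _)) mulr_sumr /=.
apply: eq_bigr => j _; rewrite mevalM rmorphXn /= mevalXU ymax.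
have -> : (hpart j p \mPo dsub).@[y] = (hpart j p).@[fun i => c * x i].
  rewrite comp_mpoly_meval; apply: meval_eq => i.
  case: (unliftP ord0 i) => [l ->|->]; first by rewrite dehomS mevalXU ywid.
  by rewrite dehom0 meval1 mulVf.
rewrite (homog_eval c x (hpart_homog j p)) mulrAC -exprD subnKC //.
by rewrite -ltnS ltn_ord.
Qed.

Lemma mderiv_wid_dehom (l : 'I_n) p :
  mderiv (wid l) (p \mPo dsub) = mderiv (lift ord0 l) p \mPo dsub.
Proof.
rewrite (der_comp (mderiv_derivation K (wid l))) (bigD1 (lift ord0 l)) //=.
rewrite dehomS mderivXU eqxx mulr1 big1 ?addr0 // => i il.
case: (unliftP ord0 i) => [k kE|->].
  rewrite kE dehomS mderivXU; case: eqP => [/(congr1 val) /= kl|]; last by rewrite mulr0.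
  by case/eqP: il; rewrite kE; congr lift; apply: val_inj.
by rewrite dehom0 -mpolyC1 mderivC mulr0.
Qed.

Lemma mderiv_max_dehom p : mderiv ord_max (p \mPo dsub) = 0.
Proof.
rewrite (der_comp (mderiv_derivation K ord_max)) big1 // => i _.
case: (unliftP ord0 i) => [k ->|->]; last by rewrite dehom0 -mpolyC1 mderivC mulr0.
rewrite dehomS mderivXU; case: eqP => [/(congr1 val) /= kl|]; rewrite ?mulr0 //.
by have := ltn_ord k; rewrite kl ltnn.
Qed.

Lemma mderiv_star (l : 'I_n) d p : (msize p <= d.+1)%N ->
  mderiv (wid l) (star d p) = star d.-1 (mderiv (lift ord0 l) p).
Proof.
move=> sp; rewrite {2}(homog_partition sp).
rewrite (der_sum (mderiv_derivation K (lift ord0 l))) star_sum.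
rewrite /star (der_sum (mderiv_derivation K (wid l))); apply: eq_bigr => j _.
rewrite -/(star d.-1 _) mderivM mderiv_wid_dehom (der_exp (mderiv_derivation K _)).
rewrite mderivXU (_ : (ord_max == wid l) = false) ?mulr0 ?mul0rn ?mulr0 ?addr0; last first.
  by apply/negbTE/eqP => /(congr1 val) /= nl; have := ltn_ord l; rewrite -nl ltnn.
have := hpart_homog j p; have := ltn_ord j; rewrite ltnS.
case: (nat_of_ord j) => [|j'] jd hj.
  have -> : hpart 0 p = (p@_0%MM)%:MP.
    apply/mpolyP => m; rewrite mcoeff_hpart mcoeffC mdeg_eq0.
    by case: eqP => [->|_]; rewrite ?mulr1 ?mulr0.
  by rewrite mderivC comp_mpoly0 mul0r star0.
have jd' : (j' <= d.-1)%N by lia.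
by rewrite (star_homog (mderiv_homog _ hj) jd'); congr (_ * _ ^+ _); lia.
Qed.

Section Poincare.
Variables (f : 'I_n.+1 -> {mpoly K[n.+1]}) (m : nat) (T : 'M[K]_n.+1).
Local Notation F := (conjF f T).
Local Notation P := (poincare f m T).
Let dP := Xder_derivation P.

Lemma Xn_max : Xn K n.+1 n.+1.-1 = 'X_ord_max.
Proof. exact: (Xn_ord ord_max). Qed.

Lemma GdehE (k : 'I_n.+1) : Gdeh f m T k = star m (F k).
Proof.
rewrite /Gdeh (valK k) /star; apply: eq_bigr => j _.
by rewrite Xn_max.
Qed.

Lemma poincare_wid (l : 'I_n) :
  P (wid l) = star m (F (lift ord0 l)) - star m (F ord0) * 'X_(wid l).
Proof.
have lt : ((wid l).+1 < n.+1)%N by rewrite ltnS; apply: (ltn_ord l).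
rewrite /poincare lt (GdehE ord0) (Xn_ord (wid l)) addrC mulNr.
by rewrite (GdehE (lift ord0 l)).
Qed.

Lemma poincare_max : P ord_max = - (star m (F ord0) * yl).
Proof. by rewrite /poincare ltnn (GdehE ord0) Xn_max mulNr. Qed.

Lemma Xder_dehom (k : 'I_n.+1) :
  Xder P (tnth dsub k) = star m (F k) - star m (F ord0) * tnth dsub k.
Proof.
case: (unliftP ord0 k) => [l ->|->]; first by rewrite dehomS XderXU poincare_wid.
by rewrite dehom0 mulr1 subrr -mpolyC1 (derC dP).
Qed.

(** Checked on each homogeneous part. In degree j, Euler's identity accounts for j copies of the
    correction term and the power of the homogenising variable for the other d - j. *)
Lemma Xder_star d p : (msize p <= d.+1)%N ->
  Xder P (star d p) = \sum_k star d.-1 (mderiv k p) * star m (F k)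
                      - d%:R *: (star m (F ord0) * star d p).
Proof.
move=> sp; set G0 := star m (F ord0).
have H j q : q \is j.-homog -> (j <= d)%N ->
    Xder P (star d q) = \sum_k star d.-1 (mderiv k q) * star m (F k) - d%:R *: (G0 * star d q).
  move=> hq jd; rewrite (star_homog hq jd) (derM dP) (der_exp dP) XderXU poincare_max -/G0.
  rewrite (der_comp dP).
  under eq_bigr do rewrite Xder_dehom mulrBr.
  rewrite sumrB mulrBl -addrA; congr (_ + _).
    rewrite mulr_suml; apply: eq_bigr => k _; rewrite mulrAC; congr (_ * _).
    case: j hq jd => [|j] hq jd.
      have -> : mderiv k q = 0.
        apply/mpolyP => m'; rewrite mcoeff_deriv mcoeff0 (homog_coeff0 hq) ?mul0rn //.
        by rewrite mdegD mdeg1 addn1.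
      by rewrite comp_mpoly0 star0 mul0r.
    have jd' : (j <= d.-1)%N by lia.
    by rewrite (star_homog (mderiv_homog k hq) jd'); congr (_ * _ ^+ _); lia.
  have -> : \sum_i (mderiv i q \mPo dsub) * (G0 * tnth dsub i) = j%:R *: (G0 * (q \mPo dsub)).
    have /(congr1 (comp_mpoly dsub)) := euler hq.
    rewrite comp_mpolyZ (raddf_sum (comp_mpoly dsub)) /= scalerAr => <-.
    rewrite mulr_sumr; apply: eq_bigr => i _.
    rewrite rmorphM /= comp_mpolyXU -tnth_nth; ring.
  have -> : d%:R = j%:R + (d - j)%:R :> K by rewrite -natrD subnKC.
  rewrite scalerDl opprD; congr (- _ + _); first by rewrite -scalerAl mulrA.
  rewrite scaler_nat -mulrnAr; case: (d - j)%N => [|e].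
    by rewrite !mulr0n !mulr0 oppr0.
  by rewrite /= exprSr !mulrnAr !mulrN mulNrn; congr (- (_ *+ _)); ring.
rewrite {1 3}(homog_partition sp) star_sum (der_sum dP).
have jd (j : 'I_d.+1) : (j <= d)%N by rewrite -ltnS; apply: ltn_ord j.
rewrite (eq_bigr _ (fun (j : 'I_d.+1) _ => H j (hpart j p) (hpart_homog j p) (jd j))).
rewrite sumrB -scaler_sumr -mulr_sumr -star_sum -homog_partition //; congr (_ - _).
rewrite exchange_big; apply: eq_bigr => k _ /=; rewrite -mulr_suml; congr (_ * _).
by rewrite -star_sum -(der_sum (mderiv_derivation K k)) -homog_partition.
Qed.

(** The sum in [Xder_star] is [star] of lmb p in degree d - 1 + m, hence a product with [star d p];
    the correction term is already a multiple of [star d p]. *)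
Lemma poincare_semi_invariant d p lmb : (forall k, (msize (F k) <= m.+1)%N) ->
  p != 0 -> (msize p <= d.+1)%N -> d.+1 = msize p -> (0 < d)%N ->
  Xder F p = lmb * p -> exists kap, Xder P (star d p) = kap * star d p.
Proof.
move=> sF p0 sp sp' d0 e; rewrite (Xder_star sp).
have -> : \sum_k star d.-1 (mderiv k p) * star m (F k) = star (d.-1 + m) (lmb * p).
  rewrite -e /Xder star_sum; apply: eq_bigr => k _; rewrite mulrC -starM //.
    by rewrite addnC.
  by rewrite prednK //; apply: msize_mderiv.
have [->|l0] := eqVneq lmb 0.
  by exists (- (d%:R *: star m (F ord0))); rewrite mul0r star0 sub0r scalerAl mulNr.
have sX : (msize (lmb * p) <= (d.-1 + m).+1)%N.
  rewrite -e; apply: msize_sum_leq => k _; rewrite addnC; apply: msizeM_leq => //.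
  by rewrite prednK //; apply: msize_mderiv.
have l1 : (0 < msize lmb)%N by rewrite lt0n msize_poly_eq0.
have [dm sl] : (d <= d.-1 + m)%N /\ (msize lmb <= (d.-1 + m - d).+1)%N.
  move: sX; rewrite msizeM // -sp'; move: (msize lmb) l1 => s s1 sX.
  by split; lia.
exists (star (d.-1 + m - d) lmb - d%:R *: star m (F ord0)).
by have := starM sl sp; rewrite (subnK dm) => ->; rewrite mulrBl scalerAl.
Qed.

End Poincare.

End Star.

(** * Consequences of property E *)

Section LinearAlgebra.
Variables (K : fieldType) (n : nat).

Lemma unit_of_injective (A : 'M[K]_n) :
  (forall x, (forall i, mact A x i = 0) -> forall i, x i = 0) -> A \in unitmx.
Proof.
move=> H; rewrite -unitmx_tr -row_free_unit -kermx_eq0; apply/eqP/row_matrixP => r.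
have /sub_kermxP := row_sub r (kermx A^T); set w := row r _ => wA.
rewrite row0; apply/rowP => i; rewrite [RHS]mxE; apply: (H (fun j => w 0 j)) => k.
transitivity ((w *m A^T) 0 k); last by rewrite wA mxE.
by rewrite [RHS]mxE; apply: eq_bigr => j _; rewrite [A^T _ _]mxE mulrC.
Qed.

Lemma mact_injective (A : 'M[K]_n) x : A \in unitmx ->
  (forall i, mact A x i = 0) -> forall i, x i = 0.
Proof.
move=> uA H i; rewrite -(mactK x uA) (_ : mact A x = fun=> 0); last exact: boolp.funext.
by rewrite /mact big1 // => j _; rewrite mulr0.
Qed.

(** Applying the product of the J - lam_j over j other than i to a relation isolates its i-th term,
    with a nonzero factor as the eigenvalues are distinct. *)
Lemma eigenrows_unit (J : 'M[K]_n) (lam : 'I_n -> K) (S : 'M[K]_n) :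
  injective lam -> (forall i, row i S != 0) ->
  (forall i, row i S *m J = lam i *: row i S) -> S \in unitmx.
Proof.
move=> lamI S0 eig; rewrite -row_free_unit -kermx_eq0; apply/eqP/row_matrixP => r.
set u := row r (kermx S); rewrite row0.
have uS : \sum_i u 0 i *: row i S = 0.
  by rewrite -mulmx_sum_row; apply/sub_kermxP/row_sub.
have H (js : seq 'I_n) : \sum_i (u 0 i * \prod_(j <- js) (lam i - lam j)) *: row i S = 0.
  elim: js => [|j js IH].
    by rewrite -[RHS]uS; apply: eq_bigr => i _; rewrite big_nil mulr1.
  have /(congr1 (fun w => w *m J - lam j *: w)) := IH.
  rewrite mul0mx scaler0 subr0 mulmx_suml scaler_sumr -sumrB => E.
  rewrite -[RHS]E; apply: eq_bigr => i _.
  rewrite -scalemxAl eig !scalerA -scalerBl big_cons; congr (_ *: _); ring.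
apply/rowP => i; rewrite [RHS]mxE.
have := H (rem i (enum 'I_n)); rewrite (bigD1 i) //= [X in _ + X]big1 ?addr0 => [|k ki].
  move=> /eqP; rewrite scaler_eq0 (negbTE (S0 i)) orbF mulf_eq0 => /orP[/eqP//|].
  rewrite prodf_seq_eq0 => /hasP[j /= js]; rewrite subr_eq0 => /eqP/lamI ij.
  by move: js; rewrite ij mem_rem_uniq ?enum_uniq // inE eqxx.
rewrite (big_rem k) /=; first by rewrite subrr mul0r mulr0 scale0r.
by rewrite mem_rem_uniq ?enum_uniq // inE ki mem_enum.
Qed.

(** Row eigenvectors are the linear forms that become new coordinates. The prescribed one, [e], will
    be the equation of the hyperplane at infinity. *)
Lemma diagonalising_rows (J : 'M[K]_n) (lam : 'I_n -> K) (e : 'rV[K]_n) a :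
  char_poly J = \prod_(i < n) ('X - (lam i)%:P) -> injective lam ->
  e != 0 -> e *m J = a *: e ->
  exists (S : 'M[K]_n) (i0 : 'I_n), [/\ S \in unitmx,
    forall i, row i S *m J = lam i *: row i S, row i0 S = e & lam i0 = a].
Proof.
move=> cp lamI e0 eJ.
have ev b : root (char_poly J) b -> exists w : 'rV[K]_n, w *m J = b *: w /\ w != 0.
  by rewrite -eigenvalue_root_char => /eigenvalueP[w]; exists w.
have rootlam i : root (char_poly J) (lam i).
  by rewrite cp (bigD1 i) //= rootM root_XsubC eqxx.
have [w Hw] := boolp.choice (fun i => ev _ (rootlam i)).
have : root (char_poly J) a.
  by rewrite -eigenvalue_root_char; apply/eigenvalueP; exists e.
rewrite cp rootE horner_prod => /eqP/eqP/prodf_eq0[i0 _].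
rewrite !hornerE subr_eq0 => /eqP ai0.
pose S := \matrix_i (if i == i0 then e else w i).
have rS i : row i S = if i == i0 then e else w i by rewrite rowK.
have eS i : row i S *m J = lam i *: row i S.
  rewrite rS; case: eqP => [->|_]; first by rewrite eJ ai0.
  by have [] := Hw i.
exists S, i0; split=> //; last by rewrite rS eqxx.
apply: eigenrows_unit lamI _ eS => i; rewrite rS.
by case: (i =P i0) => // _; case: (Hw i).
Qed.

End LinearAlgebra.

Lemma matrix_to_axis (K : fieldType) (n : nat) (v : 'I_n.+1 -> K) (k : 'I_n.+1) : v k != 0 ->
  exists T : 'M[K]_n.+1, T \in unitmx /\ mact T v = (fun i => ((i : nat) == 0%N)%:R).
Proof.
move=> vk.
(* The columns are [v] and all standard basis vectors except the k-th, which the transposition moves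
   out of the way. *)
pose A : 'M[K]_n.+1 := \matrix_(i, j) (if j == ord0 then v i else (i == tperm ord0 k j)%:R).
have Av x i : mact A x i = v i * x ord0 +
      \sum_(j < n) (i == tperm ord0 k (lift ord0 j))%:R * x (lift ord0 j).
  rewrite /mact big_ord_recl mxE eqxx; congr (_ + _).
  by apply: eq_bigr => j _; rewrite mxE eq_sym (negbTE (neq_lift ord0 j)).
have uA : A \in unitmx.
  apply: unit_of_injective => x Hx.
  have x0 : x ord0 = 0.
    have := Hx k; rewrite Av big1 => [|j _].
      by rewrite addr0 => /eqP; rewrite mulf_eq0 (negbTE vk) => /eqP.
    case: eqP => [/(congr1 (tperm ord0 k))|]; last by rewrite mul0r.
    by rewrite tpermK tpermR => /eqP; rewrite (negbTE (neq_lift ord0 j)).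
  move=> i; case: (unliftP ord0 i) => [j ->|->] //.
  have := Hx (tperm ord0 k (lift ord0 j)).
  rewrite Av x0 mulr0 add0r (bigD1 j) //= eqxx mul1r big1 ?addr0 // => l lj.
  rewrite (inj_eq perm_inj) (inj_eq lift_inj) eq_sym (negbTE lj) mul0r //.
exists (invmx A); split; first by rewrite unitmx_inv.
rewrite -[RHS](mactK _ uA); congr (mact _ _); apply: boolp.funext => i.
rewrite Av /= mulr1 big1 ?addr0 // => j _; by rewrite mulr0.
Qed.


(** Both alternatives of property E in one statement. In the second, n-1 independent eigenvalues
    leave one index [k]; subtracting a multiple of [mu] makes the coefficient at [k] zero, so every
    relation is proportional to [mu]. *)
Lemma sign_relation (K : numFieldType) (n : nat) (lam : 'I_n -> K) :
  (Qdim lam n \/ (Qdim lam n.-1 /\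
     exists mu : 'I_n -> nat, (forall i, (0 < mu i)%N) /\ \sum_(i < n) (mu i)%:R * lam i = 0)) ->
  forall c : 'I_n -> rat, \sum_i ratr (c i) * lam i = 0 ->
  [\/ forall i, c i = 0, forall i, 0 < c i | forall i, c i < 0].
Proof.
case=> [[[S [cS indS]] _] c c0|[[[S [cS indS]] _] [mu [mu0 muE]]] c c0].
  apply: Or31; apply: indS c0 => i; have -> : S = [set: 'I_n].
    by apply/eqP; rewrite eqEcard subsetT cardsT card_ord cS leqnn.
  by rewrite inE.
case: n => [|n] in lam S cS indS mu mu0 muE c c0 *; first by apply: Or31; case.
have /cards1P[k Sk] : #|~: S| == 1%N.
  by rewrite cardsCs setCK cS card_ord /= subSnn.
have mk : (mu k)%:R != 0 :> rat by rewrite pnatr_eq0 -lt0n.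
pose q := c k / (mu k)%:R.
have H i : c i = q * (mu i)%:R.
  apply/eqP; rewrite -subr_eq0; apply/eqP.
  apply: (indS (fun i => c i - q * (mu i)%:R)) => [j|].
    rewrite -in_setC Sk inE => /eqP ->.
    by rewrite /q mulfVK // subrr.
  under eq_bigr do rewrite rmorphB rmorphM /= ratr_nat mulrBl -[ratr q * _ * _]mulrA.
  by rewrite sumrB c0 -mulr_sumr muE mulr0 subrr.
case: (ltrgtP q 0) => q0; [apply: Or33|apply: Or32|apply: Or31] => i; rewrite H.
- by rewrite nmulr_rlt0 // ltr0n.
- by rewrite mulr_gt0 // ltr0n.
- by rewrite q0 mul0r.
Qed.

(** The difference b - a is a relation: zero or positive in all entries gives the claim, and
    negative in all entries contradicts the degrees. *)
Lemma sign_nonresonant (K : numFieldType) (n : nat) (lam : 'I_n -> K) :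
  (forall c : 'I_n -> rat, \sum_i ratr (c i) * lam i = 0 ->
   [\/ forall i, c i = 0, forall i, 0 < c i | forall i, c i < 0]) ->
  forall a b : 'X_{1..n}, wt lam a = wt lam b -> (mdeg a <= mdeg b)%N -> (a <= b)%MM.
Proof.
move=> sgn a b ab mab; apply/mnm_lepP => i.
have [|h|h|h] := sgn (fun i => (b i)%:R - (a i)%:R).
- under eq_bigr do rewrite rmorphB /= !ratr_nat mulrBl.
  by rewrite sumrB -/(wt lam b) -/(wt lam a) ab subrr.
- by have /eqP := h i; rewrite subr_eq0 eqr_nat => /eqP ->.
- by have := h i; rewrite subr_gt0 ltr_nat => /ltnW.
exfalso; move: mab; rewrite !mdegE leqNgt => /negP; apply.
have lt j : (b j < a j)%N by have := h j; rewrite subr_lt0 ltr_nat.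
rewrite (bigD1 i) //= [X in (_ < X)%N](bigD1 i) //= -addSn.
by apply: leq_add => //; apply: leq_sum => j _; apply: ltnW.
Qed.

Section PoincareJacobian.
Variables (K : numFieldType) (n : nat) (f : 'I_n.+1 -> {mpoly K[n.+1]}) (m : nat).
Variables (T : 'M[K]_n.+1) (c : K).
Local Notation F := (conjF f T).
Local Notation e1 := (@dirac0 K n).
Hypothesis sF : forall k, (msize (F k) <= m.+1)%N.
Hypothesis Fe1 : forall k, (hpart m (F k)).@[e1] = c * e1 k.
Local Notation J := (jacobian (poincare f m T) (fun=> 0)).

Lemma mderiv_hpart0 (i : 'I_n.+1) (p : {mpoly K[n.+1]}) : mderiv i (hpart 0 p) = 0.
Proof.
apply/mpolyP => m'; rewrite mcoeff_deriv mcoeff_hpart mdegD mdeg1 addn1 /=.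
by rewrite mcoeff0 mul0rn.
Qed.

Lemma star_mderiv_eval0 d (k : 'I_n.+1) (p : {mpoly K[n.+1]}) : (msize p <= d.+1)%N ->
  (star d.-1 (mderiv k p)).@[fun=> 0] = (mderiv k (hpart d p)).@[e1].
Proof.
move=> sp; rewrite star_eval0; case: d sp => [|d] sp; last by rewrite hpart_mderiv.
have -> : mderiv k p = 0.
  by apply/eqP; rewrite -msize_poly_eq0 -leqn0 msize_mderiv.
by rewrite mderiv_hpart0 /hpart pihomog0.
Qed.

Lemma jacobian_wid (k l : 'I_n) :
  J (wid k) (wid l) = (mderiv (lift ord0 l) (hpart m (F (lift ord0 k)))).@[e1] - c * (k == l)%:R.
Proof.
rewrite mxE poincare_wid mderivB mevalB mderiv_star // star_mderiv_eval0 //; congr (_ - _).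
rewrite mderivM mevalD !mevalM mevalXU mulr0 add0r star_eval0 Fe1 mulr1 mderivXU.
rewrite (_ : (wid k == wid l) = (k == l)); last by [].
by case: (k == l); rewrite ?meval1 ?meval0.
Qed.

(** The hyperplane at infinity is invariant: its equation is a left eigenvector of the Jacobian,
    with eigenvalue -c. *)
Lemma jacobian_max (l : 'I_n.+1) : J ord_max l = - c * (ord_max == l)%:R.
Proof.
rewrite mxE poincare_max mderivN mevalN mderivM mevalD !mevalM mevalXU mulr0 add0r.
rewrite star_eval0 Fe1 mulr1 mderivXU mulNr; congr (- (_ * _)).
by case: eqP; rewrite ?meval1 ?meval0.
Qed.

End PoincareJacobian.

(** * Transversality along stationary lines *)

Section Frame.
Variables (K : numClosedFieldType) (n : nat) (f : 'I_n.+1 -> {mpoly K[n.+1]}) (m : nat).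
Variables (v : 'I_n.+1 -> K) (c : K).
Hypothesis n0 : (0 < n)%N.
Hypothesis sf : forall i, (msize (f i) <= m.+1)%N.
Hypothesis Ef : propE f m.
Hypothesis v0 : nonzero_pt v.
Hypothesis stat : forall j, (topf f m j).@[v] = c * v j.
Local Notation e1 := (@dirac0 K n).

Definition signed_relations (lam : 'I_n.+1 -> K) :=
  forall a : 'I_n.+1 -> rat, \sum_i ratr (a i) * lam i = 0 ->
  [\/ forall i, a i = 0, forall i, 0 < a i | forall i, a i < 0].

Lemma conj_stationary T : T \in unitmx -> mact T v = e1 ->
  forall k, (hpart m (conjF f T k)).@[e1] = c * e1 k.
Proof.
move=> uT Tv k; rewrite topf_conj conjF_eval -Tv mactK //.
rewrite (_ : (fun j => (topf f m j).@[v]) = fun j => c * v j) ?mactZ //.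
exact: boolp.funext.
Qed.

Lemma frame_exists : exists (T S : 'M[K]_n.+1) (lam : 'I_n.+1 -> K) (i0 : 'I_n.+1),
  [/\ T \in unitmx, mact T v = e1, S \in unitmx & signed_relations lam] /\
  [/\ forall i, row i S *m jacobian (poincare f m T) (fun=> 0) = lam i *: row i S,
      row i0 S = delta_mx 0 ord_max & lam i0 = - c].
Proof.
have [k vk] := v0; have [T [uT Tv]] := matrix_to_axis vk.
pose J := jacobian (poincare f m T) (fun=> 0).
have [rs cpJ] := closed_field_poly_normal (char_poly J).
move: cpJ; rewrite (monicP (char_poly_monic J)) scale1r => cpJ.
have srs : size rs = n.+1.
  by have := size_char_poly J; rewrite cpJ size_prod_XsubC => -[].
pose lam (i : 'I_n.+1) := rs`_i.
have cpl : char_poly J = \prod_(i < n.+1) ('X - (lam i)%:P).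
  by rewrite cpJ (big_nth 0) srs big_mkord.
have in_l : in_line (topf f m) v by exists c.
have Tv' i : \sum_(j < n.+1) T i j * v j = ((i : nat) == 0%N)%:R.
  by have := congr1 (fun w => w i) Tv.
have sgn : signed_relations lam := sign_relation (Ef v0 in_l uT Tv' cpl).
(* Equal eigenvalues would give a relation with coefficients 1 and -1. *)
have lamI : injective lam.
  move=> i j lij; apply/eqP; apply/negPn/negP => /eqP ij.
  have ji : (j == i) = false by apply/eqP => e; apply: ij.
  have [|h|h|h] := sgn (fun k => (k == i)%:R - (k == j)%:R).
  - under eq_bigr do rewrite rmorphB /= !ratr_nat mulrBl.
    rewrite sumrB (bigD1 i) //= eqxx mul1r big1 => [|k' /negbTE ->]; last by rewrite mul0r.
    rewrite (bigD1 j) //= eqxx mul1r big1 => [|k' /negbTE ->]; last by rewrite mul0r.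
    by rewrite !addr0 lij subrr.
  - by have := h j; rewrite eqxx ji sub0r.
  - by have := h j; rewrite eqxx ji sub0r.
  - by have := h i; rewrite eqxx eq_sym ji subr0.
have e0 : delta_mx 0 ord_max != 0 :> 'rV[K]_n.+1.
  apply/eqP => /(congr1 (fun w : 'rV_n.+1 => w 0 ord_max)) /eqP.
  by rewrite !mxE !eqxx oner_eq0.
have eJ : delta_mx 0 ord_max *m J = (- c) *: delta_mx 0 ord_max :> 'rV[K]_n.+1.
  rewrite -rowE; apply/rowP => l; rewrite [LHS]mxE [RHS]mxE [delta_mx _ _ _ _]mxE eqxx /=.
  rewrite (jacobian_max (c := c)); first by rewrite eq_sym.
  exact: conj_stationary.
have [S [i0 [uS eS rS li0]]] := diagonalising_rows cpl lamI e0 eJ.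
by exists T, S, lam, i0; split.
Qed.

Section InFrame.
Variables (T S : 'M[K]_n.+1) (lam : 'I_n.+1 -> K) (i0 : 'I_n.+1).
Hypotheses (uT : T \in unitmx) (Tv : mact T v = e1) (uS : S \in unitmx).
Hypothesis sgn : signed_relations lam.
Local Notation F := (conjF f T).
Local Notation P := (poincare f m T).
Local Notation J := (jacobian P (fun=> 0)).
Local Notation Ti := (invmx T).
Local Notation Si := (invmx S).
Hypothesis eigS : forall i, row i S *m J = lam i *: row i S.
Hypothesis rowS : row i0 S = delta_mx 0 ord_max.
Hypothesis lami0 : lam i0 = - c.

Let sF k : (msize (F k) <= m.+1)%N.
Proof. exact: conjF_msize. Qed.

Let Fe1 := conj_stationary uT Tv.

Lemma Tie1 : mact Ti e1 = v.
Proof. by rewrite -Tv mactK. Qed.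

(** A zero eigenvalue would give a relation with one entry 1 and, as there are at least two indices,
    another entry 0. *)
Lemma lam_neq0 i : lam i != 0.
Proof.
apply/negP => /eqP li.
have [j ji] : exists j : 'I_n.+1, j != i.
  have [e|h] := eqVneq ord0 i; last by exists ord0.
  by exists ord_max; rewrite -e -val_eqE /= -lt0n.
have [|h|h|h] := sgn (a := fun k => (k == i)%:R).
- rewrite (bigD1 i) //= li mulr0 big1 ?addr0 // => k /negbTE ->.
  by rewrite rmorph0 mul0r.
- by have := h i; rewrite eqxx => /eqP; rewrite oner_eq0.
- by have := h j; rewrite (negbTE ji) ltxx.
- by have := h j; rewrite (negbTE ji) ltxx.
Qed.

Lemma c_neq0 : c != 0.
Proof. by have := lam_neq0 i0; rewrite lami0 oppr_eq0. Qed.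

Lemma S_i0 l : S i0 l = (l == ord_max)%:R.
Proof. by have := congr1 (fun w : 'rV_n.+1 => w 0 l) rowS; rewrite !mxE eqxx. Qed.

(** Otherwise row k would be proportional to row [i0], which is supported on [ord_max]. The index
    [l] supplies a direction of the chart transversal to the branch [k]. *)
Lemma S_other k : k != i0 -> exists l : 'I_n, S k (wid l) != 0.
Proof.
move=> ki; apply: boolp.contrapT => no.
have Sk l : S k (wid l) = 0.
  by apply/eqP; rewrite -[_ == _]negbK; apply/negP => h; apply: no; exists l.
pose x i : K := (i == k)%:R - S k ord_max * (i == i0)%:R.
have : forall i, x i = 0.
  apply: (@mact_injective _ _ S^T); first by rewrite unitmx_tr.
  move=> l; rewrite /mact.
  under eq_bigr do rewrite mxE /x mulrBr mulrCA.
  rewrite sumrB -mulr_sumr (bigD1 k) //= eqxx mulr1 big1 => [|j /negbTE ->]; last by rewrite mulr0.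
  rewrite (bigD1 i0) //= eqxx mulr1 big1 => [|j /negbTE ->]; last by rewrite mulr0.
  rewrite !addr0 S_i0; have [->|lm] := eqVneq l ord_max; first by rewrite mulr1 subrr.
  rewrite mulr0 subr0; case: (unliftP ord_max l) => [l' lE|e]; last by rewrite e eqxx in lm.
  have -> : l = wid l'; last exact: Sk.
  by rewrite lE; apply: val_inj; rewrite /= /bump leqNgt ltn_ord.
by move=> /(_ k)/eqP; rewrite /x eqxx (negbTE ki) mulr0 subr0 oner_eq0.
Qed.

(* The tangent vector of the affine chart x_1 = 1 corresponding to a vector of K^n. *)
Definition chart (U : 'I_n.+1 -> K) : 'I_n.+1 -> K :=
  fun i => if unlift ord_max i is Some l then U (lift ord0 l) else 0.

Lemma chart_max U : chart U ord_max = 0.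
Proof. by rewrite /chart unlift_none. Qed.

Lemma chart_wid U l : chart U (wid l) = U (lift ord0 l).
Proof.
have -> : wid l = lift ord_max l by apply: val_inj; rewrite /= /bump leqNgt ltn_ord.
by rewrite /chart liftK.
Qed.

Lemma e1_lift l : e1 (lift ord0 l) = 0.
Proof. by []. Qed.

Lemma e1_0 : e1 ord0 = 1.
Proof. by []. Qed.

Lemma chart_eq0 u : (forall i, chart (mact T u) i = 0) -> exists b, forall i, u i = b * v i.
Proof.
move=> H; pose U := mact T u; exists (U ord0) => i.
have UE : U = fun j => U ord0 * e1 j.
  apply: boolp.funext => j; case: (unliftP ord0 j) => [l ->|->].
    by rewrite -chart_wid /U H e1_lift mulr0.
  by rewrite e1_0 mulr1.
by rewrite -{1}(mactK u uT) -/U {1}UE mactZ Tie1.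
Qed.

Lemma grad_e1 (p : {mpoly K[n.+1]}) : grad p e1 e1 = (mderiv ord0 p).@[e1].
Proof.
rewrite /grad big_ord_recl big1 ?addr0 => [|l _]; last by rewrite e1_lift mulr0.
by rewrite e1_0 mulr1.
Qed.

Lemma grad_chart d (p : {mpoly K[n.+1]}) U : p \is d.-homog -> p.@[e1] = 0 ->
  \sum_(l < n) (mderiv (lift ord0 l) p).@[e1] * U (lift ord0 l) = grad p e1 U.
Proof.
move=> hp pe; rewrite [RHS]/grad big_ord_recl -grad_e1 (grad_euler _ hp) pe.
by rewrite mulr0 mul0r add0r.
Qed.

Lemma grad_conj u i :
  grad (hpart m (F i)) e1 (mact T u) = mact T (fun j => grad (topf f m j) v u) i.
Proof.
rewrite topf_conj /conjF grad_sum; apply: eq_bigr => j _.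
by rewrite gradZ -/(lsub Ti _) grad_lsub Tie1 mactK.
Qed.

(** On vectors with last coordinate 0 the Jacobian is the map that Dg(v) - c induces on the quotient
    by the line of [v]. Its eigenvalues being nonzero, the class of [u] vanishes. *)
Lemma nondegenerate_in_frame u a :
  (forall j, grad (topf f m j) v u = c * u j + a * v j) ->
  exists b, forall i, u i = b * v i.
Proof.
move=> Hu; apply: chart_eq0; set U := mact T u.
have JY i : \sum_l J i l * chart U l = 0.
  rewrite big_ord_recr /= chart_max mulr0 addr0.
  case: (unliftP ord_max i) => [k kE|->]; last first.
    rewrite big1 // => l _; rewrite (jacobian_max Fe1) (_ : (ord_max == _) = false).
      by rewrite mulr0 mul0r.
    by apply/eqP => /(congr1 val) /= e; have := ltn_ord l; rewrite -e ltnn.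
  have -> : i = wid k by rewrite kE; apply: val_inj; rewrite /= /bump leqNgt ltn_ord.
  under eq_bigr do rewrite -/(wid _) chart_wid (jacobian_wid sF Fe1) mulrBl.
  rewrite sumrB (grad_chart _ (hpart_homog _ _)) ?Fe1 ?e1_lift ?mulr0 //.
  rewrite (bigD1 k) //= eqxx mulr1 big1 ?addr0 => [|l /negbTE lk]; last first.
    by rewrite eq_sym lk mulr0 mul0r.
  rewrite /U grad_conj (_ : (fun j => _) = fun j => c * u j + a * v j); last exact: boolp.funext.
  have -> : mact T (fun j => c * u j + a * v j) (lift ord0 k) =
     c * mact T u (lift ord0 k) + a * mact T v (lift ord0 k).
    rewrite /mact !mulr_sumr -big_split; apply: eq_bigr => j _ /=; ring.
  by rewrite Tv e1_lift mulr0 addr0 subrr.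
apply: (mact_injective uS) => i; apply: (mulfI (lam_neq0 i)); rewrite mulr0.
transitivity (\sum_l (row i S *m J) 0 l * chart U l).
  rewrite eigS /mact mulr_sumr; apply: eq_bigr => l _.
  by rewrite !mxE mulrA.
transitivity (\sum_j S i j * (\sum_l J j l * chart U l)); last first.
  by rewrite big1 // => j _; rewrite JY mulr0.
under eq_bigr do rewrite mxE mulr_suml; rewrite exchange_big; apply: eq_bigr => j _ /=.
by rewrite mulr_sumr; apply: eq_bigr => l _; rewrite !mxE mulrA.
Qed.

Let nonres := sign_nonresonant sgn.

Lemma poincare_ordge1 j : ordge 1 (P j).
Proof.
apply/ordge1P; case: (unliftP ord_max j) => [k kE|->].
  have -> : j = wid k by rewrite kE; apply: val_inj; rewrite /= /bump leqNgt ltn_ord.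
  by rewrite poincare_wid mevalB mevalM mevalXU mulr0 subr0 star_eval0 Fe1 e1_lift mulr0.
by rewrite poincare_max mevalN mevalM mevalXU mulr0 oppr0.
Qed.

Lemma conj_poincare_lin i : ordge 2 (conjF P S i - lam i *: 'X_i).
Proof.
pose L j : {mpoly K[n.+1]} := \sum_l J j l *: 'X_l.
have oL j : ordge 2 (P j - L j).
  have := linear_part (poincare_ordge1 j).
  by rewrite /L; under [X in _ - X]eq_bigr do rewrite -[_.@[_]](mxE matrix_key
    (fun i j => (mderiv j (P i)).@[fun=> 0])).
have -> : lam i *: 'X_i = \sum_j S i j *: lsub Si (L j).
  have -> : 'X_i = lsub Si (\sum_l S i l *: 'X_l) by rewrite -lsubXU lsubVK.
  rewrite -lsubZ; under [RHS]eq_bigr do rewrite -lsubZ.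
  rewrite -lsub_sum; congr lsub; rewrite scaler_sumr.
  under [RHS]eq_bigr do rewrite scaler_sumr.
  rewrite exchange_big; apply: eq_bigr => l _ /=.
  under eq_bigr do rewrite scalerA; rewrite -scaler_suml scalerA; congr (_ *: _).
  have := congr1 (fun w : 'rV_n.+1 => w 0 l) (eigS i); rewrite !mxE => <-.
  by apply: eq_bigr => j _; rewrite mxE.
rewrite /conjF -sumrB; apply: ordge_sum => j _.
by rewrite -scalerBr -/(lsub Si (P j)) -(raddfB (comp_mpoly _)); apply/ordgeZ/lsub_ordge.
Qed.

Lemma direction_lsub j (A : {mpoly K[n.+1]}) :
  \sum_k S k j *: mderiv k (lsub Si A) = lsub Si (mderiv j A).
Proof.
rewrite -{2}(lsubK A uS) mderiv_lsub lsub_sum; apply: eq_bigr => k _.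
by rewrite lsubZ lsubVK.
Qed.

(** Eliminating the coordinate [lift ord0 l] yields a combination whose [star] has zero derivative
    along [wid l], a direction transversal to the branch because S_kl is nonzero; [no_common_branch]
    applies. If [q] lacks that coordinate, it is its own eliminant. *)
Lemma no_branch_by_elimination k (l : 'I_n) (q p : {mpoly K[n.+1]}) r s :
  S k (wid l) != 0 -> mirreducible q -> (msize q <= r.+1)%N -> (msize p <= s.+1)%N ->
  (~ mdivides q p \/ mderiv (lift ord0 l) q = 0) ->
  common_branch k (lsub Si (star r q)) (lsub Si (star s p)) -> False.
Proof.
move=> Skl qi sq sp H br.
have [u [w [R0 dR]]] : exists u w, u * q + w * p != 0 /\
    mderiv (lift ord0 l) (u * q + w * p) = 0.
  case: H => [nd|dq]; first exact: mpoly_eliminate.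
  exists 1, 0; rewrite mul1r mul0r addr0; split=> //.
  by case: qi => + _; rewrite /nonconstant; case: eqVneq => // ->; rewrite msize0.
set R := u * q + w * p in R0 dR.
(* Any degree large enough for both products will do; [star] is multiplicative only when the degree
   bounds add up. *)
pose e := (msize u + msize w + r + s)%N.
have [su sw] : (msize u <= (e - r).+1)%N /\ (msize w <= (e - s).+1)%N.
  by rewrite /e; move: (msize u) (msize w) => a b; split; lia.
have [re se] : (r <= e)%N /\ (s <= e)%N by rewrite /e; split; lia.
have sR : (msize R <= e.+1)%N.
  apply: (leq_trans (msizeD_le _ _)); rewrite geq_max.
  have := msizeM_leq su sq; rewrite subnK // => ->.
  by have := msizeM_leq sw sp; rewrite subnK.
have starR : star e R = star (e - r) u * star r q + star (e - s) w * star s p.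
  have := starM su sq; have := starM sw sp; rewrite !subnK // => <- <-.
  exact: starD.
have E : lsub Si (star e R) =
   lsub Si (star (e - r) u) * lsub Si (star r q) + lsub Si (star (e - s) w) * lsub Si (star s p).
  by rewrite starR lsubD !lsubM.
apply: (@no_common_branch _ _ k _ _ (lsub Si (star (e - r) u)) (lsub Si (star (e - s) w))
  (fun k => S k (wid l)) br _ Skl); last first.
  by rewrite -E direction_lsub mderiv_star // dR star0 lsub0.
rewrite -E; apply: contra_neq (star_neq0 R0 sR); apply: lsub_eq0.
by rewrite unitmx_inv.
Qed.

Section Transversality.
Variable phi : 'I_n -> {mpoly K[n.+1]}.
Hypothesis phi_irr : forall i, mirreducible (phi i).
Hypothesis phi_prime : forall i j, i != j -> rel_prime (phi i) (phi j).
Hypothesis phi_semi : forall i, semi_invariant f (phi i).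
Hypothesis phi_v : forall i, (hpart (tdeg (phi i)) (phi i)).@[v] = 0.

Let r i := tdeg (phi i).
Let q i := lsub Ti (phi i).
Let st i := star (r i) (q i).
Let psi i := lsub Si (st i).

Let uTi : Ti \in unitmx. Proof. by rewrite unitmx_inv. Qed.
Let uSi : Si \in unitmx. Proof. by rewrite unitmx_inv. Qed.

Let r0 i : (0 < r i)%N.
Proof. by have [h _] := phi_irr i; rewrite /r /tdeg -ltnS prednK // ltnW. Qed.

Let sq i : msize (q i) = (r i).+1.
Proof. by rewrite lsub_msize // /r /tdeg prednK // ltnW //; case: (phi_irr i). Qed.

Let q0 i : q i != 0.
Proof. by rewrite -msize_poly_eq0 sq. Qed.

Lemma mirreducible_lsub A p : A \in unitmx -> mirreducible p ->
  mirreducible (lsub (A : 'M[K]_n.+1) p).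
Proof.
move=> uA [np ip]; split; first by rewrite /nonconstant lsub_msize.
move=> a b ab; have uAi : invmx A \in unitmx by rewrite unitmx_inv.
have E : p = lsub (invmx A) a * lsub (invmx A) b by rewrite -lsubM -ab lsubVK.
by have := ip _ _ E; rewrite /nonconstant !lsub_msize.
Qed.

Let q_irr i : mirreducible (q i).
Proof. exact: mirreducible_lsub. Qed.

Let q_ndiv i j : i != j -> ~ mdivides (q i) (q j).
Proof.
move=> ij [p qE]; have [ni _] := phi_irr i.
apply: (phi_prime ij _ _ ni); first by exists 1; rewrite mulr1.
exists (lsub T p).
by rewrite -[LHS](lsubK _ uT) -/(q j) qE lsubM lsubK.
Qed.

Let st_semi i : exists kap, Xder P (st i) = kap * st i.
Proof.
have [_ [lmb e]] := phi_semi i.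
apply: (poincare_semi_invariant (lmb := lsub Ti lmb)) => //; rewrite ?sq //.
by rewrite Xder_conj // e lsubM.
Qed.

Let psi_semi i : exists kap, Xder (conjF P S) (psi i) = kap * psi i.
Proof.
have [kap e] := st_semi i; exists (lsub Si kap).
by rewrite Xder_conj // e lsubM.
Qed.

Let psi0 i : psi i != 0.
Proof.
have := @star_neq0 _ _ (r i) (q i) (q0 i); rewrite sq => /(_ (leqnn _)).
by apply: contra_neq; apply: lsub_eq0.
Qed.

Let qe1 i : (hpart (r i) (q i)).@[e1] = 0.
Proof. by rewrite hpart_lsub lsub_eval Tie1; apply: phi_v. Qed.

Let psi_ordge1 i : ordge 1 (psi i).
Proof. by apply/lsub_ordge/ordge1P; rewrite star_eval0 qe1. Qed.

Let low_pos i a : lowest a (psi i) -> exists k, (0 < a k)%N.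
Proof.
move=> [ai _]; apply: boolp.contrapT => no.
have a0 : a = 0%MM.
  apply/mnmP => k; rewrite mnm0E; apply/eqP; rewrite -leqn0 leqNgt.
  by apply/negP => h; apply: no; exists k.
by move: ai; rewrite a0 (psi_ordge1 i) ?eqxx // mdeg0.
Qed.

(* The hyperplane at infinity is not tangent to the semi-invariants. *)
Let low_i0 i a : lowest a (psi i) -> a i0 = 0%N.
Proof.
move=> la; apply/eqP; rewrite -leqn0 leqNgt; apply/negP => ai.
have [kap e] := psi_semi i.
have yE : lsub Si 'X_ord_max = 'X_i0.
  have -> : 'X_ord_max = lsub S 'X_i0 :> {mpoly K[n.+1]}.
    rewrite lsubXU (bigD1 ord_max) //= S_i0 eqxx scale1r big1 ?addr0 // => l lm.
    by rewrite S_i0 (negbTE lm) scale0r.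
  by rewrite lsubVK.
have ey : Xder (conjF P S) 'X_i0 = lsub Si (- star m (F ord0)) * 'X_i0.
  have := Xder_conj P 'X_ord_max uS; rewrite XderXU poincare_max yE => ->.
  by rewrite -mulNr lsubM yE.
have ly : lowest U_(i0)%MM ('X_i0 : {mpoly K[n.+1]}).
  by split; [rewrite mcoeffX eqxx oner_eq0|exact: ordgeX].
have yi : (0 < U_(i0)%MM i0)%N by rewrite mnm1E eqxx.
have br := pair_common_branch conj_poincare_lin nonres e ey la ly ai yi.
(* [A] is [st i] with the homogenising variable set to 0; it is free of that variable, so it serves
   as the eliminant of [psi i] and ['X_i0]. *)
set A := hpart (r i) (q i) \mPo dehom_sub K n.+1.
have [w stE] := star_top (r i) (q i).
have A0 : A != 0.
  have hp0 : hpart (r i) (q i) != 0 by have := hpart_tdeg_neq0 (q0 i); rewrite /tdeg sq.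
  have := star_neq0 hp0 (homog_msize_le (hpart_homog _ _)).
  by rewrite (star_homog (hpart_homog _ _)) // subnn expr0 mulr1.
have E : lsub Si A = 1 * psi i + (- lsub Si w) * 'X_i0.
  by rewrite -yE mul1r mulNr -lsubM /psi /st stE lsubD addrK.
apply: (@no_common_branch _ _ i0 _ _ 1 (- lsub Si w) (fun k => S k ord_max) br); rewrite -?E.
- by apply: contra_neq A0; apply: lsub_eq0.
- by rewrite S_i0 eqxx oner_eq0.
- by rewrite direction_lsub // mderiv_max_dehom lsub0.
Qed.

(** A shared coordinate is not [i0], so it gives a common branch to which elimination between the
    coprime [q i] and [q j] applies. *)
Let low_disjoint i j a b k : lowest a (psi i) -> lowest b (psi j) ->
  (0 < a k)%N -> (0 < b k)%N -> i = j.
Proof.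
move=> la lb ak bk; apply/eqP; apply/negPn/negP => ij.
have ki : k != i0 by apply: contraTneq ak => ->; rewrite (low_i0 la).
have [l Skl] := S_other ki.
have [kap e] := psi_semi i; have [kap' e'] := psi_semi j.
have br := pair_common_branch conj_poincare_lin nonres e e' la lb ak bk.
apply: (no_branch_by_elimination Skl (q_irr i) _ _ _ br); rewrite ?sq //.
by left; apply: q_ndiv.
Qed.

(** A repeated coordinate is a common branch of [psi i] and its derivative along a chart direction.
    The irreducible [q i] does not divide its own nonzero derivative, for reasons of degree. *)
Let low_simple i a k : lowest a (psi i) -> (a k <= 1)%N.
Proof.
move=> la; rewrite leqNgt; apply/negP => ak.
have ki : k != i0 by apply: contraTneq ak => ->; rewrite (low_i0 la).
have [l Skl] := S_other ki; have [kap e] := psi_semi i.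
pose D (p : {mpoly K[n.+1]}) := \sum_k S k (wid l) *: mderiv k p.
have dD : derivation D.
  split=> [x y|x y|b]; rewrite /D.
  - by rewrite -big_split; apply: eq_bigr => t _; rewrite mderivD scalerDr.
  - rewrite mulr_suml mulr_sumr -big_split /=; apply: eq_bigr => t _.
    by rewrite mderivM scalerDr scalerAl scalerAr.
  - by rewrite big1 // => t _; rewrite mderivC scaler0.
have oD d p : ordge d p -> ordge d.-1 (D p).
  by move=> op; apply: ordge_sum => t _; apply/ordgeZ/ordge_mderiv.
have br := double_common_branch conj_poincare_lin nonres dD oD e la ak.
have sr : (msize (q i) <= (r i).+1)%N by rewrite sq.
have sd : (msize (mderiv (lift ord0 l) (q i)) <= (r i).-1.+1)%N.
  by rewrite prednK //; apply: msize_mderiv.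
have DE : D (psi i) = lsub Si (star (r i).-1 (mderiv (lift ord0 l) (q i))).
  by rewrite /D direction_lsub // mderiv_star.
rewrite DE in br.
apply: (no_branch_by_elimination Skl (q_irr i) sr sd _ br).
have [->|d0] := eqVneq (mderiv (lift ord0 l) (q i)) 0; first by right.
left; case=> w dE; move: sd; rewrite prednK // dE.
have w0 : w != 0 by apply: contraNneq d0 => w0; rewrite dE w0 mulr0.
rewrite msizeM // sq; move: w0; rewrite -msize_poly_eq0.
by move: (msize w) => s; lia.
Qed.

(** The lowest monomials have n nonempty, pairwise disjoint supports among the n indices other than
    [i0]. All are therefore singletons, with exponent one by [low_simple]. *)
Lemma psi_linear : exists k : 'I_n -> 'I_n.+1,
  [/\ injective k, forall i, k i != i0 &
   forall i, exists2 b, b != 0 & ordge 2 (psi i - b *: 'X_(k i))].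
Proof.
have [a la] := boolp.choice (fun i => lowest_exists (psi0 i)).
have [k ak] := boolp.choice (fun i => low_pos (la i)).
have kI : injective k.
  by move=> i j kij; apply: (low_disjoint (la i) (la j) (ak i)); rewrite kij; apply: ak.
have ki0 i : k i != i0.
  by apply: contraTneq (ak i) => ->; rewrite (low_i0 (la i)).
have ksurj t : t != i0 -> exists i, k i = t.
  move=> ti; have : t \in [set k i | i : 'I_n].
    suff -> : [set k i | i : 'I_n] = ~: [set i0] by rewrite !inE.
    apply/eqP; rewrite eqEcard; apply/andP; split.
      by apply/subsetP => _ /imsetP[i _ ->]; rewrite !inE.
    by rewrite card_imset // cardsCs setCK cards1 !card_ord subn1.
  by case/imsetP => i _ ->; exists i.
have aE i : a i = U_(k i)%MM.
  apply/mnmP => t; rewrite mnm1E; have [<-|kt] := eqVneq (k i) t.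
    by apply/eqP; rewrite eqn_leq (low_simple _ (la i)) ak.
  apply/eqP; rewrite -leqn0 leqNgt; apply/negP => at0.
  have ti : t != i0 by apply: contraTneq at0 => ->; rewrite (low_i0 (la i)).
  have [j kj] := ksurj t ti; have : i = j.
    by apply: (low_disjoint (la i) (la j) at0); rewrite -kj.
  by move=> ij; rewrite ij kj eqxx in kt.
exists k; split=> // i; have [ai _] := la i.
exists ((psi i)@_(a i)) => //; apply: ordge_eqP.
  by apply: ordgeB => //; apply/ordgeZ/ordgeXU.
move=> t t1; rewrite mcoeffB mcoeffZ mcoeffX -aE.
have [->|ta] := eqVneq (a i) t; first by rewrite mulr1 subrr.
(* A second linear monomial would have the same weight, and [nonres] in both directions identifies
   it with the first. *)
rewrite mulr0 subr0; apply/eqP; apply/negPn/negP => pt.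
have [kap e] := psi_semi i.
have lt : lowest t (psi i) by split=> //; rewrite t1.
have wtE := etrans (lowest_weight conj_poincare_lin e lt)
  (esym (lowest_weight conj_poincare_lin e (la i))).
have da : mdeg (a i) = 1%N by rewrite aE mdeg1.
have /mnm_lepP h1 : (t <= a i)%MM by apply: (nonres wtE); rewrite t1 da.
have /mnm_lepP h2 : (a i <= t)%MM by apply: (nonres (esym wtE)); rewrite t1 da.
by case/eqP: ta; apply/mnmP => j; apply/eqP; rewrite eqn_leq h1 h2.
Qed.

(** At the origin the differential of [psi i] is a nonzero multiple of the coordinate [k i]. These
    coordinates of the chart vector vanish by hypothesis, and the one at [i0] because chart vectors
    have last entry 0. *)
Theorem transversal_in_frame u :
  (forall i, grad (hpart (tdeg (phi i)) (phi i)) v u = 0) ->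
  exists b, forall i, u i = b * v i.
Proof.
move=> Hu; apply: chart_eq0; set U := mact T u.
have [k [kI ki0 kl]] := psi_linear.
apply: (mact_injective uS) => t.
have [->|ti] := eqVneq t i0.
  rewrite /mact (bigD1 ord_max) //= chart_max mulr0 add0r big1 // => l lm.
  by rewrite S_i0 (negbTE lm) mul0r.
have [i <-] : exists i, k i = t.
  have : t \in [set k i | i : 'I_n].
    suff -> : [set k i | i : 'I_n] = ~: [set i0] by rewrite !inE.
    apply/eqP; rewrite eqEcard; apply/andP; split.
      by apply/subsetP => _ /imsetP[i _ ->]; rewrite !inE.
    by rewrite card_imset // cardsCs setCK cards1 !card_ord subn1.
  by case/imsetP => i _ ->; exists i.
have [b b0 ob] := kl i; apply: (mulfI b0); rewrite mulr0.
transitivity (grad (psi i) (fun=> 0) (mact S (chart U))).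
  rewrite -[psi i](subrK (b *: 'X_(k i))).
  have gD (x y : {mpoly K[n.+1]}) p w : grad (x + y) p w = grad x p w + grad y p w.
    by rewrite /grad -big_split; apply: eq_bigr => l _; rewrite mderivD mevalD mulrDl.
  rewrite gD (ordge2_grad0 _ ob) add0r gradZ; congr (_ * _).
  rewrite /grad (bigD1 (k i)) //= mderivXU eqxx meval1 mul1r big1 ?addr0 // => l lk.
  by rewrite mderivXU eq_sym (negbTE lk) meval0 mul0r.
transitivity (grad (st i) (fun=> 0) (chart U)).
  have zero : mact S (fun _ : 'I_n.+1 => 0 : K) = (fun _ : 'I_n.+1 => 0 : K).
    by apply: boolp.funext => j; rewrite /mact big1 // => l _; rewrite mulr0.
  by have := grad_lsub S (psi i) (fun=> 0) (chart U); rewrite zero lsubK.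
rewrite /grad big_ord_recr /= chart_max mulr0 addr0.
have sr : (msize (q i) <= (r i).+1)%N by rewrite sq.
under eq_bigr do rewrite -/(wid _) chart_wid mderiv_star // star_mderiv_eval0 //.
rewrite (grad_chart _ (hpart_homog _ _)) ?qe1 //.
rewrite hpart_lsub grad_lsub Tie1 /U mactK //; exact: Hu.
Qed.

End Transversality.

End InFrame.

Theorem stationary_nondegenerate : c != 0 /\ forall u a,
  (forall j, grad (topf f m j) v u = c * u j + a * v j) ->
  exists b, forall i, u i = b * v i.
Proof.
have [T [S [lam [i0 [[uT Tv uS sgn] [eigS rowS li0]]]]]] := frame_exists.
split; first exact: (c_neq0 sgn li0).
by move=> u a; apply: (nondegenerate_in_frame uT Tv uS sgn eigS).
Qed.

Theorem stationary_transversal (phi : 'I_n -> {mpoly K[n.+1]}) :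
  (forall i, mirreducible (phi i)) ->
  (forall i j, i != j -> rel_prime (phi i) (phi j)) ->
  (forall i, semi_invariant f (phi i)) ->
  (forall i, (hpart (tdeg (phi i)) (phi i)).@[v] = 0) ->
  forall u, (forall i, grad (hpart (tdeg (phi i)) (phi i)) v u = 0) ->
  exists b, forall i, u i = b * v i.
Proof.
have [T [S [lam [i0 [[uT Tv uS sgn] [eigS rowS li0]]]]]] := frame_exists.
move=> pi pp ps pv u; exact: (transversal_in_frame uT Tv uS sgn eigS rowS).
Qed.

End Frame.

(** * Common zeros are stationary *)

Section GeneratedIdeal.
Variables (K : fieldType) (n : nat) (I : finType) (F : I -> {mpoly K[n]}).

Definition gen_ideal q := exists a : I -> {mpoly K[n]}, q = \sum_i a i * F i.

Lemma gen_ideal0 : gen_ideal 0.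
Proof. by exists (fun=> 0); rewrite big1 // => i _; rewrite mul0r. Qed.

Lemma gen_idealD p q : gen_ideal p -> gen_ideal q -> gen_ideal (p + q).
Proof.
move=> [a ->] [b ->]; exists (fun i => a i + b i).
by rewrite -big_split; apply: eq_bigr => i _; rewrite mulrDl.
Qed.

Lemma gen_idealMl p q : gen_ideal q -> gen_ideal (p * q).
Proof.
move=> [a ->]; exists (fun i => p * a i).
by rewrite mulr_sumr; apply: eq_bigr => i _; rewrite mulrA.
Qed.

Lemma gen_ideal_gen i : gen_ideal (F i).
Proof.
exists (fun j => (j == i)%:R); rewrite (bigD1 i) //= eqxx mul1r big1 ?addr0 //.
by move=> j /negbTE ->; rewrite mul0r.
Qed.

Lemma gen_ideal_sum (T : Type) (r : seq T) (P : pred T) (G : T -> {mpoly K[n]}) :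
  (forall i, P i -> gen_ideal (G i)) -> gen_ideal (\sum_(i <- r | P i) G i).
Proof. by move=> H; elim/big_ind: _ => //; [exact: gen_ideal0|exact: gen_idealD]. Qed.

Lemma gen_ideal_eval x q : (forall i, (F i).@[x] = 0) -> gen_ideal q -> q.@[x] = 0.
Proof.
move=> H [a ->]; rewrite (raddf_sum (meval x)) big1 // => i _.
by rewrite /= mevalM H mulr0.
Qed.

Lemma gen_ideal_der D : derivation D -> (forall i, gen_ideal (D (F i))) ->
  forall q, gen_ideal q -> gen_ideal (D q).
Proof.
move=> dD H q [a ->]; rewrite (der_sum dD); apply: gen_ideal_sum => i _.
by rewrite (derM dD); apply: gen_idealD; apply: gen_idealMl => //; apply: gen_ideal_gen.
Qed.

End GeneratedIdeal.

Lemma gen_ideal_ideal (K : closedFieldType) n (I : finType) (F : I -> {mpoly K[n]}) :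
  ideal (gen_ideal F).
Proof. by split; [exact: gen_ideal0|exact: gen_idealD|exact: gen_idealMl]. Qed.

(** * Derivative of a determinant *)

Section DerivativeOfDeterminant.
Variables (K : fieldType) (n : nat) (D : {mpoly K[n]} -> {mpoly K[n]}).
Hypothesis dD : derivation D.

Lemma der_prod (I : finType) (F : I -> {mpoly K[n]}) :
  D (\prod_i F i) = \sum_i \prod_j (if j == i then D (F j) else F j).
Proof.
have H (s : seq I) : uniq s -> D (\prod_(i <- s) F i) =
    \sum_(i <- s) \prod_(j <- s) (if j == i then D (F j) else F j).
  elim: s => [_|x s IH /= /andP[xs us]].
    by rewrite !big_nil -mpolyC1 (derC dD).
  rewrite !big_cons (derM dD) IH // eqxx; congr (_ * _ + _).
    by apply: eq_big_seq => i si; case: eqP => // e; rewrite -e si in xs.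
  rewrite mulr_sumr; apply: eq_big_seq => i si; rewrite big_cons.
  by case: eqP => // e; rewrite e si in xs.
exact: H (index_enum_uniq I).
Qed.

Lemma der_sign (b : bool) p : D ((-1) ^+ b * p) = (-1) ^+ b * D p.
Proof. by case: b; rewrite ?expr1 ?mulN1r ?(derN dD) // expr0 !mul1r. Qed.

Lemma der_det k (A : 'M[{mpoly K[n]}]_k) :
  D (\det A) = \sum_i \sum_j D (A i j) * cofactor A i j.
Proof.
pose A' i : 'M_k := \matrix_(a, b) (if a == i then D (A a b) else A a b).
have E i : \sum_j D (A i j) * cofactor A i j = \det (A' i).
  rewrite (expand_det_row _ i); apply: eq_bigr => j _.
  have -> : A' i i j = D (A i j) by rewrite mxE eqxx.
  have rE : row' i (col' j (A' i)) = row' i (col' j A).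
    by apply/matrixP => a b; rewrite !mxE eq_sym (negbTE (neq_lift i a)).
  by rewrite /cofactor rE.
rewrite (eq_bigr _ (fun i _ => E i)) /determinant (der_sum dD) exchange_big.
apply: eq_bigr => s _ /=; rewrite der_sign -mulr_sumr; congr (_ * _).
rewrite der_prod; apply: eq_bigr => i _; apply: eq_bigr => j _.
by rewrite mxE.
Qed.

End DerivativeOfDeterminant.

(** Differentiating h^(k+1) (D h)^e and multiplying by D h gives (k+1) h^k (D h)^(e+2) modulo the
    ideal, so k descends to 0. In characteristic 0 the radical of a stable ideal is thus stable. *)
Lemma ideal_der_power (K : numClosedFieldType) n (I : {mpoly K[n]} -> Prop) D h k e :
  ideal I -> derivation D -> (forall q, I q -> I (D q)) ->
  I (h ^+ k * D h ^+ e) -> exists e', I (D h ^+ e').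
Proof.
move=> iI dD stab; elim: k e => [|k IH] e hke; first by exists e; rewrite expr0 mul1r in hke.
apply: (IH e.+2); have := idealMl iI (D h) (stab _ hke).
rewrite (derM dD) !(der_exp dD) /=.
set b := D (D h); set c := D h in hke *.
have -> : c * ((h ^+ k * c) *+ k.+1 * c ^+ e + h ^+ k.+1 * ((c ^+ e.-1 * b) *+ e)) =
   k.+1%:R *: (h ^+ k * c ^+ e.+2) + (b *+ e) * (h ^+ k.+1 * c ^+ e).
  rewrite scaler_nat mulrDr; congr (_ + _); first by rewrite mulrnAl mulrnAr !exprS;
    congr (_ *+ _); ring.
  case: e {hke} => [|e]; first by rewrite !mulr0n mulr0 mulr0 mul0r.
  by rewrite !mulrnAr mulrnAl /= !exprS; congr (_ *+ _); ring.
move=> H; have := idealB iI H (idealMl iI (b *+ e) hke); rewrite addrK => H2.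
have := idealZ k.+1%:R^-1 iI H2.
by rewrite scalerA mulVf ?scale1r // pnatr_eq0.
Qed.

Section CommonZeros.
Variables (K : numClosedFieldType) (n : nat).
Hypothesis uncK : uncountable_type K.
Hypothesis n0 : (0 < n)%N.
Variables (p : 'I_n -> {mpoly K[n.+1]}) (r : 'I_n -> nat) (g : 'I_n.+1 -> {mpoly K[n.+1]}).
Hypothesis p_homog : forall i, p i \is (r i).-homog.
Hypothesis r_pos : forall i, (0 < r i)%N.
Hypothesis p_neq0 : forall i, p i != 0.
Variable lmb : 'I_n -> {mpoly K[n.+1]}.
Hypothesis p_semi : forall i, Xder g (p i) = lmb i * p i.
Local Notation D := (Xder g).
Let dD := Xder_derivation g.

(** The border row makes the matrix square: its determinant is, up to sign, the maximal minor of the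
    Jacobian of the [p i] that omits column [k]. *)
Definition bordered_jac k : 'M[{mpoly K[n.+1]}]_n.+1 :=
  \matrix_(a, j) (if unlift ord0 a is Some i then mderiv j (p i) else (j == k)%:R).

Definition border_minor k := \det (bordered_jac k).

Definition sing_eq (j : 'I_(n + n.+1)) : {mpoly K[n.+1]} :=
  match split j with inl i => p i | inr k => border_minor k end.

Lemma bordered_row0 k j : bordered_jac k ord0 j = (j == k)%:R.
Proof. by rewrite mxE unlift_none. Qed.
Lemma bordered_rowS k i j : bordered_jac k (lift ord0 i) j = mderiv j (p i).
Proof. by rewrite mxE liftK. Qed.

Lemma sing_eq_p i : gen_ideal sing_eq (p i).
Proof.
have := gen_ideal_gen sing_eq (lshift n.+1 i); rewrite {2}/sing_eq.
by have := unsplitK (inl i : 'I_n + 'I_n.+1); rewrite /= => ->.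
Qed.

Lemma sing_eq_minor k : gen_ideal sing_eq (border_minor k).
Proof.
have := gen_ideal_gen sing_eq (rshift n k); rewrite {2}/sing_eq.
by have := unsplitK (inr k : 'I_n + 'I_n.+1); rewrite /= => ->.
Qed.

Lemma cofactor_border k j : cofactor (bordered_jac k) ord0 j = border_minor j.
Proof.
rewrite /border_minor (expand_det_row _ ord0) (bigD1 j) //= bordered_row0 eqxx mul1r.
rewrite big1 ?addr0 => [|l /negbTE lj]; last by rewrite bordered_row0 lj mul0r.
have rE : row' ord0 (col' j (bordered_jac k)) = row' ord0 (col' j (bordered_jac j)).
  by apply/matrixP => a b; rewrite !mxE liftK.
by rewrite /cofactor rE.
Qed.

Lemma der_bordered k i j : D (mderiv j (p i)) =
  lmb i * bordered_jac k (lift ord0 i) j + mderiv j (lmb i) * p i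
  - \sum_l bordered_jac k (lift ord0 i) l * mderiv j (g l).
Proof.
rewrite bordered_rowS; under eq_bigr do rewrite bordered_rowS.
have -> : lmb i * mderiv j (p i) + mderiv j (lmb i) * p i = mderiv j (D (p i)).
  by rewrite p_semi mderivM addrC.
rewrite /Xder (der_sum (mderiv_derivation K j)) -sumrB; apply: eq_bigr => l _.
by rewrite mderivM mderiv_comm; ring.
Qed.

(* The Lie derivative of dp_1 /\ ... /\ dp_n is a multiple of it modulo (p_1, ..., p_n). *)
Lemma der_border_minor k : gen_ideal sing_eq (D (border_minor k)).
Proof.
set B := bordered_jac k; rewrite /border_minor (der_det dD) -/B.
have S0 : \sum_j D (B ord0 j) * cofactor B ord0 j = 0.
  apply: big1 => j _; have -> : D (B ord0 j) = 0; last by rewrite mul0r.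
  rewrite bordered_row0; case: eqP => _; first by rewrite -mpolyC1 (derC dD).
  exact: der0 dD.
have drop0 (t : 'I_n.+1 -> {mpoly K[n.+1]}) : t ord0 = 0 ->
    \sum_i t i = \sum_(i < n) t (lift ord0 i).
  by move=> t0; rewrite big_ord_recl t0 add0r.
apply: (eq_ind_r (gen_ideal sing_eq) _ (drop0 (fun i => \sum_j D (B i j) * cofactor B i j) S0)).
pose G (l j : 'I_n.+1) := mderiv j (g l).
have E i : \sum_j D (B (lift ord0 i) j) * cofactor B (lift ord0 i) j =
   lmb i * \det B + \sum_j (mderiv j (lmb i) * cofactor B (lift ord0 i) j) * p i
   - \sum_j \sum_l G l j * (cofactor B (lift ord0 i) j * B (lift ord0 i) l).
  rewrite (expand_det_row B (lift ord0 i)) mulr_sumr -big_split -sumrB.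
  apply: eq_bigr => j _ /=.
  have -> : D (B (lift ord0 i) j) = lmb i * B (lift ord0 i) j + mderiv j (lmb i) * p i
      - \sum_l B (lift ord0 i) l * mderiv j (g l).
    by rewrite -(der_bordered k) -(bordered_rowS k).
  rewrite mulrBl; congr (_ - _); first by ring.
  rewrite [LHS]mulr_suml; apply: eq_bigr => l _; rewrite /G; ring.
rewrite (eq_bigr _ (fun i _ => E i)) sumrB; apply: gen_idealD.
  apply: gen_ideal_sum => i _; apply: gen_idealD.
    exact/gen_idealMl/sing_eq_minor.
  by apply: gen_ideal_sum => j _; apply/gen_idealMl/sing_eq_p.
rewrite -mulN1r; apply: gen_idealMl; rewrite exchange_big; apply: gen_ideal_sum => j _.
rewrite exchange_big; apply: gen_ideal_sum => l _ /=.
rewrite -mulr_sumr; apply: gen_idealMl.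
(* The adjugate identity sums over all rows; leaving out the border row costs one multiple of a
   border minor. *)
have adjE : \sum_a cofactor B a j * B a l = \det B * (j == l)%:R.
  transitivity ((\adj B *m B) j l); last by rewrite mul_adj_mx mxE mulr_natr.
  by rewrite [RHS]mxE; apply: eq_bigr => a _; rewrite [\adj B _ _]mxE.
rewrite big_ord_recl in adjE.
have -> : \sum_(i < n) cofactor B (lift ord0 i) j * B (lift ord0 i) l =
   \det B * (j == l)%:R - border_minor j * B ord0 l.
  by rewrite -adjE (cofactor_border k j) [X in _ = X - _]addrC addrK.
apply: gen_idealD; first by rewrite mulrC; apply/gen_idealMl/sing_eq_minor.
by rewrite mulrC -mulNr; apply/gen_idealMl/sing_eq_minor.
Qed.

Lemma sing_stable q : gen_ideal sing_eq q -> gen_ideal sing_eq (D q).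
Proof.
apply: gen_ideal_der => // j; rewrite /sing_eq; case: (split j) => [i|k].
  by rewrite p_semi; apply/gen_idealMl/sing_eq_p.
exact: der_border_minor.
Qed.

Lemma sing_zeroP x : (forall j, (sing_eq j).@[x] = 0) <->
  (forall i, (p i).@[x] = 0) /\ (forall k, (border_minor k).@[x] = 0).
Proof.
split=> [H|[H1 H2] j]; last by rewrite /sing_eq; case: (split j).
by split=> i; apply: gen_ideal_eval H _; [exact: sing_eq_p|exact: sing_eq_minor].
Qed.

Lemma border_minor_eval k x :
  (border_minor k).@[x] = \det (map_mx (meval x) (bordered_jac k)).
Proof. by rewrite det_map_mx. Qed.

Lemma bordered_mact k x u a : mact (map_mx (meval x) (bordered_jac k)) u a =
  if unlift ord0 a is Some i then grad (p i) x u else u k.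
Proof.
rewrite /mact; case: unliftP => [i ->|->].
  by apply: eq_bigr => l _; rewrite mxE bordered_rowS.
rewrite (bigD1 k) //= mxE bordered_row0 eqxx meval1 mul1r big1 ?addr0 //.
by move=> l /negbTE lk; rewrite mxE bordered_row0 lk meval0 mul0r.
Qed.

(** For [k] with x_k nonzero, the border row excludes the multiples of [x], the only kernel vectors
    of the Jacobian. *)
Lemma transversal_minor x : nonzero_pt x ->
  (forall u, (forall i, grad (p i) x u = 0) -> exists b, forall i, u i = b * x i) ->
  exists k, (border_minor k).@[x] != 0.
Proof.
move=> [k xk] tr; exists k; rewrite border_minor_eval -unitfE -unitmxE.
apply: unit_of_injective => u Hu.
have [i|b ub] := tr u; first by have := Hu (lift ord0 i); rewrite bordered_mact liftK.
have := Hu ord0; rewrite bordered_mact unlift_none ub => /eqP.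
by rewrite mulf_eq0 (negbTE xk) orbF => /eqP b0 i; rewrite ub b0 mul0r.
Qed.

(* Both x, by Euler's identity, and g(x) lie in the kernel of the differentials of the
   p_i at x, which is a line. *)
Lemma minor_stationary x : nonzero_pt x -> (forall i, (p i).@[x] = 0) ->
  (exists k, (border_minor k).@[x] != 0) -> in_line g x.
Proof.
move=> [k0 xk0] px [k]; rewrite border_minor_eval -unitfE -unitmxE => uB.
have gx i : grad (p i) x x = 0 by rewrite (grad_euler _ (p_homog i)) px mulr0.
have gg i : grad (p i) x (fun l => (g l).@[x]) = 0.
  transitivity ((D (p i)).@[x]); last by rewrite p_semi mevalM px mulr0.
  rewrite /Xder (raddf_sum (meval x)); apply: eq_bigr => l _.
  by rewrite /= mevalM mulrC.
have xk : x k != 0.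
  apply: contraNneq xk0 => xk; apply/eqP; apply: (mact_injective uB) => a.
  by rewrite bordered_mact; case: unliftP.
exists ((g k).@[x] / x k) => i; apply/eqP; rewrite -subr_eq0; apply/eqP.
apply: (mact_injective uB (x := fun i => (g i).@[x] - (g k).@[x] / x k * x i)) => a.
rewrite bordered_mact; case: unliftP => [l _|_]; last by rewrite mulfVK // subrr.
transitivity (grad (p l) x (fun l => (g l).@[x]) - (g k).@[x] / x k * grad (p l) x x).
  by rewrite /grad mulr_sumr -sumrB; apply: eq_bigr => t _; ring.
by rewrite gg gx mulr0 subrr.
Qed.

Lemma sing_homogeneous (x : 'I_n.+1 -> K) c : (forall j, (sing_eq j).@[x] = 0) ->
  forall j, (sing_eq j).@[fun i => c * x i] = 0.
Proof.
move=> /sing_zeroP[px mx]; apply/sing_zeroP; split=> [i|k].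
  by rewrite (homog_eval _ _ (p_homog i)) px mulr0.
rewrite border_minor_eval.
have -> : map_mx (meval (fun i => c * x i)) (bordered_jac k) =
   diag_mx (\row_a (if unlift ord0 a is Some i then c ^+ (r i).-1 else 1))
   *m map_mx (meval x) (bordered_jac k).
  apply/matrixP => a j; rewrite mul_diag_mx !mxE; case: unliftP => [i _|_].
    by apply/homog_eval/mderiv_homog; rewrite prednK.
  by case: (j == k); rewrite ?meval1 ?meval0 ?mulr1 ?mulr0.
by rewrite det_mulmx -border_minor_eval mx mulr0.
Qed.

Lemma infinite_line (Y : ('I_n.+1 -> K) -> Prop) x : nonzero_pt x ->
  (forall c : K, Y (fun i => c * x i)) -> infinite_set Y.
Proof.
move=> [k xk] Yx [s Hs].
pose t : seq K := [seq y k / x k | y <- s].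
have Ht (c : K) : c \in t.
  have : List.In (fun i => c * x i) s by apply: Hs.
  rewrite /t; elim: s {Hs t} => //= y s IH [->|/IH h]; rewrite inE ?h ?orbT //.
  by rewrite mulfK // eqxx.
have : {subset [seq i%:R | i <- iota 0 (size t).+1] <= t} by move=> c _; apply: Ht.
move=> /uniq_leq_size; rewrite map_inj_uniq ?iota_uniq; last first.
  by move=> i j /eqP; rewrite eqr_nat => /eqP.
by rewrite size_map size_iota ltnn => /(_ isT).
Qed.

Variables (f : 'I_n.+1 -> {mpoly K[n.+1]}) (m : nat).
Hypothesis g_top : g = topf f m.
Hypothesis Sf : propS f m.
Hypothesis trans : forall v, nonzero_pt v -> in_line g v -> (forall i, (p i).@[v] = 0) ->
  forall u, (forall i, grad (p i) v u = 0) -> exists b, forall i, u i = b * v i.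

Theorem common_zero_stationary w : nonzero_pt w -> (forall i, (p i).@[w] = 0) ->
  in_line g w.
Proof.
move=> w0 pw; apply: minor_stationary => //; apply: boolp.contrapT => no.
pose Y x := forall j, (sing_eq j).@[x] = 0.
have Yw : Y w.
  apply/sing_zeroP; split=> // k; apply/eqP; apply/negPn/negP => h.
  by apply: no; exists k.
have homY : homogeneous_set Y by move=> c x; apply: sing_homogeneous.
have [|||||v [v0 [Yv vl]]] := Sf (Y := Y).
- by exists (n + n.+1)%N, sing_eq.
- exact: homY.
- have [x px] := mpoly_nonvanishing (p_neq0 (Ordinal n0)); exists x => Yx.
  by move: px; have [-> _] := (sing_zeroP x).1 Yx; rewrite eqxx.
- by apply: (infinite_line w0) => c; apply: homY.
(* Property S asks for stability of the full vanishing ideal, while [sing_stable] concerns the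
   generated one. A power of [h] lies in the latter, hence so does a power of D h. *)
- move=> h hY x Yx; rewrite -g_top.
  have [k hk] : exists k, gen_ideal sing_eq (h ^+ k).
    apply: (nullstellensatz uncK (gen_ideal_ideal sing_eq)) => y Hy; apply: hY => j.
    exact/Hy/gen_ideal_gen.
  have [|e he] := @ideal_der_power _ _ _ D h k 0 (gen_ideal_ideal sing_eq) dD sing_stable.
    by rewrite expr0 mulr1.
  have := gen_ideal_eval Yx he; rewrite rmorphXn /= => /eqP.
  by rewrite expf_eq0 => /andP[_ /eqP].
have {}Yv : Y v.
  have := Yv 1; rewrite (_ : (fun i => 1 * v i) = v) //.
  by apply: boolp.funext => i; rewrite mul1r.
have [pv mv] := (sing_zeroP v).1 Yv; rewrite -g_top in vl.
have [k] := transversal_minor v0 (trans v0 vl pv).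
by rewrite mv eqxx.
Qed.

End CommonZeros.

(** * Dimension counts *)

(** Binomial expansion, where the lower powers of [x] are at most x^n. Their coefficients sum to
    (c+1)^(n+1) - 1, whence the x^n on the left. *)
Lemma expn_shift_bound (c n x : nat) : (0 < x)%N ->
  ((x + c) ^ n.+1 + x ^ n <= x ^ n.+1 + c.+1 ^ n.+1 * x ^ n)%N.
Proof.
move=> x0; elim: n => [|n IH]; first by rewrite !expn1 expn0 muln1; lia.
rewrite [((x + c) ^ n.+2)%N]expnS [(c.+1 ^ n.+2)%N]expnS [(x ^ n.+2)%N]expnS.
have e0 : (0 < c.+1 ^ n.+1)%N by rewrite expn_gt0.
move: IH; rewrite [(x ^ n.+1)%N]expnS.
move: (c.+1 ^ n.+1)%N e0 ((x + c) ^ n.+1)%N (x ^ n)%N => e e0 p y IH.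
have h1 : ((x + c) * (p + y) <= (x + c) * (x * y + e * y))%N by rewrite leq_mul2l IH orbT.
have h2 : (c * y * (x + e) <= c * y * (e * x + 1))%N.
  rewrite leq_mul2l; apply/orP; right.
  case: x x0 {h1 IH} => // x _; case: e e0 => // e _; nia.
nia.
Qed.

(** Comparison of leading coefficients without limits: at D = N (c+1)^(n+1) + C the lower-order
    terms stay below (D+1)^(n+1). *)
Lemma asymptotic_leq (a N c C n : nat) :
  (forall D, a * D.+1 ^ n.+1 <= N * (D.+1 + c) ^ n.+1 + C * D.+1 ^ n)%N -> (a <= N)%N.
Proof.
move=> H; rewrite leqNgt; apply/negP => Na.
pose E := (c.+1 ^ n.+1)%N; pose D := (N * E + C)%N.
have := H D; apply/negP; rewrite -ltnNge.
have xp : (0 < D.+1 ^ n)%N by rewrite expn_gt0.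
apply: (@leq_ltn_trans (N * D.+1 ^ n.+1 + D * D.+1 ^ n)).
  rewrite /D mulnDl addnA leq_add2r -mulnA -mulnDr leq_mul2l.
  apply/orP; right; apply: leq_trans (expn_shift_bound c n (ltn0Sn D)).
  exact: leq_addr.
apply: (@leq_trans (N.+1 * D.+1 ^ n.+1)); last by rewrite leq_mul2r Na orbT.
by rewrite mulSnr ltn_add2l [X in (_ < X)%N]expnS ltn_mul2r xp ltnSn.
Qed.

Lemma bin_lower (D n : nat) : (D.+1 ^ n <= 'C(D + n, n) * n`!)%N.
Proof.
rewrite bin_ffact ffact_prod.
have -> : (D.+1 ^ n = \prod_(i < n) D.+1)%N by rewrite prod_nat_const card_ord.
apply: leq_prod => i _; have := ltn_ord i; lia.
Qed.

Lemma bin_upper (D n : nat) : ('C(D + n, n) * n`! <= (D + n) ^ n)%N.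
Proof.
rewrite bin_ffact ffact_prod.
have -> : ((D + n) ^ n = \prod_(i < n) (D + n))%N by rewrite prod_nat_const card_ord.
by apply: leq_prod => i _; rewrite leq_subr.
Qed.

Definition monomials (n d : nat) : seq 'X_{1..n} :=
  [seq s2m t | t : d.-tuple 'I_n <- enum (basis n d)].

Lemma mem_monomials n d (m : 'X_{1..n}) : (m \in monomials n d) = (mdeg m == d).
Proof. by rewrite basis_cover. Qed.

Lemma size_monomials n d : size (monomials n.+1 d) = 'C(d + n, n).
Proof. by rewrite /monomials size_basis -{2}[d](addnK n) bin_sub ?leq_addl. Qed.

Lemma uniq_monomials n d : uniq (monomials n d).
Proof. exact: uniq_basis. Qed.

Section LinearSpan.
Variables (K : fieldType) (V : lmodType K).

(** Span of a set given by a predicate: the recursive reduction of forms supplies generators one at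
    a time, and a finite list is needed only for the count. *)
Inductive lspan (S : V -> Prop) : V -> Prop :=
| lspan0 : lspan S 0
| lspanS c x y : S x -> lspan S y -> lspan S (c *: x + y).

Lemma lspan_in (S : V -> Prop) x : S x -> lspan S x.
Proof. by move=> Sx; rewrite -[x]scale1r -[_ *: _]addr0; apply: lspanS => //; apply: lspan0. Qed.

Lemma lspanD (S : V -> Prop) x y : lspan S x -> lspan S y -> lspan S (x + y).
Proof.
move=> Sx Sy; elim: Sx => [|c a b Sa _ IH]; first by rewrite add0r.
by rewrite -addrA; apply: lspanS.
Qed.

Lemma lspanZ (S : V -> Prop) c x : lspan S x -> lspan S (c *: x).
Proof.
elim=> [|b a y Sa _ IH]; first by rewrite scaler0; apply: lspan0.
by rewrite scalerDr scalerA; apply: lspanS.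
Qed.

Lemma lspan_sum (S : V -> Prop) (I : Type) (r : seq I) (P : pred I) (F : I -> V) :
  (forall i, P i -> lspan S (F i)) -> lspan S (\sum_(i <- r | P i) F i).
Proof. by move=> H; elim/big_ind: _ => //; [exact: lspan0|exact: lspanD]. Qed.

Lemma lspan_seq (S : V -> Prop) (s : seq V) x : (forall y, S y -> y \in s) -> lspan S x ->
  exists c : 'I_(size s) -> K, x = \sum_j c j *: s`_j.
Proof.
move=> Ss; elim=> [|c a y Sa _ [d ->]].
  by exists (fun=> 0); rewrite big1 // => j _; rewrite scale0r.
have as' := Ss _ Sa; have lt : (index a s < size s)%N by rewrite index_mem.
exists (fun j => (if j == Ordinal lt then c else 0) + d j).
under [RHS]eq_bigr do rewrite scalerDl.
rewrite big_split /=; congr (_ + _).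
rewrite (bigD1 (Ordinal lt)) //= eqxx nth_index // big1 ?addr0 //.
by move=> j /negbTE ->; rewrite scale0r.
Qed.

Lemma lspan_size (S : V -> Prop) (s : seq V) (I : finType) (x : I -> V) :
  (forall y, S y -> y \in s) -> (forall i, lspan S (x i)) ->
  (forall u : I -> K, \sum_i u i *: x i = 0 -> forall i, u i = 0) -> (#|I| <= size s)%N.
Proof.
move=> Ss Sx free; have [c Hc] := boolp.choice (fun i => lspan_seq Ss (Sx i)).
have := @span_card K V I 'I_(size s) x (fun j => s`_j) c Hc free.
by rewrite card_ord.
Qed.

End LinearSpan.

Lemma lspan_sub (K : fieldType) (V W : lmodType K) (S : V -> Prop) (S' : W -> Prop)
    (f : V -> W) x : (forall c a b, f (c *: a + b) = c *: f a + f b) -> f 0 = 0 ->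
  (forall a, S a -> lspan S' (f a)) -> lspan S x -> lspan S' (f x).
Proof.
move=> fl f0 H; elim=> [|c a b Sa _ IH]; first by rewrite f0; apply: lspan0.
by rewrite fl; apply: lspanD => //; apply: lspanZ; apply: H.
Qed.

(** To each [a] belong the exponents r_i a_i + b_i with b_i below r_i. Division with remainder
    recovers a and b, so these are distinct monomials of degree at most D plus the sum of the r_i,
    homogenised by one more variable. *)
Lemma weighted_count (n D : nat) (r : 'I_n -> nat) : (forall i, (0 < r i)%N) ->
  (#|[set a : {ffun 'I_n -> 'I_D.+1} | (\sum_i r i * a i <= D)%N]| * \prod_i r i
    <= 'C(D + \sum_i r i + n, n))%N.
Proof.
move=> r0; set A := [set a | _]; set R := (\sum_i r i)%N.
have rR i : (r i <= R)%N by rewrite /R (bigD1 i) //= leq_addr.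
pose Fam := family (fun i => [pred x : 'I_R.+1 | (x < r i)%N]).
have cF : #|Fam| = (\prod_i r i)%N.
  rewrite card_family foldrE big_map big_enum; apply: eq_bigr => i _.
  have inj : injective (widen_ord (m := R.+1) (leqW (rR i))).
    by move=> x y /(congr1 val) /= e; apply: val_inj.
  rewrite -[RHS]card_ord -(card_codom inj); apply: eq_card => x; rewrite !inE.
  apply/idP/codomP => [xr|[y ->]]; last exact: (ltn_ord y).
  by exists (Ordinal xr); apply: val_inj.
rewrite -cF -size_monomials.
pose ex (x : {ffun 'I_n -> 'I_D.+1} * {ffun 'I_n -> 'I_R.+1}) (i : 'I_n.+1) : nat :=
  if unlift ord0 i is Some k then (r k * x.1 k + x.2 k)%N
  else (D + R - \sum_k (r k * x.1 k + x.2 k))%N.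
pose mon x : 'X_{1..n.+1} := [multinom ex x i | i < n.+1].
have exS x k : ex x (lift ord0 k) = (r k * x.1 k + x.2 k)%N by rewrite /ex liftK.
have ex0 x : ex x ord0 = (D + R - \sum_k (r k * x.1 k + x.2 k))%N by rewrite /ex unlift_none.
have -> : (#|A| * #|Fam| = size [seq mon x | x <- enum [predX A & Fam]])%N.
  by rewrite size_map -cardE cardX.
apply: uniq_leq_size; last first.
  move=> _ /mapP[[a b] + ->]; rewrite mem_enum inE /= => /andP[aA /familyP bF].
  rewrite mem_monomials; apply/eqP; rewrite mdegE [LHS]big_ord_recl mnmE ex0 /=.
  under [X in (_ + X)%N]eq_bigr do rewrite mnmE exS /=.
  rewrite subnK // big_split /=; apply: leq_add; first by rewrite inE in aA.
  by apply: leq_sum => i _; apply: ltnW; apply: (bF i).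
rewrite map_inj_in_uniq ?enum_uniq // => [[a b] [a' b']].
rewrite !mem_enum !inE /= => /andP[_ /familyP bF] /andP[_ /familyP b'F] e.
have E k : (r k * a k + b k = r k * a' k + b' k)%N.
  by have := congr1 (fun m : 'X_{1..n.+1} => m (lift ord0 k)) e; rewrite !mnmE !exS.
congr (_, _); apply/ffunP => k; apply: val_inj => /=.
  have := congr1 (divn^~ (r k)) (E k); rewrite ![(r k * _)%N]mulnC !divnMDl //.
  by rewrite !divn_small ?addn0 //; [exact: (b'F k)|exact: (bF k)].
have := congr1 (modn^~ (r k)) (E k); rewrite ![(r k * _)%N]mulnC !modnMDl.
by rewrite !modn_small //; [exact: (b'F k)|exact: (bF k)].
Qed.

(** * The lower bound on the number of lines *)

Lemma hpartM_homog (K : fieldType) n d e (a b : {mpoly K[n]}) : b \is e.-homog ->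
  hpart (d + e) (a * b) = hpart d a * b.
Proof.
move=> hb; rewrite -[in RHS](hpart_id hb); apply: hpartM_gen => k1 k2 s kd.
by rewrite (homog_coeff0 hb) ?mulr0 //; apply: contra kd => /eqP; lia.
Qed.

Lemma hpartM_homog_lt (K : fieldType) n d e (a b : {mpoly K[n]}) : b \is e.-homog ->
  (d < e)%N -> hpart d (a * b) = 0.
Proof.
move=> hb de; apply: ordge_hpart0 de; apply: ordgeMr; exact: homog_ordge.
Qed.

Lemma homog_gen_ideal (K : fieldType) n (I : finType) (p : I -> {mpoly K[n]}) (r : I -> nat) d q :
  (forall i, p i \is (r i).-homog) -> q \is d.-homog -> gen_ideal p q ->
  exists a : I -> {mpoly K[n]}, q = \sum_i a i * p i /\
    forall i, ((r i <= d)%N -> a i \is (d - r i).-homog) /\ ((d < r i)%N -> a i = 0).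
Proof.
move=> hp hq [a qE].
exists (fun i => if (r i <= d)%N then hpart (d - r i) (a i) else 0); split; last first.
  move=> i; split=> [rd|dr]; first by rewrite rd hpart_homog.
  by rewrite leqNgt dr.
rewrite -(hpart_id hq) {1}qE hpart_sum; apply: eq_bigr => i _.
case: ifPn => [rd|]; first by rewrite -{1}(subnK rd) hpartM_homog.
by rewrite -ltnNge => dr; rewrite (hpartM_homog_lt _ (hp i) dr) mul0r.
Qed.

Lemma eval_inj (K : numFieldType) n (p q : {mpoly K[n]}) : (forall x, p.@[x] = q.@[x]) -> p = q.
Proof.
move=> H; apply/eqP; rewrite -subr_eq0; apply/negPn/negP => /mpoly_nonvanishing[x].
by rewrite mevalB H subrr eqxx.
Qed.

(** * The ideal of a line through the origin *)

Section PointIdeal.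
Variables (K : numFieldType) (n : nat) (v : 'I_n.+1 -> K) (k : 'I_n.+1).
Hypothesis vk : v k != 0.

Definition line_eq l : {mpoly K[n.+1]} := 'X_l - (v l / v k) *: 'X_k.

Lemma line_eq_homog l : line_eq l \is 1.-homog.
Proof. by apply: rpredB; [exact: homogXU|apply: rpredZ; exact: homogXU]. Qed.

Lemma line_eq_k : line_eq k = 0.
Proof. by rewrite /line_eq divff // scale1r subrr. Qed.

(** Substituting (v_l / v_k) x_k for x_l changes a polynomial by an element of the ideal, and turns
    [h] into its restriction to the line, which is 0. *)
Lemma line_ideal d h : h \is d.-homog -> h.@[v] = 0 -> gen_ideal line_eq h.
Proof.
move=> hh hv; pose t := [tuple (v l / v k) *: 'X_k | l < n.+1] : n.+1.-tuple {mpoly K[n.+1]}.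
have H q : gen_ideal line_eq (q - (q \mPo t)).
  elim/mpoly_gen_ind: q => [c|i|p q IHp IHq|p q IHp IHq].
  - by rewrite comp_mpolyC subrr; apply: gen_ideal0.
  - by rewrite comp_mpolyXU -tnth_nth tnth_mktuple; apply: gen_ideal_gen.
  - by rewrite comp_mpolyD opprD addrACA; apply: gen_idealD.
  - rewrite rmorphM /=; have -> : p * q - (p \mPo t) * (q \mPo t) =
      q * (p - (p \mPo t)) + (p \mPo t) * (q - (q \mPo t)) by ring.
    by apply: gen_idealD; apply: gen_idealMl.
suff h0 : h \mPo t = 0 by rewrite -[h]subr0 -h0.
apply: eval_inj => x; rewrite meval0 comp_mpoly_meval.
rewrite (@meval_eq _ _ _ (fun l => (x k / v k) * v l)) ?(homog_eval _ _ hh) ?hv ?mulr0 //.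
by move=> l; rewrite tnth_mktuple mevalZ mevalXU mulrC [RHS]mulrAC mulrA.
Qed.

Lemma grad_line_eq l x u : grad (line_eq l) x u = u l - v l / v k * u k.
Proof.
have gX j : grad ('X_j : {mpoly K[n.+1]}) x u = u j.
  rewrite /grad (bigD1 j) //= mderivXU eqxx meval1 mul1r big1 ?addr0 // => t tj.
  by rewrite mderivXU eq_sym (negbTE tj) meval0 mul0r.
rewrite -[line_eq l]/('X_l - _) -[X in grad X]addrC -scaleNr.
have gD (p q : {mpoly K[n.+1]}) : grad (p + q) x u = grad p x u + grad q x u.
  by rewrite /grad -big_split; apply: eq_bigr => t _; rewrite mderivD mevalD mulrDl.
by rewrite gD gradZ !gX addrC mulNr.
Qed.

Lemma line_eq_eval l b : (line_eq l).@[fun i => b * v i] = 0.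
Proof. by rewrite mevalB mevalZ !mevalXU mulrCA mulfVK // subrr. Qed.

(* Near the line K v the p_i generate the ideal of the line: M expresses the p_i
   through the equations of the line, and det M is invertible along it. *)
Lemma local_generation (p : 'I_n -> {mpoly K[n.+1]}) (r : 'I_n -> nat) :
  (forall i, p i \is (r i).-homog) -> (forall i, (p i).@[v] = 0) ->
  exists s, (forall b,
     (forall u, (forall i, grad (p i) (fun i => b * v i) u = 0) ->
        exists b', forall i, u i = b' * v i) ->
     s.@[fun i => b * v i] != 0) /\
   forall d h, h \is d.-homog -> h.@[v] = 0 -> gen_ideal p (s * h).
Proof.
move=> hp pv; have [M HM] := boolp.choice (fun i => line_ideal (hp i) (pv i)).
pose B : 'M[{mpoly K[n.+1]}]_n.+1 :=
  \matrix_(a, j) (if unlift ord0 a is Some i then M i j else (j == k)%:R).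
have B0 j : B ord0 j = (j == k)%:R by rewrite mxE unlift_none.
have BS i j : B (lift ord0 i) j = M i j by rewrite mxE liftK.
exists (\det B); split=> [b tr|d h hh hv].
  rewrite -det_map_mx -unitfE -unitmxE; apply: unit_of_injective => u Hu.
  have uk : u k = 0.
    have := Hu ord0; rewrite /mact (bigD1 k) //= mxE B0 eqxx meval1 mul1r big1 ?addr0 //.
    by move=> l /negbTE lk; rewrite mxE B0 lk meval0 mul0r.
  have [i|b' ub] := tr u.
    have := Hu (lift ord0 i); rewrite /mact => <-.
    rewrite HM grad_sum; apply: eq_bigr => l _; rewrite mxE BS.
    transitivity ((M i l).@[fun i => b * v i] * grad (line_eq l) (fun i => b * v i) u).
      rewrite /grad mulr_sumr; apply: eq_bigr => t _.
      by rewrite mderivM mevalD !mevalM line_eq_eval mulr0 add0r mulrA.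
    by rewrite grad_line_eq uk mulr0 subr0.
  move: uk; rewrite ub => /eqP; rewrite mulf_eq0 (negbTE vk) orbF => /eqP b0 i.
  by rewrite ub b0 mul0r.
have sl l : gen_ideal p (\det B * line_eq l).
  have BL a : \sum_j B a j * line_eq j = if unlift ord0 a is Some i then p i else 0.
    case: (unliftP ord0 a) => [i ->|->].
      by rewrite HM; apply: eq_bigr => j _; rewrite BS.
    rewrite (bigD1 k) //= B0 eqxx mul1r line_eq_k add0r big1 // => j /negbTE jk.
    by rewrite B0 jk mul0r.
  have E a j : (\adj B *m B) a j = \det B * (a == j)%:R by rewrite mul_adj_mx mxE mulr_natr.
  have -> : \det B * line_eq l = \sum_a \adj B l a * (if unlift ord0 a is Some i then p i else 0).
    transitivity (\sum_j (\adj B *m B) l j * line_eq j).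
      rewrite (bigD1 l) //= E eqxx mulr1 big1 ?addr0 // => j jl.
      by rewrite E eq_sym (negbTE jl) mulr0 mul0r.
    under [RHS]eq_bigr do rewrite -BL mulr_sumr.
    rewrite [RHS]exchange_big; apply: eq_bigr => j _ /=; rewrite [(\adj B *m B) l j]mxE mulr_suml.
    by apply: eq_bigr => a _; rewrite mulrA.
  apply: gen_ideal_sum => a _; case: unlift => [i|]; last by rewrite mulr0; apply: gen_ideal0.
  by apply: gen_idealMl; apply: gen_ideal_gen.
have [c ->] := line_ideal hh hv; rewrite mulr_sumr; apply: gen_ideal_sum => l _.
by rewrite mulrCA; apply: gen_idealMl.
Qed.

End PointIdeal.

Lemma split_monomial n (m : 'X_{1..n}) k : (k <= mdeg m)%N ->
  exists m1 m2, m = (m1 + m2)%MM /\ mdeg m1 = k.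
Proof.
elim: k => [_|k IH km]; first by exists 0%MM, m; rewrite add0m mdeg0.
have [m1 [m2 [mE m1k]]] := IH (ltnW km).
have [i m2i] : exists i, (U_(i) <= m2)%MM.
  apply: boolp.contrapT => no; have m20 : m2 = 0%MM.
    apply/mnmP => i; rewrite mnm0E; apply/eqP; apply/negPn/negP => h.
    by apply: no; exists i; rewrite lep1mP.
  by move: km; rewrite mE m20 addm0 m1k ltnn.
exists (m1 + U_(i))%MM, (m2 - U_(i))%MM; split.
  by rewrite mE -addmA [(U_(i) + _)%MM]addmC submK.
by rewrite mdegD mdeg1 m1k addn1.
Qed.

Lemma homog_prod (K : fieldType) n (k : nat) (F : 'I_k -> {mpoly K[n]}) :
  (forall i, F i \is 1.-homog) -> \prod_i F i \is k.-homog.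
Proof.
move=> H; have := homog_prod_exp (fun=> 1%N) H.
rewrite (eq_bigr F) => [|i _]; last by rewrite expr1.
by rewrite sum_nat_const card_ord mul1n muln1.
Qed.

Section LowerBound.
Variables (K : numClosedFieldType) (n N : nat).
Hypothesis uncK : uncountable_type K.
Variables (p : 'I_n.+1 -> {mpoly K[n.+2]}) (r : 'I_n.+1 -> nat) (pts : 'I_N -> ('I_n.+2 -> K)).
Hypothesis p_homog : forall i, p i \is (r i).-homog.
Hypothesis r_pos : forall i, (0 < r i)%N.
Hypothesis pts_neq0 : forall j, nonzero_pt (pts j).
Hypothesis pts_zero : forall i j, (p i).@[pts j] = 0.
Hypothesis pts_distinct : forall i j b, (forall l, pts j l = b * pts i l) -> i = j.
Hypothesis pts_all : forall w, nonzero_pt w -> (forall i, (p i).@[w] = 0) ->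
  exists j b, forall l, w l = b * pts j l.
Hypothesis transv : forall w, nonzero_pt w -> (forall i, (p i).@[w] = 0) ->
  forall u, (forall i, grad (p i) w u = 0) -> exists b, forall l, u l = b * w l.

Definition vanish (h : {mpoly K[n.+2]}) := forall j, h.@[pts j] = 0.

(** The [p i] and the local multipliers [s j] have no common zero except possibly the origin, so the
    Nullstellensatz puts some x_t^(e_t) into their ideal. As s_j h lies in the ideal of the [p i],
    so does x_t^(e_t) h, and a monomial of degree M, the sum of the e_t, contains one of these
    powers. *)
Lemma kill_monomials : exists M, forall m, mdeg m = M -> forall d h,
  h \is d.-homog -> vanish h -> gen_ideal p ('X_[m] * h).
Proof.
have loc j : exists s, (forall b,
     (forall u, (forall i, grad (p i) (fun l => b * pts j l) u = 0) ->
        exists b', forall l, u l = b' * pts j l) -> s.@[fun l => b * pts j l] != 0) /\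
   forall d h, h \is d.-homog -> h.@[pts j] = 0 -> gen_ideal p (s * h).
  by have [k vk] := pts_neq0 j; apply: (local_generation vk p_homog) => i.
have {loc}[s Hs] := boolp.choice loc.
pose F (x : 'I_n.+1 + 'I_N) := match x with inl i => p i | inr j => s j end.
have pow t : exists e, gen_ideal F ('X_t ^+ e).
  apply: (nullstellensatz uncK (gen_ideal_ideal F)) => x Hx; rewrite mevalXU.
  have Fx y : (F y).@[x] = 0 by apply/Hx/gen_ideal_gen.
  apply/eqP; apply/negPn/negP => xt; have x0 : nonzero_pt x by exists t.
  have px i : (p i).@[x] = 0 := Fx (inl i).
  have [j [b xE]] := pts_all x0 px.
  have xb : x = (fun l => b * pts j l) by apply: boolp.funext.
  have := Fx (inr j); rewrite /= xb => /eqP; apply/negP; apply: (Hs j).1 => u gu.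
  have [|b' ub] := transv x0 px (u := u); first by rewrite xb.
  by exists (b' * b) => l; rewrite ub xE mulrA.
have {pow}[e He] := boolp.choice pow.
exists (\sum_t e t)%N => m mM d h hh hv.
have [t et] : exists t, (e t <= m t)%N.
  apply: boolp.contrapT => no.
  have lt t : (m t < e t)%N by rewrite ltnNge; apply/negP => h'; apply: no; exists t.
  move: mM; rewrite mdegE => /eqP; rewrite eqn_leq leqNgt [X in _ && X]leqNgt andbC.
  move=> /andP[/negP + _]; apply; rewrite (bigD1 ord0) //= [X in (_ < X)%N](bigD1 ord0) //=.
  by rewrite -addSn; apply: leq_add => //; apply: leq_sum => i _; apply: ltnW.
have mE : 'X_[m] = 'X_[m - U_(t) *+ e t] * 'X_t ^+ e t :> {mpoly K[n.+2]}.
  rewrite mpolyXn -mpolyXD submK //; apply/mnm_lepP => i; rewrite mulmnE mnm1E.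
  by case: eqP => [<-|_]; rewrite ?mul1n ?mul0n.
have [a aE] := gen_idealMl 'X_[m - U_(t) *+ e t] (He t).
rewrite mE aE mulr_suml; apply: gen_ideal_sum => -[i|j] _ /=.
  by rewrite mulrAC; apply/gen_idealMl/gen_ideal_gen.
by rewrite -mulrA; apply/gen_idealMl/((Hs j).2 _ _ hh).
Qed.

Lemma separating_forms : exists l : 'I_N -> 'I_N -> {mpoly K[n.+2]},
  forall i j, [/\ l i j \is 1.-homog, (l i j).@[pts j] = 1 & i != j -> (l i j).@[pts i] = 0].
Proof.
have H (ij : 'I_N * 'I_N) : exists l : {mpoly K[n.+2]},
    [/\ l \is 1.-homog, l.@[pts ij.2] = 1 & ij.1 != ij.2 -> l.@[pts ij.1] = 0].
  case: ij => i j /=; have [->|ij] := eqVneq i j.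
    have [k vk] := pts_neq0 j; exists ((pts j k)^-1 *: 'X_k); split=> //.
      by apply: rpredZ; exact: homogXU.
    by rewrite mevalZ mevalXU mulVf.
  have [k vk] := pts_neq0 i.
  have [l hl] : exists l, (line_eq (pts i) k l).@[pts j] != 0.
    apply: boolp.contrapT => no; case/eqP: ij.
    apply: (pts_distinct (b := pts j k / pts i k)) => l.
    have : (line_eq (pts i) k l).@[pts j] = 0.
      by apply/eqP; apply/negPn/negP => h; apply: no; exists l.
    rewrite /line_eq mevalB mevalZ !mevalXU => /eqP; rewrite subr_eq0 => /eqP ->.
    by rewrite mulrC [RHS]mulrAC mulrA.
  exists ((line_eq (pts i) k l).@[pts j]^-1 *: line_eq (pts i) k l); split=> [||_].
  - by apply: rpredZ; exact: line_eq_homog.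
  - by rewrite mevalZ mulVf.
  - have e : (line_eq (pts i) k l).@[pts i] = 0.
      by rewrite -[RHS](line_eq_eval vk l 1); apply: meval_eq => t; rewrite mul1r.
    by rewrite mevalZ e mulr0.
have [l Hl] := boolp.choice H; exists (fun i j => l (i, j)) => i j; exact: (Hl (i, j)).
Qed.

(** The powers of [Y j], which is 1 at point [j], raise the degree without changing the values at
    the points. *)
Lemma interpolating_forms : exists Z : nat -> 'I_N -> {mpoly K[n.+2]},
  exists Y : 'I_N -> {mpoly K[n.+2]},
  [/\ forall a j, Z a j \is (a + N).-homog, forall a i j, (Z a j).@[pts i] = (i == j)%:R,
      forall j, Y j \is 1.-homog & forall a b j, Y j ^+ a * Z b j = Z (a + b)%N j].
Proof.
have [l Hl] := separating_forms.
exists (fun a j => l j j ^+ a * \prod_i l i j), (fun j => l j j); split.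
- move=> a j; apply: dhomogM; last by apply: homog_prod => i; case: (Hl i j).
  by rewrite -[a in a.-homog]mul1n; apply: dhomogMn; case: (Hl j j).
- move=> a i j; rewrite mevalM rmorphXn rmorph_prod /=; case: (eqVneq i j) => [->|ij].
    have [_ -> _] := Hl j j; rewrite expr1n mul1r big1 // => k _.
    by case: (Hl k j).
  by rewrite (bigD1 i) //=; have [_ _ ->] := Hl i j; rewrite // mul0r mulr0.
- by move=> j; case: (Hl j j).
- by move=> a b j; rewrite mulrA exprD.
Qed.

Definition pmon (a : 'I_n.+1 -> nat) := \prod_i p i ^+ a i.
Definition pdeg (a : 'I_n.+1 -> nat) := (\sum_i r i * a i)%N.

Section Spanning.
Variables (Z : nat -> 'I_N -> {mpoly K[n.+2]}) (Y : 'I_N -> {mpoly K[n.+2]}) (M : nat).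
Hypothesis Z_homog : forall a j, Z a j \is (a + N).-homog.
Hypothesis Z_eval : forall a i j, (Z a j).@[pts i] = (i == j)%:R.
Hypothesis Y_homog : forall j, Y j \is 1.-homog.
Hypothesis YZ : forall a b j, Y j ^+ a * Z b j = Z (a + b)%N j.
Hypothesis killM : forall m, mdeg m = M -> forall d h,
  h \is d.-homog -> vanish h -> gen_ideal p ('X_[m] * h).
(** One [M] for each of the two uses of [killM] in the reduction of a monomial, and [N] for the
    interpolating forms. *)
Let D0 := (M + M + N)%N.

Lemma kill_homog q d h : q \is M.-homog -> h \is d.-homog -> vanish h -> gen_ideal p (q * h).
Proof.
move=> /dhomogP hq hh hv; rewrite (mpolyE q) mulr_suml big_seq; apply: gen_ideal_sum => m mq.
rewrite -scalerAl -mul_mpolyC; apply: gen_idealMl; apply: killM hh hv; exact: hq.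
Qed.

(** Modulo the [p i] only values at the points matter. The factor [m1] allows the replacement of the
    monomial [m2] by its interpolant; then the factor Y_j^M allows the replacement of each x^m1 Z_j
    by a multiple of an interpolating form. *)
Lemma reduce_monomial m : (D0 <= mdeg m)%N -> exists c : 'I_N -> K,
  gen_ideal p ('X_[m] - \sum_j c j *: Z (mdeg m - N) j).
Proof.
move=> Dm; have [|m1 [m2 [mE m1M]]] := @split_monomial _ m M.
  by apply: leq_trans Dm; rewrite /D0 -addnA leq_addr.
pose b := (mdeg m - N - M - M)%N.
have dm : mdeg m = (M + mdeg m2)%N by rewrite mE mdegD m1M.
have [e1 e2] : (mdeg m - N = M + (M + b) /\ mdeg m2 = M + b + N)%N.
  by rewrite /b; rewrite /D0 in Dm; lia.
pose al j := 'X_[K, m2].@[pts j]; pose be j := 'X_[K, m1].@[pts j].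
exists (fun j => al j * be j).
have -> : 'X_[m] - \sum_j (al j * be j) *: Z (mdeg m - N) j =
   'X_[m1] * ('X_[m2] - \sum_j al j *: Z (M + b) j) +
   \sum_j al j *: (Y j ^+ M * ('X_[m1] * Z b j - be j *: Z (M + b) j)).
  rewrite {1}mE mpolyXD mulrBr mulr_sumr -addrA; congr (_ + _).
  rewrite -!sumrN -big_split; apply: eq_bigr => j _.
  rewrite /= mulrBr -!scalerAr YZ mulrCA YZ -e1 scalerBr scalerA.
  by rewrite addrA addNr add0r.
apply: gen_idealD.
  apply: (killM m1M (d := (M + b + N)%N)).
    apply: rpredB; first by rewrite -e2; exact: homogX.
    by apply: rpred_sum => j _; apply/rpredZ/Z_homog.
  move=> i; rewrite mevalB (raddf_sum (meval _)) (bigD1 i) //= mevalZ Z_eval eqxx mulr1.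
  rewrite big1 ?addr0 ?subrr // => j /negbTE ji.
  by rewrite mevalZ Z_eval eq_sym ji mulr0.
apply: gen_ideal_sum => j _; rewrite -mul_mpolyC; apply: gen_idealMl.
apply: (@kill_homog _ (M + b + N)%N).
- by rewrite -[M in M.-homog]mul1n; apply: dhomogMn.
- apply: rpredB; last by apply/rpredZ/Z_homog.
  by rewrite -addnA; apply: dhomogM; rewrite -?m1M ?homogX ?Z_homog.
- move=> i; rewrite mevalB mevalM mevalZ !Z_eval; case: eqP => [->|_].
    by rewrite !mulr1 subrr.
  by rewrite !mulr0 subrr.
Qed.

(** Two families of generators: products of the [p i] times one of N interpolating forms, and
    products times a monomial of bounded degree. Only the first matters to leading order in [D]. *)
Definition span_gen D (x : {mpoly K[n.+2]}) := exists a : 'I_n.+1 -> nat,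
  (exists j, (pdeg a + N <= D)%N /\ x = pmon a * Z (D - N - pdeg a) j) \/
  (exists m : 'X_{1..n.+2 < D0}, (pdeg a + mdeg m = D)%N /\ x = pmon a * 'X_[m]).

Lemma span_gen_mul D i x : (r i <= D)%N -> span_gen (D - r i) x -> span_gen D (x * p i).
Proof.
move=> rD [a H]; pose a' l := (a l + (l == i))%N.
have pa : pmon a' = pmon a * p i.
  rewrite /pmon (bigD1 i) //= [in RHS](bigD1 i) //= /a' eqxx addn1 exprSr -!mulrA.
  congr (_ * _); rewrite [in RHS]mulrC; congr (_ * _); apply: eq_bigr => l /negbTE ->.
  by rewrite addn0.
have da : pdeg a' = (pdeg a + r i)%N.
  rewrite /pdeg (bigD1 i) //= [in RHS](bigD1 i) //= /a' eqxx addn1 mulnS.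
  rewrite (eq_bigr (fun l => r l * a l)%N) => [|l /negbTE ->]; first by lia.
  by rewrite addn0.
exists a'; case: H => [[j [h ->]]|[m [h ->]]]; [left; exists j|right; exists m].
  split; first by rewrite da; lia.
  by rewrite pa mulrAC da; congr (_ * Z _ j); lia.
by split; [rewrite da; lia|rewrite pa mulrAC].
Qed.

(** Strong induction on the degree: a reduced monomial leaves interpolating forms plus a combination
    of the [p i] with homogeneous coefficients of smaller degree. *)
Lemma span_homog D q : q \is D.-homog -> lspan (span_gen D) q.
Proof.
move: {2}D.+1 (ltnSn D) => B; elim: B D q => // B IH D q DB hq.
rewrite (mpolyE q) big_seq; apply: lspan_sum => m mq; apply: lspanZ.
have mD : mdeg m = D by move/dhomogP: hq; apply.
have pm0 : pmon (fun=> 0%N) = 1 by rewrite /pmon big1 // => i _; rewrite expr0.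
have pd0 : pdeg (fun=> 0%N) = 0%N by rewrite /pdeg big1 // => i _; rewrite muln0.
have [lt|ge] := ltnP (mdeg m) D0.
  apply: lspan_in; exists (fun=> 0%N); right; exists (BMultinom lt).
  by rewrite pm0 mul1r pd0.
have [c hc] := reduce_monomial ge.
rewrite -['X_[m]](subrK (\sum_j c j *: Z (mdeg m - N) j)); apply: lspanD; last first.
  apply: lspan_sum => j _; apply/lspanZ/lspan_in; exists (fun=> 0%N); left; exists j.
  rewrite pm0 mul1r pd0 add0n subn0 mD; split=> //.
  by rewrite -mD; apply: leq_trans ge; rewrite /D0 leq_addl.
set t := 'X_[m] - _ in hc *.
have ht : t \is D.-homog.
  apply: rpredB; first by rewrite -mD; exact: homogX.
  apply: rpred_sum => j _; apply: rpredZ.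
  have -> : D = (mdeg m - N + N)%N; last exact: Z_homog.
  by rewrite subnK // (leq_trans _ ge) // /D0 leq_addl.
have [a [-> ha]] := homog_gen_ideal p_homog ht hc.
apply: lspan_sum => i _; have [h1 h2] := ha i.
have [Dr|rD] := ltnP D (r i); first by rewrite h2 // mul0r; apply: lspan0.
apply: (lspan_sub (S := span_gen (D - r i)) (f := fun x => x * p i)).
- by move=> b x y; rewrite mulrDl scalerAl.
- by rewrite mul0r.
- by move=> x Sx; apply/lspan_in/span_gen_mul.
by apply: IH; [rewrite -ltnS (leq_trans _ DB) // ltnS ltn_subrL r_pos (leq_trans (r_pos i) rD)|
  exact: h1].
Qed.

(** In the second family the total degree determines the exponent of the first [p i] from the
    others, which leaves O(D^n) generators against the order D^(n+1) of the first family. *)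
Definition last_exponent D (b : {ffun 'I_n -> 'I_D.+1}) (m : 'X_{1..n.+2 < D0})
    (i : 'I_n.+1) : nat :=
  if unlift ord0 i is Some k then b k
  else ((D - mdeg m - \sum_k r (lift ord0 k) * b k) %/ r ord0)%N.

Definition span_list D : seq {mpoly K[n.+2]} :=
  [seq pmon (fun i => nat_of_ord (a i)) * Z (D - N - pdeg (fun i => nat_of_ord (a i))) j |
     a : {ffun 'I_n.+1 -> 'I_D.+1} <-
       enum [set a : {ffun 'I_n.+1 -> 'I_D.+1} | (\sum_i r i * a i <= D)%N],
     j : 'I_N <- enum 'I_N] ++
  [seq pmon (last_exponent b m) * 'X_[bmnm m] |
     b : {ffun 'I_n -> 'I_D.+1} <- enum {: {ffun 'I_n -> 'I_D.+1}},
     m : 'X_{1..n.+2 < D0} <- enum {: 'X_{1..n.+2 < D0}}].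

Lemma span_gen_list D x : span_gen D x -> x \in span_list D.
Proof.
have small a i : (pdeg a <= D)%N -> (a i < D.+1)%N.
  rewrite ltnS => h; apply: leq_trans h; rewrite /pdeg (bigD1 i) //=.
  by apply: leq_trans (leq_addr _ _); rewrite leq_pmull.
case=> a [[j [aD ->]]|[m [aD ->]]]; rewrite mem_cat; apply/orP.
  have {}aD : (pdeg a <= D)%N by apply: leq_trans aD; rewrite leq_addr.
  left; pose b : {ffun 'I_n.+1 -> 'I_D.+1} := [ffun i => inord (a i)].
  have ba : (fun i => (b i : nat)) = a.
    by apply: boolp.funext => i; rewrite ffunE inordK // small.
  apply/allpairsP; exists (b, j); split=> /=; rewrite ?mem_enum //.
    by rewrite inE; have := aD; rewrite -{1}ba.
  by rewrite ba.
right; have aD' : (pdeg a <= D)%N by rewrite -aD leq_addr.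
pose b : {ffun 'I_n -> 'I_D.+1} := [ffun k => inord (a (lift ord0 k))].
apply/allpairsP; exists (b, m); split; rewrite ?mem_enum //=.
have -> // : last_exponent b m = a.
apply: boolp.funext => i; rewrite /last_exponent; case: unliftP => [k ->|->].
  by rewrite ffunE inordK // small.
have -> : (D - mdeg m = pdeg a)%N by rewrite -aD addnK.
have -> : (\sum_k r (lift ord0 k) * b k = \sum_k r (lift ord0 k) * a (lift ord0 k))%N.
  by apply: eq_bigr => k _; rewrite ffunE inordK // small.
by rewrite /pdeg big_ord_recl addnK mulKn.
Qed.

(** The forms of degree D have dimension about D^(n+1) / (n+1)!. The first family has at most N
    times about D^(n+1) / ((n+1)! R) members by [weighted_count], R being the product of the
    degrees; leading coefficients give R at most N. *)
Lemma prod_leq_points : (\prod_i r i <= N)%N.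
Proof.
pose H := #|{: 'X_{1..n.+2 < D0}}|; set R := (\prod_i r i)%N.
apply: (@asymptotic_leq _ _ (\sum_i r i + n.+1) (R * n.+1`! * H) n) => D.
set A := [set a : {ffun 'I_n.+1 -> 'I_D.+1} | (\sum_i r i * a i <= D)%N].
have cA : (#|A| * R <= 'C(D + \sum_i r i + n.+1, n.+1))%N := weighted_count D r_pos.
have sz : ('C(D + n.+1, n.+1) <= #|A| * N + D.+1 ^ n * H)%N.
  rewrite -size_monomials; set ms := monomials _ _.
  have -> : (#|A| * N + D.+1 ^ n * H = size (span_list D))%N.
    rewrite size_cat !size_allpairs -!cardE cardsE card_ord card_ffun !card_ord.
    by congr (_ * _ + _)%N; apply: eq_card => a; rewrite !inE.
  rewrite -[size ms]card_ord.
  apply: (lspan_size (S := span_gen D)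
    (x := fun i : 'I_(size ms) => 'X_[nth 0%MM ms i] : {mpoly K[n.+2]})).
  - exact: span_gen_list.
  - move=> i; apply: span_homog; have := mem_nth 0%MM (ltn_ord i).
    by rewrite mem_monomials => /eqP mD; rewrite -[in _.-homog]mD; exact: homogX.
  - move=> u /(congr1 (fun q => fun i : 'I_(size ms) => q@_(nth 0%MM ms i))) E i.
    have := congr1 (fun q => q i) E.
    rewrite mcoeff0 raddf_sum (bigD1 i) //= mcoeffZ mcoeffX eqxx mulr1.
    rewrite big1 ?addr0 // => j ji; rewrite mcoeffZ mcoeffX nth_uniq ?uniq_monomials //.
    by rewrite (inj_eq val_inj) (negbTE ji) mulr0.
have h1 := bin_lower D n.+1; have h2 := bin_upper (D + \sum_i r i) n.+1.
have h3 : (D.+1 + (\sum_i r i + n.+1) = (D + \sum_i r i + n.+1).+1)%N by lia.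
have h4 : ((D + \sum_i r i + n.+1) ^ n.+1 <= (D.+1 + (\sum_i r i + n.+1)) ^ n.+1)%N.
  by rewrite h3 leq_exp2r.
apply: leq_trans (leq_mul (leqnn R) h1) _.
apply: leq_trans (_ : R * ((#|A| * N + D.+1 ^ n * H) * n.+1`!) <= _)%N.
  by rewrite leq_mul2l leq_mul2r sz !orbT.
have -> : (R * ((#|A| * N + D.+1 ^ n * H) * n.+1`!) =
   N * ((#|A| * R) * n.+1`!) + R * n.+1`! * H * D.+1 ^ n)%N by ring.
rewrite leq_add2r leq_mul2l; apply/orP; right.
apply: leq_trans h4; apply: leq_trans h2.
by rewrite leq_mul2r cA orbT.
Qed.

End Spanning.

Theorem prod_degrees_leq : (\prod_i r i <= N)%N.
Proof.
have [M killM] := kill_monomials.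
have [Z [Y [hZ eZ hY YZ]]] := interpolating_forms.
exact: (prod_leq_points hZ eZ hY YZ killM).
Qed.

End LowerBound.

(** * The upper bound on the number of lines *)

Lemma card_bmultinom n A : #|{: 'X_{1..n < A.+1}}| = 'C(A + n, n).
Proof.
rewrite -size_monomials.
pose F (m : 'X_{1..n < A.+1}) : 'X_{1..n.+1} :=
  [multinom (if unlift ord0 i is Some k then bmnm m k else A - mdeg m)%N | i < n.+1].
have F0 m : F m ord0 = (A - mdeg m)%N by rewrite mnmE unlift_none.
have FS m k : F m (lift ord0 k) = bmnm m k by rewrite mnmE liftK.
rewrite cardE -(size_map F); apply: perm_size; apply: uniq_perm.
- rewrite map_inj_uniq ?enum_uniq // => x y e; apply: val_inj; apply/mnmP => k.
  by rewrite /= -!FS e.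
- exact: uniq_monomials.
move=> m; rewrite mem_monomials; apply/mapP/eqP => [[x _ ->]|mA].
  rewrite mdegE big_ord_recl F0; under eq_bigr do rewrite FS.
  by rewrite -mdegE subnK // -ltnS; exact: (valP x).
pose m' : 'X_{1..n} := [multinom m (lift ord0 k) | k < n].
have md : (m ord0 + mdeg m' = A)%N.
  rewrite -mA !mdegE big_ord_recl; congr (_ + _)%N; apply: eq_bigr => k _.
  by rewrite mnmE.
have lt : (mdeg m' < A.+1)%N by lia.
exists (BMultinom lt); rewrite ?mem_enum //; apply/mnmP => i.
case: (unliftP ord0 i) => [k ->|->]; rewrite ?FS ?F0 /= ?mnmE //; lia.
Qed.

Section Translation.
Variables (K : fieldType) (n : nat) (a : 'I_n -> K).
Implicit Type p : {mpoly K[n]}.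

Definition trans p : {mpoly K[n]} := p \mPo [tuple 'X_i + (a i)%:MP | i < n].

Lemma trans_eval p v : (trans p).@[v] = p.@[fun i => v i + a i].
Proof.
rewrite comp_mpoly_meval; apply: meval_eq => i.
by rewrite tnth_mktuple mevalD mevalXU mevalC.
Qed.

Lemma mderiv_trans k p : mderiv k (trans p) = trans (mderiv k p).
Proof.
rewrite /trans (der_comp (mderiv_derivation K k)) (bigD1 k) //= tnth_mktuple.
rewrite mderivD mderivC mderivXU eqxx addr0 mulr1 big1 ?addr0 // => i /negbTE ik.
by rewrite tnth_mktuple mderivD mderivC mderivXU ik addr0 mulr0.
Qed.

End Translation.

(** * An affine Bezout bound for nondegenerate zeros *)

Section NondegenerateZeros.
Variables (K : numClosedFieldType) (n N m : nat).
Variables (F : 'I_n.+1 -> {mpoly K[n.+1]}) (a : 'I_N -> 'I_n.+1 -> K).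
Hypothesis F_size : forall i, (msize (F i) <= m.+1)%N.
Hypothesis a_inj : forall i j, (forall l, a i l = a j l) -> i = j.
Hypothesis F_zero : forall i j, (F i).@[a j] = 0.
Hypothesis F_nondeg : forall j u, (forall i, grad (F i) (a j) u = 0) -> forall l, u l = 0.

Lemma separating_polynomials : exists e : 'I_N -> {mpoly K[n.+1]},
  forall i j, (e j).@[a i] = (i == j)%:R.
Proof.
have H (ij : 'I_N * 'I_N) : exists l : {mpoly K[n.+1]},
    l.@[a ij.2] = 1 /\ (ij.1 != ij.2 -> l.@[a ij.1] = 0).
  case: ij => i j /=; have [->|ij] := eqVneq i j.
    by exists 1; rewrite meval1.
  have [k ak] : exists k, a i k != a j k.
    apply: boolp.contrapT => no; case/eqP: ij; apply: a_inj => k.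
    by apply/eqP; apply/negPn/negP => h; apply: no; exists k.
  exists ((a j k - a i k)^-1 *: ('X_k - (a i k)%:MP)).
  rewrite !mevalZ !mevalB !mevalXU !mevalC subrr mulr0 mulVf //.
  by rewrite subr_eq0 eq_sym.
have [l Hl] := boolp.choice H; exists (fun j => \prod_i l (i, j)) => i j.
rewrite rmorph_prod /=; have [->|ij] := eqVneq i j.
  by rewrite big1 // => k _; case: (Hl (k, j)).
by rewrite (bigD1 i) //= (Hl (i, j)).2 ?mul0r.
Qed.

Definition Fmon (b : 'X_{1..n.+1}) := \prod_i F i ^+ b i.

Lemma Fmon_size b : (msize (Fmon b) <= (m * mdeg b).+1)%N.
Proof.
rewrite mdegE big_distrr /= /Fmon; elim/big_rec2: _ => [|i x p _ IH]; first by rewrite msize1.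
apply: msizeM_leq => //; elim: (b i) => [|k IHk]; first by rewrite expr0 muln0 msize1.
by rewrite exprS mulnS; apply: msizeM_leq.
Qed.

(** Translating the zero to the origin and inverting the Jacobian turns [F i] into x_i plus terms of
    order 2. *)
Lemma local_coordinates j : exists phi : {mpoly K[n.+1]} -> {mpoly K[n.+1]},
  [/\ forall p, (phi p).@[fun=> 0] = p.@[a j], forall b, ordge (mdeg b).+1 (phi (Fmon b) - 'X_[b]),
   forall p q, phi (p * q) = phi p * phi q & forall (I : finType) c (G : I -> {mpoly K[n.+1]}),
   phi (\sum_i c i *: G i) = \sum_i c i *: phi (G i)].
Proof.
pose B : 'M[K]_n.+1 := \matrix_(i, t) (mderiv t (F i)).@[a j].
have gB i u : mact B u i = grad (F i) (a j) u.
  by apply: eq_bigr => t _; rewrite mxE.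
have uB : B \in unitmx.
  by apply: unit_of_injective => u Hu; apply: (F_nondeg (j := j)) => i; rewrite -gB.
pose T := invmx B; pose phi p := lsub T (trans (a j) p).
have ph0 p : (phi p).@[fun=> 0] = p.@[a j].
  rewrite lsub_eval trans_eval; apply: meval_eq => i.
  by rewrite /mact big1 ?add0r // => l _; rewrite mulr0.
have phM p q : phi (p * q) = phi p * phi q by rewrite /phi /trans rmorphM lsubM.
have ph1 : phi 1 = 1 by rewrite /phi /trans rmorph1; exact: lsubC.
exists phi; split=> // [b|I c G]; last first.
  rewrite /phi /trans raddf_sum lsub_sum; apply: eq_bigr => i _.
  by rewrite /= comp_mpolyZ lsubZ.
have phX p k : phi (p ^+ k) = phi p ^+ k.
  by elim: k => [|k IH]; rewrite ?expr0 // !exprS phM IH.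
rewrite /Fmon (big_morph phi phM ph1).
rewrite (eq_bigr (fun i => phi (F i) ^+ b i)) => [|i _]; last exact: phX.
apply: prod_lowest => i.
have o1 : ordge 1 (phi (F i)) by apply/ordge1P; rewrite ph0 F_zero.
have := linear_part o1; rewrite [X in _ - X](_ : _ = 'X_i) //.
have d l : (mderiv l (phi (F i))).@[fun=> 0] = (B *m T) i l.
  rewrite mderiv_lsub (raddf_sum (meval _)) mxE; apply: eq_bigr => k _.
  rewrite /= mevalZ mderiv_trans -/(phi _) ph0 mxE mulrC //.
rewrite (bigD1 i) //= d mulmxV // mxE eqxx scale1r big1 ?addr0 // => l il.
by rewrite d mulmxV // mxE eq_sym (negbTE il) scale0r.
Qed.

(** In a relation, take a term of least degree of [b] and pass to its zero. Terms with another
    separator gain an order there; terms with the same separator have other lowest monomials. The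
    coefficient of x^b then isolates one unknown. *)
Lemma Fmon_free (A : nat) (e : 'I_N -> {mpoly K[n.+1]}) (u : 'X_{1..n.+1 < A} * 'I_N -> K) :
  (forall i j, (e j).@[a i] = (i == j)%:R) ->
  \sum_x u x *: (Fmon (bmnm x.1) * e x.2) = 0 -> forall x, u x = 0.
Proof.
move=> He U0 x0; apply/eqP; apply/negPn/negP => ux0.
have [x ux xmin] := @arg_minnP _ x0 (fun y => u y != 0)
  (fun y : 'X_{1..n.+1 < A} * 'I_N => mdeg y.1) ux0.
have [phi [ph0 phF phM phS]] := local_coordinates x.2.
have oF b : ordge (mdeg b) (phi (Fmon b)).
  rewrite -[phi _](subrK 'X_[b]); apply: ordgeD; last exact: ordgeX.
  exact: ordgeW (leqnSn _) (phF b).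
have low b q : q.@[a x.2] = 1 -> ordge (mdeg b).+1 (phi (Fmon b * q) - 'X_[b]).
  move=> q1; rewrite phM.
  have -> : phi (Fmon b) * phi q - 'X_[b] =
      'X_[b] * (phi q - 1) + (phi (Fmon b) - 'X_[b]) * phi q by ring.
  apply: ordgeD; last exact/ordgeMl/phF.
  rewrite -[(mdeg b).+1]addn1; apply: ordgeM; first exact: ordgeX.
  by apply/ordge1P; rewrite mevalB meval1 ph0 q1 subrr.
have coef b q b' : q.@[a x.2] = 1 -> mdeg b' = mdeg b ->
    (phi (Fmon b * q))@_b' = (b == b')%:R.
  move=> q1 bb; have := low b q q1 b'; rewrite bb ltnSn mcoeffB mcoeffX => /(_ isT)/eqP.
  by rewrite subr_eq0 => /eqP.
case/eqP: ux; have := congr1 (fun p => (phi p)@_(bmnm x.1)) U0.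
have -> : phi 0 = 0.
  by have := phS _ (fun _ : 'I_0 => 0) (fun=> 0); rewrite !big_ord0.
rewrite mcoeff0 phS raddf_sum (bigD1 x) //= mcoeffZ coef ?He ?eqxx // mulr1.
rewrite big1 ?addr0 // => y yx.
rewrite mcoeffZ; have [->|uy] := eqVneq (u y) 0; first by rewrite mul0r.
suff -> : (phi (Fmon (bmnm y.1) * e y.2))@_(bmnm x.1) = 0 by rewrite mulr0.
have [ey|ney] := eqVneq y.2 x.2; last first.
  have o1 : ordge 1 (phi (e y.2)) by apply/ordge1P; rewrite ph0 He eq_sym (negbTE ney).
  by rewrite phM (ordgeM (oF _) o1) // [(_ + 1)%N]addn1 ltnS; exact: xmin.
have [mxy|ne] := eqVneq (mdeg x.1) (mdeg y.1); last first.
  by rewrite phM (ordgeMl _ (oF _)) // ltn_neqAle ne; exact: xmin.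
rewrite coef ?He ?ey ?eqxx //; case: (_ =P _) => // E; case/eqP: yx.
by apply: injective_projections => //; apply: val_inj.
Qed.

(** The products with b of degree at most A live in degree at most m A + E, where E bounds the sizes
    of the separators; E disappears in the leading coefficient in A. *)
Theorem nondegenerate_zeros_leq : (0 < m)%N -> (N <= m ^ n.+1)%N.
Proof.
move=> m0; have [e He] := separating_polynomials.
pose E := (\max_j msize (e j))%N.
apply: (@asymptotic_leq _ _ (E + n.+1) 0 n) => A; rewrite mul0n addn0.
have H : ('C(A + n.+1, n.+1) * N <= 'C(m * A + E + n.+1, n.+1))%N.
  rewrite -!card_bmultinom -[N in (_ * N)%N]card_ord -card_prod.
  pose x (y : 'X_{1..n.+1 < A.+1} * 'I_N) := Fmon (bmnm y.1) * e y.2.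
  apply: (span_card (x := x) (y := fun b : 'X_{1..n.+1 < (m * A + E).+1} => 'X_[bmnm b])
    (c := fun y b => (x y)@_(bmnm b))) => [y|u]; last exact: Fmon_free.
  apply: mpolywE; apply: msizeM_leq.
    apply: leq_trans (Fmon_size _) _; rewrite ltnS leq_mul2l -ltnS; apply/orP; right.
    exact: (valP y.1).
  by apply: leqW; rewrite /E (bigD1 y.2) //= leq_maxl.
have h1 := bin_lower A n.+1; have h2 := bin_upper (m * A + E) n.+1.
apply: leq_trans (leq_mul (leqnn N) h1) _.
rewrite mulnA [(N * _)%N]mulnC; apply: leq_trans (leq_mul H (leqnn _)) _.
apply: leq_trans h2 _; rewrite -expnMn leq_exp2r //; nia.
Qed.

End NondegenerateZeros.

Lemma distinct_unity_roots (K : numClosedFieldType) q : (0 < q)%N ->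
  exists z : 'I_q -> K, injective z /\ forall i, z i ^+ q = 1.
Proof.
move=> q0; have [r rE] := closed_field_poly_normal ('X^q - 1 : {poly K}).
have lc : lead_coef ('X^q - 1 : {poly K}) = 1 by apply/eqP; exact: monic_Xn_sub_1.
rewrite lc scale1r in rE.
have ur : uniq r.
  by rewrite -separable_prod_XsubC -rE separable_Xn_sub_1 // pnatr_eq0 -lt0n.
have sr : size r = q.
  by have := size_Xn_sub_1 K q0; rewrite rE size_prod_XsubC => -[].
exists (fun i => r`_i); split=> [i j /eqP|i].
  by rewrite nth_uniq ?sr // => /eqP/val_inj.
have : root ('X^q - 1 : {poly K}) r`_i by rewrite rE root_prod_XsubC mem_nth ?sr.
by rewrite rootE !hornerE ?hornerXn subr_eq0 => /eqP.
Qed.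

Lemma grad_linear (K : fieldType) n (p : {mpoly K[n]}) w u :
  p \is 1.-homog -> grad p w u = p.@[u].
Proof.
move=> hp; rewrite -[RHS]mul1r -(grad_euler u hp); apply: eq_bigr => l _; congr (_ * _).
have h0 := mderiv_homog l hp.
rewrite -[LHS]mul1r -[RHS]mul1r -(expr0 0) -!(homog_eval _ _ h0).
by apply: meval_eq => i; rewrite !mul0r.
Qed.

(** * Counting stationary lines of a homogeneous field *)

Section StationaryLines.
Variables (K : numClosedFieldType) (n N m : nat) (g : 'I_n.+1 -> {mpoly K[n.+1]}).
Variables (v : 'I_N -> 'I_n.+1 -> K) (c : 'I_N -> K).
Hypothesis g_homog : forall j, g j \is m.-homog.
Hypothesis v_neq0 : forall i, nonzero_pt (v i).
Hypothesis v_stat : forall i j, (g j).@[v i] = c i * v i j.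
Hypothesis v_distinct : forall i j b, (forall l, v j l = b * v i l) -> i = j.
Hypothesis nondeg : forall w a, nonzero_pt w -> (forall j, (g j).@[w] = a * w j) ->
  a != 0 /\ forall u b, (forall j, grad (g j) w u = a * u j + b * w j) ->
    exists b', forall l, u l = b' * w l.

Lemma stationary_value_neq0 i : c i != 0.
Proof. by have [] := nondeg (v_neq0 i) (v_stat i). Qed.

(** A field of degree 0 is constant, so c_i v_i = c_j v_j for all i and j. *)
Lemma stationary_lines_leq0 : m = 0%N -> (N <= 1)%N.
Proof.
move=> m0; rewrite leqNgt; apply/negP => N1.
have eq (i j : 'I_N) : i = j.
  apply: (v_distinct (b := c i / c j)) => l.
  have e : (g l).@[v i] = (g l).@[v j].
    have h := g_homog l; rewrite m0 in h.
    rewrite -[LHS]mul1r -[RHS]mul1r -(expr0 0) -!(homog_eval _ _ h).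
    by apply: meval_eq => t; rewrite !mul0r.
  by rewrite mulrAC -v_stat e v_stat mulrC mulrA mulVf ?mul1r // stationary_value_neq0.
by have := congr1 val (eq (Ordinal (ltnW N1)) (Ordinal N1)).
Qed.

(** The [v i] are eigenvectors of a linear map, and nondegeneracy makes each eigenspace a line, so
    the [c i] are distinct roots of the characteristic polynomial. *)
Lemma stationary_lines_leq1 : m = 1%N -> (N <= n.+1)%N.
Proof.
move=> m1; have h j : g j \is 1.-homog by rewrite -{1}m1.
have c_inj : injective c.
  move=> i j cij; have [_ nd] := nondeg (v_neq0 i) (v_stat i).
  have [l|b vb] := nd (v j) 0; last exact: v_distinct vb.
  by rewrite grad_linear // v_stat cij mul0r addr0.
pose A : 'M[K]_n.+1 := \matrix_(l, j) (mderiv l (g j)).@[fun=> 0].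
have cr i : root (char_poly A) (c i).
  rewrite -eigenvalue_root_char; apply/eigenvalueP.
  exists (\row_l v i l); last first.
    have [l vl] := v_neq0 i; apply: contraNneq vl => /rowP/(_ l)/eqP.
    by rewrite !mxE.
  apply/rowP => j; rewrite !mxE -v_stat -(grad_linear (fun=> 0)) //.
  by apply: eq_bigr => l _; rewrite !mxE mulrC.
have := @max_poly_roots _ (char_poly A) [seq c i | i <- enum 'I_N].
rewrite size_map size_enum_ord size_char_poly ltnS; apply.
- by rewrite -size_poly_eq0 size_char_poly.
- by apply/allP => _ /mapP[i _ ->].
- by rewrite map_inj_uniq ?enum_uniq.
Qed.

(** The multiple s v_i is fixed by g exactly when s = 0 or s^(m-1) = 1/c_i: each line carries m-1
    nonzero fixed points, and [None] stands for the origin shared by all lines. *)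
Lemma stationary_lines_leq2 : (1 < m)%N -> (N * m.-1 + 1 <= m ^ n.+1)%N.
Proof.
move=> m1; set q := m.-1; have q0 : (0 < q)%N by rewrite /q; lia.
have mq : m = q.+1 by rewrite prednK // ltnW.
have [z [z_inj zq]] := distinct_unity_roots K q0.
have z0 s : z s != 0.
  by apply/eqP => z0; have := zq s; rewrite z0 expr0n gtn_eqF // => /esym/eqP; rewrite oner_eq0.
pose t i := q.-root (c i)^-1.
have tq i : t i ^+ q = (c i)^-1 by rewrite rootCK.
have t0 i : t i != 0.
  apply/eqP => t0; have := tq i; rewrite t0 expr0n gtn_eqF // => /esym/eqP.
  by rewrite invr_eq0 (negbTE (stationary_value_neq0 i)).
pose P (x : option ('I_N * 'I_q)) (l : 'I_n.+1) : K :=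
  if x is Some y then z y.2 * t y.1 * v y.1 l else 0.
have Pstat x j : (g j).@[P x] = P x j.
  case: x => [[i s]|] /=; last first.
    have := homog_eval 0 (P None) (g_homog j); rewrite mq expr0n mul0r => <-.
    by apply: meval_eq => l; rewrite mulr0.
  rewrite (homog_eval _ _ (g_homog j)) v_stat mq exprS exprMn zq tq mul1r.
  by rewrite -mulrA [_^-1 * _]mulrA mulVf ?stationary_value_neq0 // mul1r.
have Pneq0 y : nonzero_pt (P (Some y)).
  by have [l vl] := v_neq0 y.1; exists l; rewrite /= !mulf_neq0.
have P_inj x y : (forall l, P x l = P y l) -> x = y.
  case: x y => [[i s]|] [[j s']|] H //; last 2 first.
  - by have [l] := Pneq0 (i, s); rewrite H eqxx.
  - by have [l] := Pneq0 (j, s'); rewrite -H eqxx.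
  have ij : j = i.
    apply: (v_distinct (b := (z s * t i)^-1 * (z s' * t j))) => l.
    by rewrite -mulrA -[_ * v j l](H l) /= mulrA mulVf ?mul1r // mulf_neq0.
  rewrite ij in H *; congr (Some (_, _)); apply: z_inj.
  have [l vl] := v_neq0 i; have := H l => /= /(mulIf vl).
  exact: mulIf.
pose F j := g j - 'X_j.
have gradF j w u : grad (F j) w u = grad (g j) w u - u j.
  rewrite /grad /F; under eq_bigr do rewrite mderivB mevalB mulrBl.
  rewrite sumrB; congr (_ - _); rewrite (bigD1 j) //= mderivXU eqxx meval1 mul1r.
  by rewrite big1 ?addr0 // => l lj; rewrite mderivXU eq_sym (negbTE lj) meval0 mul0r.
have -> : (N * m.-1 + 1 = #|{: option ('I_N * 'I_q)}|)%N.
  by rewrite card_option card_prod !card_ord addn1.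
apply: (@nondegenerate_zeros_leq K n _ m F (fun i => P (enum_val i))); last exact: ltnW.
- move=> j; apply: leq_trans (msizeD_le _ _) _; rewrite geq_max msizeN.
  by rewrite (homog_msize_le (g_homog j)) msizeX mdeg1 (leq_trans m1) // leqnSn.
- by move=> i j /P_inj/enum_val_inj.
- by move=> j i; rewrite /F mevalB mevalXU Pstat subrr.
move=> i; case: (enum_val i) => [y|] u Hu l.
  have st j : (g j).@[P (Some y)] = 1 * P (Some y) j by rewrite Pstat mul1r.
  have [_ nd] := nondeg (Pneq0 y) st.
  have gu j : grad (g j) (P (Some y)) u = u j.
    by apply/eqP; rewrite -subr_eq0 -gradF Hu.
  have [j|b ub] := nd u 0; first by rewrite gu mul1r mul0r addr0.
  have [k yk] := Pneq0 y; suff b0 : b = 0 by rewrite ub b0 mul0r.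
  (* Only the direction of the line remains; by Euler's identity Dg multiplies it by m at a fixed
     point, and m differs from 1. *)
  have gb : grad (g k) (P (Some y)) u = b * (m%:R * P (Some y) k).
    rewrite -[X in m%:R * X]Pstat -(grad_euler _ (g_homog k)) /grad mulr_sumr.
    by apply: eq_bigr => l' _; rewrite ub mulrCA.
  have : b * (m%:R - 1) * P (Some y) k = 0.
    by rewrite mulrBr mulr1 mulrBl -mulrA -gb gu ub subrr.
  move/eqP; rewrite mulf_eq0 (negbTE yk) orbF mulf_eq0 mq mulrS addrAC subrr add0r.
  by rewrite pnatr_eq0 gtn_eqF // orbF => /eqP.
(* At the origin Dg vanishes because m is at least 2, so the differential of [F] is minus the
   identity. *)
have := Hu l; rewrite gradF ordge2_grad0 ?sub0r; last first.
  by apply: ordgeW (homog_ordge (g_homog l)).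
by move/eqP; rewrite oppr_eq0 => /eqP.
Qed.

Theorem stationary_lines_leq : (N <= \sum_(i < n.+1) m ^ i)%N.
Proof.
case: (ltngtP m 1) => [|m1|m1].
- rewrite ltnS leqn0 => /eqP m0; apply: leq_trans (stationary_lines_leq0 m0) _.
  by rewrite m0 big_ord_recl leq_addr.
- have := stationary_lines_leq2 m1.
  have e : (m ^ n.+1 = (m ^ n.+1).-1 + 1)%N by rewrite addn1 prednK // expn_gt0 ltnW.
  have m0 : (0 < m.-1)%N by rewrite -subn1 subn_gt0.
  by rewrite e leq_add2r predn_exp mulnC leq_pmul2l.
- apply: leq_trans (stationary_lines_leq1 m1) _.
  rewrite (eq_bigr (fun=> 1%N)) => [|i _]; last by rewrite m1 exp1n.
  by rewrite sum_nat_const card_ord muln1.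
Qed.

End StationaryLines.

(** * Degrees of semi-invariants *)

(** Compare the parts of degree m + r - 1 in the equation for [q] of degree r. A nonzero cofactor
    has degree at most m - 1, and its part of that degree is the new cofactor. *)
Lemma top_form_semi (K : fieldType) n (f : 'I_n -> {mpoly K[n]}) m q :
  (forall i, (msize (f i) <= m.+1)%N) -> semi_invariant f q ->
  exists lam, Xder (topf f m) (hpart (tdeg q) q) = lam * hpart (tdeg q) q.
Proof.
move=> sf [nq [lam E]]; set r := tdeg q; set p := hpart r q.
have r0 : (0 < r)%N by move: nq; rewrite /nonconstant /r /tdeg; case: (msize q) => [|[]].
have sq : msize q = r.+1 by rewrite /r /tdeg prednK // (leq_trans _ nq).
have sd i : (msize (mderiv i q) <= r.-1.+1)%N by apply: msize_mderiv; rewrite prednK // sq.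
have -> : Xder (topf f m) p = hpart (m + r.-1) (Xder f q).
  rewrite /Xder hpart_sum; apply: eq_bigr => i _.
  by rewrite hpartM_top // hpart_mderiv prednK.
rewrite E; have [->|l0] := eqVneq lam 0; first by exists 0; rewrite !mul0r; exact: raddf0.
have q0 : q != 0 by apply: contraTneq nq => ->; rewrite /nonconstant msize0.
have : (msize (lam * q) <= (m + r.-1).+1)%N.
  by rewrite -E; apply: msize_sum_leq => i _; apply: msizeM_leq.
rewrite msizeM // sq addnS /= => sl.
have lp : (0 < msize lam)%N by rewrite lt0n msize_poly_eq0.
have rE : r.-1.+1 = r by rewrite prednK.
have slm : (msize lam <= m)%N by rewrite -(leq_add2r r) -[in X in (_ <= X)%N]rE addnS.
have m0 : (0 < m)%N := leq_trans lp slm.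
exists (hpart m.-1 lam); have -> : (m + r.-1 = m.-1 + r)%N by rewrite -{2}rE addnS -addSn prednK.
by rewrite hpartM_top ?prednK // sq.
Qed.

Definition distinct_lines (K : fieldType) n N (pts : 'I_N -> point K n) :=
  (forall i, nonzero_pt (pts i)) /\
  forall i j b, (forall l, pts j l = b * pts i l) -> i = j.

(** The bound guarantees a largest family, and a point on none of its lines would extend it. This is
    how finiteness of the set of common zero lines is obtained. *)
Lemma maximal_lines (K : fieldType) n (Z : point K n -> Prop) B :
  (forall N (pts : 'I_N -> point K n), distinct_lines pts -> (forall i, Z (pts i)) ->
     (N <= B)%N) ->
  exists N (pts : 'I_N -> point K n), [/\ distinct_lines pts, forall i, Z (pts i) &
    forall w, nonzero_pt w -> Z w -> exists j b, forall l, w l = b * pts j l].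
Proof.
move=> HB; pose P N := boolp.asbool
  (exists pts : 'I_N -> point K n, distinct_lines pts /\ forall i, Z (pts i)).
have P0 : exists N, P N.
  by exists 0%N; apply/boolp.asboolP; exists (fun=> fun=> 0); split; [split|] => -[].
have PB N : P N -> (N <= B)%N.
  by move=> /boolp.asboolP[pts [d z]]; exact: HB d z.
case: (ex_maxnP P0 PB) => N /boolp.asboolP[pts [[pn pd] pz]] Nmax.
exists N, pts; split=> // w wn wz; apply: boolp.contrapT => no.
have : P N.+1.
  apply/boolp.asboolP.
  pose pts' (i : 'I_N.+1) := if unlift ord0 i is Some k then pts k else w.
  have pS k : pts' (lift ord0 k) = pts k by rewrite /pts' liftK.
  have p0 : pts' ord0 = w by rewrite /pts' unlift_none.
  exists pts'; split; [split=> [i|i j b]|move=> i].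
  - by case: (unliftP ord0 i) => [k ->|->]; rewrite ?pS ?p0.
  - case: (unliftP ord0 i) => [k ->|->]; case: (unliftP ord0 j) => [k' ->|->] //;
      rewrite ?pS ?p0 => E.
    + by rewrite (pd _ _ _ E).
    + by case: no; exists k, b.
    + have b0 : b != 0.
        by apply/eqP => b0; have [l] := pn k'; rewrite E b0 mul0r eqxx.
      by case: no; exists k', b^-1 => l; rewrite E mulKf.
  - by case: (unliftP ord0 i) => [k ->|->]; rewrite ?pS ?p0.
by move=> /Nmax; rewrite ltnn.
Qed.

Theorem prod_degrees_bound (K : numClosedFieldType) n m
    (f : 'I_n.+2 -> {mpoly K[n.+2]}) (phi : 'I_n.+1 -> {mpoly K[n.+2]}) :
  uncountable_type K -> has_degree f m -> propE f m -> propS f m ->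
  (forall i, mirreducible (phi i)) ->
  (forall i j, i != j -> rel_prime (phi i) (phi j)) ->
  (forall i, semi_invariant f (phi i)) ->
  (\prod_i tdeg (phi i) <= \sum_(i < n.+2) m ^ i)%N.
Proof.
move=> uncK [sf _] Ef Sf irr cop semi.
pose r i := tdeg (phi i); pose p i := hpart (r i) (phi i); pose g := topf f m.
have nc i : (1 < msize (phi i))%N by case: (irr i).
have r_pos i : (0 < r i)%N by move: (nc i); rewrite /r /tdeg; case: (msize _) => [|[]].
have p_homog i : p i \is (r i).-homog by exact: hpart_homog.
have p_neq0 i : p i != 0.
  by apply: hpart_tdeg_neq0; apply: contraTneq (nc i) => ->; rewrite msize0.
have [lmb p_semi] := boolp.choice (fun i => top_form_semi sf (semi i)).
have trans v : nonzero_pt v -> in_line g v -> (forall i, (p i).@[v] = 0) ->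
    forall u, (forall i, grad (p i) v u = 0) -> exists b, forall i, u i = b * v i.
  move=> v0 [c vc] pv u; exact: (stationary_transversal _ sf Ef v0 vc irr cop semi pv).
have stat w : nonzero_pt w -> (forall i, (p i).@[w] = 0) -> in_line g w.
  exact: (common_zero_stationary uncK _ p_homog r_pos p_neq0 p_semi (erefl g) Sf trans).
have bound N (pts : 'I_N -> point K n.+2) : distinct_lines pts ->
    (forall j, forall i, (p i).@[pts j] = 0) -> (N <= \sum_(i < n.+2) m ^ i)%N.
  move=> [pn pd] pz; have [c Hc] := boolp.choice (fun j => stat _ (pn j) (pz j)).
  apply: (stationary_lines_leq (g := g) (v := pts) (c := c)) => //.
    by move=> j; apply: hpart_homog.
  by move=> w a w0 wa; apply: stationary_nondegenerate.
have [N [pts [[pn pd] pz pall]]]  :=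
  maximal_lines (Z := fun w => forall i, (p i).@[w] = 0) bound.
apply: leq_trans (bound _ _ (conj pn pd) pz).
apply: (prod_degrees_leq uncK p_homog r_pos pn _ pd) => [i j||]; [exact: pz|exact: pall|].
by move=> w w0 pw; apply: trans => //; apply: stat.
Qed.

Theorem theorem3p4 (R : realType) (n m : nat)
  (f : 'I_n -> {mpoly (complex R)[n]})
  (phi : 'I_n.-1 -> {mpoly (complex R)[n]}) :
  has_degree f m ->
  propE f m ->
  propS f m ->
  (forall i, mirreducible (phi i)) ->
  (forall i j, i != j -> rel_prime (phi i) (phi j)) ->
  (forall i, semi_invariant f (phi i)) ->
  (\prod_(i < n.-1) tdeg (phi i) <= \sum_(i < n) m ^ i)%N.
Proof.
(* Without variables [has_degree] fails for want of a nonzero component; with one variable the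
   product is empty and the sum contains m^0 = 1. *)
case: n f phi => [|[|n]] f phi fm; first by case: fm => _ [[]].
  by move=> *; rewrite big_ord0 big_ord_recl leq_addr.
exact: (prod_degrees_bound (@complex_uncountable R)).
Qed.
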